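(* There exist real polynomials $p_{k,d}(x)$, for $k\ge4$ and $0\le d\le k-1$, with $\deg p_{k,d}=k-d-1$ and with constant coefficients depending only on $k$ and $d$, such that for all integers $n\ge0$, $l\ge0$ with $(n,l)\ne(0,0)$, $$K_n^l=K_{n+2l-1}-\Bigl(\tfrac{l(l-1)}{2}n+\tfrac{(l+1)l(l-1)}{3}\Bigr)K_{n+2l-3}$$ $$+\,l(l-1)(l-2)(l-3)\Bigl(\tfrac18n^2+\tfrac{2l+1}{12}n+\tfrac{(l+1)(5l-2)}{90}\Bigr)K_{n+2l-5}$$ $$+\sum_{k=4}^{[l/2]+1}\left(\frac{(-1)^{k-1}}{2^{k-1}(k-1)!}\,\frac{l!}{(l-2k+2)!}\sum_{d=0}^{k-1}p_{k,d}(l)\,n^d\right)K_{n+2(l-k)+1}.$$ Here $K_m$ (one index) are the Bernoulli-Euler numbers and $K_n^l$ (two indices) are the numbers of connected components of the sets of very nice M-morsifications of $B_n^l$.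
   Context: The Bernoulli-Euler numbers $K_m$, $m\ge0$, are defined by $\sec t+\tan t=\sum_{m\ge0}K_m t^m/m!$ (so $1,1,1,2,5,16,61,\dots$). A term $c\cdot K_m$ with coefficient $c=0$ is understood to be $0$, even if $m<0$; $n^0=1$; an empty sum is $0$; $[\,\cdot\,]$ is the integer part. For an integer $n\ge 1$ let $P_n$ be the space of real polynomials of the form $x^n+\lambda_2x^{n-2}+\cdots+\lambda_{n-1}x$, with the topology of the coefficients $\lambda_i\in\mathbb R$ (so $P_1=\{x\}$, $P_2=\{x^2\}$). For $l\ge 0$ consider pairs $(f;b_1,\dots,b_l)\in P_n\times\mathbb R^l$; the $b_i$ are the (labelled) boundary points and the numbers $f(b_i)$ are the boundary values. Such a pair is a very nice M-morsification of $B_n^l$ if all $n-1$ critical points of $f$ (counted with multiplicity) are real and the $n-1$ critical values together with the $l$ boundary values are all pairwise distinct. $K_n^l$ is the number of connected components of the set of very nice M-morsifications of $B_n^l$, as a subspace of $P_n\times\mathbb R^l$. For $n=0$, $K_0^l$ (for $l\ge1$) is the number of connected components of the space of degree $0$ polynomials (the zero polynomial) with $l$ labelled real boundary points having pairwise distinct boundary values; thus $K_0^1=1$ and $K_0^l=0$ for $l\ge 2$. It is known (Arnold) that $K_n^0=K_{n-1}$ for $n\ge1$ and $K_n^1=K_{n+1}$ for $n\ge0$. *)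

(* Defs.v *)
From mathcomp Require Import all_boot all_order all_algebra finmap.
From mathcomp Require Import all_classical all_reals all_analysis.

Set Implicit Arguments.
Unset Strict Implicit.
Unset Printing Implicit Defensive.

Import Order.TTheory GRing.Theory Num.Theory.
Import numFieldNormedType.Exports.

Local Open Scope classical_set_scope.
Local Open Scope ring_scope.

(* Convergence is only required near 0; this already determines K. *)
Definition bernoulli_euler (R : realType) (K : nat -> R) : Prop :=
  \forall t \near (0 : R),
    series (fun m => K m * t ^+ m / (m`!)%:R) @ \oo --> (cos t)^-1 + tan t.

(* The value 0 at negative indices is a dummy: such an index only ever occurs
   with coefficient 0. *)
Definition int_index (R : realType) (K : nat -> R) (m : int) : R :=
  if m is Posz k then K k else 0.

(* For n >= 1 this is x^n + lambda_2 x^(n-2) + ... + lambda_(n-1) x, where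
   lambda_i is the entry a 0 (i - 2); for n = 0 it is the zero polynomial. *)
Definition morse_poly (R : realType) (n : nat) (a : 'rV[R]_(n - 2)) : {poly R} :=
  if n is 0 then 0 else 'X^n + \sum_(i < n - 2) a 0 i *: 'X^(n - 2 - i).

(* The tuple c lists the critical points with multiplicity: f' has leading
   coefficient n, so it splits over R iff it is n times a product of n - 1
   monic real linear factors.  For n = 0 the tuple is empty and f' = 0. *)
Definition very_nice (R : realType) (n l : nat)
    : set ('rV[R]_(n - 2) * 'rV[R]_l)%type :=
  [set ab : 'rV[R]_(n - 2) * 'rV[R]_l | let f := morse_poly ab.1 in
    exists2 c : n.-1.-tuple R,
      f^`() = n%:R *: \prod_(x <- c) ('X - x%:P) &
      uniq ([seq f.[x] | x <- c] ++ [seq f.[ab.2 0 i] | i : 'I_l])].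

Definition components (T : topologicalType) (A : set T) : set (set T) :=
  connected_component A @` A.

(* fset_set is empty on an infinite set, so this is the number of components
   only together with finiteness of components (very_nice n l). *)
Definition num_morsifications (R : realType) (n l : nat) : nat :=
  #|` fset_set (components (@very_nice R n l))|.

(* Main.v *)
(** Number the critical points by increasing abscissa. A very nice morsification
    then has a combinatorial type: the order of the abscissas and the order of
    the ordinates of its critical and boundary points. The set of the pairs of
    a given type is open. A polynomial x^n + ... without x^(n-1) term and with
    distinct real critical points is determined by its critical values, which
    can be any sequence that rises and falls alternately: the image of the map
    to the critical values is open by compactness and descent along the envelope
    theorem, and closed by compactness. The set of values with two preimages is
    likewise open and closed, and it is empty because it misses the values
    +1, -1, +1, ... of the Chebyshev polynomials. So the critical and boundary
    values map each type homeomorphically onto a convex set, and the components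
    are exactly the types.

    Counting them, K_n^l is l! times the number of words of n + l - 1 distinct
    letters, bordered by -oo or +oo on the left and by +oo on the right, that
    have n - 1 turning points. Inserting the largest letter gives the recurrence
    of the coefficients of the polynomials R_N such that R_N(sin) / cos^(N+1) is
    the N-th derivative of sec + tan. Hence K_n^l = l! [x^l] R_(n+l-1), so that
      K_n^(l+2) = K_(n+2)^(l+1) - (l+1) (n+2) K_(n+2)^l,
    and the formula follows by solving this recurrence from l = 0 and l = 1. *)

Require Import Defs.
From mathcomp Require Import all_boot all_order all_algebra all_fingroup.
From mathcomp Require Import zify ring lra.
From mathcomp Require polyrcf.

Set Implicit Arguments.
Unset Strict Implicit.
Unset Printing Implicit Defensive.

Import Order.TTheory GRing.Theory Num.Theory.

(** * Permutations by number of turning points *)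

Section Changes.
Implicit Types (e : nat -> bool) (N g : nat).

Definition changes e N := \sum_(0 <= j < N) (e j != e j.+1 : nat).

(* The up-down pattern of a word after inserting a letter larger than all the
   others at gap g; the number of turning points grows by 2 iff splits holds. *)
Definition insert_peak e N g : nat -> bool := fun j =>
  if j < g then e j
  else if j == g then (if g == 0 then e 0 else true)
  else if j == g.+1 then g == N
  else e j.-1.

Definition splits e N g : bool :=
  if e g then (g < N) && e g.+1 else (0 < g) && ~~ e g.-1.

Lemma changesS e N : changes e N.+1 = changes e N + (e N != e N.+1).
Proof. by rewrite /changes big_nat_recr. Qed.

Lemma changes0 e : changes e 0 = 0.
Proof. by rewrite /changes big_nil. Qed.

Lemma changes_le e N : changes e N <= N.
Proof. by elim: N => [|N IH]; rewrite ?changes0 // changesS; case: (_ != _); lia. Qed.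

Lemma changes_insert e N g : 0 < N -> e N -> g <= N ->
  changes (insert_peak e N g) N.+1 = changes e N + 2 * splits e N g.
Proof.
move=> N0 eN gN; set e' := insert_peak e N g.
have lt j : j < g -> e' j = e j by rewrite /e' /insert_peak => ->.
have eqg : e' g = (if g == 0 then e 0 else true) by rewrite /e' /insert_peak ltnn eqxx.
have eqg1 : e' g.+1 = (g == N).
  by rewrite /e' /insert_peak; do 2 (case: ifP; first by lia); rewrite eqxx.
have gt j : g < j -> e' j.+1 = e j.
  move=> gj; rewrite /e' /insert_peak; do 3 (case: ifP; first by lia).
  by [].
have pre n : n < g -> changes e' n = changes e n.
  elim: n => [|n IH] ng; first by rewrite !changes0.
  by rewrite !changesS IH ?lt //; lia.
have post n : g < n -> n <= N -> changes e' n.+1 = changes e n + 2 * splits e N g.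
  elim: n => [//|n IH]; rewrite ltnS leq_eqVlt => /orP[/eqP <-|gn] nN.
    rewrite changesS eqg1 (gt _ (ltnSn g)).
    have -> : (g == N) = false by lia.
    have {}nN : g < N by lia.
    case: (posnP g) => [g0|g0].
      rewrite g0 in eqg eqg1 *; rewrite !changesS !changes0 eqg eqg1 /splits.
      have -> : (0 == N) = false by lia.
      by rewrite N0 /=; case: (e 0); case: (e 1).
    have [h hg] : exists h, g = h.+1 by exists g.-1; lia.
    rewrite hg in eqg eqg1 nN pre lt *.
    rewrite !changesS (pre h) // (lt h) // eqg /splits nN /=.
    by case: (e h); case: (e h.+1); case: (e h.+2); lia.
  rewrite changesS (IH gn) ?(ltnW nN) // changesS !gt //; first lia.
  by rewrite ltnW.
move: gN; rewrite leq_eqVlt => /orP[/eqP gN|gN]; last by rewrite post.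
have [h hg] : exists h, g = h.+1 by exists g.-1; lia.
rewrite hg in eqg eqg1 gN pre lt *.
rewrite -gN in eN eqg1 *.
rewrite !changesS (pre h) // (lt h) // eqg eqg1 eqxx /splits eN ltnn /=; lia.
Qed.

Lemma sum_splits e N : \sum_(0 <= g < N.+1) splits e N g = N - changes e N.
Proof.
have -> : \sum_(0 <= g < N.+1) splits e N g =
  \sum_(0 <= g < N.+1) (e g && ((g < N) && e g.+1) : nat) + \sum_(0 <= g < N.+1) (~~ e g && ((0 < g) && ~~ e g.-1) : nat).
  by rewrite -big_split /=; apply: eq_bigr => g _; rewrite /splits; case: (e g) => /=; lia.
rewrite big_nat_recr //= ltnn andbF addn0 [X in _ + X]big_nat_recl //= andbF add0n -big_split /=.
suff h : \sum_(0 <= i < N) ((e i && ((i < N) && e i.+1)) + (~~ e i.+1 && ~~ e i)) + changes e N = N.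
  by apply/eqP; rewrite -(eqn_add2r (changes e N)) h subnK ?changes_le.
rewrite /changes -big_split /=.
rewrite (eq_big_nat _ _ (F2 := fun=> 1)); first by rewrite sum_nat_const_nat subn0 muln1.
by move=> i /andP[_ ->]; case: (e i); case: (e i.+1).
Qed.

End Changes.

Section PermWords.

Definition nat_of_perm N (s : {perm 'I_N}) (j : nat) : nat :=
  if insub j is Some a then val (s a) else j.

Lemma nat_of_permE N (s : {perm 'I_N}) (a : 'I_N) : nat_of_perm s a = s a.
Proof. by rewrite /nat_of_perm valK. Qed.

Lemma nat_of_perm_ge N (s : {perm 'I_N}) j : N <= j -> nat_of_perm s j = j.
Proof. by move=> Nj; rewrite /nat_of_perm insubF //; lia. Qed.

Lemma nat_of_perm_lt N (s : {perm 'I_N}) j : (nat_of_perm s j < N) = (j < N).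
Proof.
have [jN|jN] := ltnP j N; last by rewrite nat_of_perm_ge // ltnNge jN.
by rewrite (nat_of_permE s (Ordinal jN)) ltn_ord.
Qed.

(* The word s is completed by [d] on the left (true for -oo, false for +oo)
   and by +oo on the right. *)
Definition ascents N (d : bool) (s : {perm 'I_N}) (j : nat) : bool :=
  if j is j'.+1 then nat_of_perm s j' < nat_of_perm s j else d.

Lemma ascents_ge N d (s : {perm 'I_N}) j : 0 < j -> N <= j -> ascents d s j.
Proof.
case: j => // j _; rewrite leq_eqVlt => /orP[/eqP Nj|Nj].
  by rewrite /ascents (@nat_of_perm_ge _ s j.+1) ?Nj //; rewrite -Nj nat_of_perm_lt Nj.
by rewrite /ascents !nat_of_perm_ge // ltnW.
Qed.

Lemma nat_of_lift_perm N (g : 'I_N.+1) (s : {perm 'I_N}) j : j <= N ->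
  nat_of_perm (lift_perm g ord_max s) j =
  if j == g then N else nat_of_perm s (unbump g j).
Proof.
move=> jN; have jN1 : j < N.+1 by [].
rewrite -[j in LHS]/(val (Ordinal jN1)) nat_of_permE.
have [jg|jg] := eqVneq j g.
  have -> : Ordinal jN1 = g by apply: val_inj.
  by rewrite lift_perm_id.
have jg' : g != Ordinal jN1 by rewrite eq_sym; apply: contraNneq jg => <-.
have [k kE _] := unlift_some jg'.
rewrite kE lift_perm_lift /= /bump leqNgt ltn_ord add0n.
have -> : unbump g j = k :> nat by rewrite -[j]/(val (Ordinal jN1)) kE /= bumpK.
by rewrite nat_of_permE.
Qed.

Lemma ascents_lift N d (g : 'I_N.+1) (s : {perm 'I_N}) j : 0 < N -> j <= N.+1 ->
  ascents d (lift_perm g ord_max s) j = insert_peak (ascents d s) N g j.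
Proof.
move=> N0 jN; have gN : g <= N by rewrite -ltnS.
rewrite /insert_peak; case: ifP => [jg|jg].
  case: j jN jg => //= j jN jg.
  have uj i : i < g -> unbump g i = i by rewrite /unbump => ig; lia.
  rewrite !nat_of_lift_perm ?uj ?(leq_trans (ltnW jg)) //; try lia.
  by do 2 (case: eqP => [?|_]; first lia).
case: eqP => [->|ng].
  case: (posnP g) => [->|g0] //.
  have [h hg] : exists h, g = h.+1 :> nat by exists g.-1; lia.
  rewrite hg /= !nat_of_lift_perm ?hg; [|lia|lia].
  rewrite eqxx; have -> : (h == h.+1) = false by lia.
  by have -> : unbump h.+1 h = h; rewrite ?nat_of_perm_lt /unbump; lia.
case: eqP => [->|ng1].
  rewrite /= nat_of_lift_perm // eqxx; have [->|gN'] := eqVneq (g : nat) N.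
    by rewrite nat_of_perm_ge // ltnSn.
  rewrite nat_of_lift_perm; last by lia.
  have -> : (g.+1 == g) = false by lia.
  have -> : unbump g g.+1 = g by rewrite /unbump; lia.
  by apply/negbTE; rewrite -leqNgt ltnW // nat_of_perm_lt; lia.
case: j jN jg ng ng1 => [|[|i]] iN; [lia|lia|] => ig ng ng1.
move: iN; rewrite leq_eqVlt => /orP[/eqP iN|iN].
  by rewrite ascents_ge ?iN // ascents_ge //= -?iN; lia.
rewrite /= !nat_of_lift_perm; [|lia|lia].
do 2 (case: eqP => [?|_]; first lia).
by congr (nat_of_perm s _ < nat_of_perm s _); rewrite /unbump; lia.
Qed.

Definition word_changes N d (s : {perm 'I_N}) := changes (ascents d s) N.

Lemma word_changes_lift N d (g : 'I_N.+1) (s : {perm 'I_N}) : 0 < N ->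
  word_changes d (lift_perm g ord_max s) = word_changes d s + 2 * splits (ascents d s) N g.
Proof.
move=> N0; rewrite /word_changes -changes_insert //; last 2 first.
- by rewrite ascents_ge.
- by rewrite -ltnS.
by apply: eq_big_nat => i /andP[_ iN]; rewrite !ascents_lift //; lia.
Qed.

Lemma lift_perm_bij N : bijective (fun gs : 'I_N.+1 * {perm 'I_N} => lift_perm gs.1 ord_max gs.2).
Proof.
apply: inj_card_bij; last by rewrite card_prod card_ord !card_Sn factS.
move=> [g s] [g' s'] /= e.
have eg : g = g'.
  have : lift_perm g ord_max s g = ord_max by rewrite lift_perm_id.
  rewrite e; case: (unliftP g' g) => [k ->|-> //].
  by rewrite lift_perm_lift => /eqP; rewrite eq_sym (negbTE (neq_lift _ _)).
rewrite -{g'}eg in e *; congr (_, _); apply/permP => k.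
by apply: (@lift_inj _ ord_max); rewrite -!(lift_perm_lift g) e.
Qed.

Definition run_count N m :=
  \sum_(d : bool) \sum_(s : {perm 'I_N}) (word_changes d s == m : nat).

Lemma run_count_gt N m : N < m -> run_count N m = 0.
Proof.
move=> Nm; rewrite /run_count big1 // => d _; rewrite big1 // => s _.
have := changes_le (ascents d s) N; rewrite -/(word_changes d s); lia.
Qed.

Lemma run_countS N m : 0 < N ->
  run_count N.+1 m = m.+1 * run_count N m + (if m is k.+2 then (N - k) * run_count N k else 0).
Proof.
move=> N0; have -> : (if m is k.+2 then (N - k) * run_count N k else 0) =
  \sum_(d : bool) \sum_(s : {perm 'I_N}) ((N - word_changes d s) * (word_changes d s + 2 == m)).
  case: m => [|[|k]].
  - by rewrite big1 // => d _; rewrite big1 // => s _; rewrite addn2 muln0.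
  - by rewrite big1 // => d _; rewrite big1 // => s _; rewrite addn2 muln0.
  rewrite /run_count big_distrr /=; apply: eq_bigr => d _; rewrite big_distrr /=; apply: eq_bigr => s _.
  by rewrite addn2 !eqSS; case: eqP => [->|]; rewrite ?muln0.
rewrite /run_count big_distrr /= -big_split /=; apply: eq_bigr => d _.
rewrite (reindex _ (onW_bij _ (lift_perm_bij N))) /=.
rewrite -(pair_bigA _ (fun g s => (word_changes d (lift_perm g ord_max s) == m : nat))) /= exchange_big /=.
rewrite big_distrr /= -big_split /=; apply: eq_bigr => s _.
have wN : word_changes d s <= N := changes_le _ _.
transitivity (\sum_(g < N.+1) ((splits (ascents d s) N g) * (word_changes d s + 2 == m)
   + (~~ splits (ascents d s) N g) * (word_changes d s == m))).
  apply: eq_bigr => g _; rewrite word_changes_lift //.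
  by case: (splits _ _ _); rewrite /= ?addn0 ?mul1n ?mul0n ?addn0 ?add0n.
rewrite big_split -!big_distrl /= addnC.
have sp : \sum_(i < N.+1) splits (ascents d s) N i = N - word_changes d s.
  by rewrite -(big_mkord xpredT (fun i => splits (ascents d s) N i : nat)) sum_splits.
congr (_ + _); last by rewrite sp.
have -> : \sum_(i < N.+1) ~~ splits (ascents d s) N i = (word_changes d s).+1.
  have : \sum_(i < N.+1) splits (ascents d s) N i + \sum_(i < N.+1) ~~ splits (ascents d s) N i = N.+1.
    rewrite -big_split /= -[RHS]card_ord -sum1_card; apply: eq_bigr => i _.
    by case: (splits _ _ _).
  by rewrite sp; lia.
by case: eqP => [->|]; rewrite ?muln0.
Qed.

Lemma run_count1 m : run_count 1 m = (m <= 1).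
Proof.
rewrite /run_count big_bool /=.
have h d : \sum_(s : {perm 'I_1}) (word_changes d s == m : nat) = (~~ d == m :> nat).
  rewrite (big_pred1 1%g) => [|s]; last by apply/esym/eqP/permP => i; rewrite !ord1.
  rewrite /word_changes changesS changes0 (@ascents_ge _ _ _ 1) //=.
  by case: d.
by rewrite !h; case: (m) => [|[|]].
Qed.

End PermWords.

(** * Combinatorial types *)

Section AltConfig.
Variables m l : nat.
Local Notation I := 'I_(m + l).

Section Def.
Context {d d' : Order.disp_t} {T : orderType d} {T' : orderType d'}.
Implicit Types (x : I -> T) (u : I -> T').

Definition crit_ge x (t : T) := #|[set k : 'I_m | (t <= x (lshift l k))%O]|.

Definition no_crit_between x i j := [forall k : 'I_m, ~~ (x i < x (lshift l k) < x j)%O].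

(* x gives the abscissas and u the ordinates of m critical points (in
   increasing order of abscissa) and l other points of the graph of a function
   that tends to +oo at +oo and changes direction at the critical points. *)
Definition alt_config x u :=
  [forall i, forall j, (x i < x j)%O && no_crit_between x i j ==>
    ((u i < u j)%O == ~~ odd (crit_ge x (x j)))] &&
  [forall k : 'I_m, forall k' : 'I_m, (k < k') ==> (x (lshift l k) < x (lshift l k'))%O].

Lemma alt_configP x u : reflect
  ((forall i j, (x i < x j)%O -> (forall k, ~~ (x i < x (lshift l k) < x j)%O) ->
      (u i < u j)%O = ~~ odd (crit_ge x (x j))) /\
   (forall k k' : 'I_m, k < k' -> (x (lshift l k) < x (lshift l k'))%O)) (alt_config x u).
Proof.
apply: (iffP andP) => -[h1 h2]; split.
- move=> i j ij nk; have /forallP/(_ i)/forallP/(_ j) := h1.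
  by rewrite ij /= => /implyP h; apply/eqP/h/forallP.
- by move=> k k' kk; have /forallP/(_ k)/forallP/(_ k')/implyP := h2; apply.
- apply/forallP => i; apply/forallP => j; apply/implyP => /andP[ij /forallP nk].
  by rewrite h1.
- by apply/forallP => k; apply/forallP => k'; apply/implyP/h2.
Qed.
End Def.

Lemma alt_config_mono d1 d1' d2 d2' (T1 : orderType d1) (T1' : orderType d1')
    (T2 : orderType d2) (T2' : orderType d2') (x1 : I -> T1) (u1 : I -> T1')
    (x2 : I -> T2) (u2 : I -> T2') :
  (forall i j, (x1 i < x1 j)%O = (x2 i < x2 j)%O) ->
  (forall i j, (u1 i < u1 j)%O = (u2 i < u2 j)%O) ->
  alt_config x1 u1 = alt_config x2 u2.
Proof.
move=> hx hu; rewrite /alt_config; congr (_ && _); last first.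
  by apply: eq_forallb => k; apply: eq_forallb => k'; rewrite hx.
apply: eq_forallb => i; apply: eq_forallb => j; rewrite hx hu; congr (_ && _ ==> (_ == ~~ odd _)).
  by apply: eq_forallb => k; rewrite !hx.
by apply: eq_card => k; rewrite !inE !leNgt hx.
Qed.

Definition crit_pos (r : {perm I}) : {set I} := [set r (lshift l k) | k : 'I_m].

Definition crit_incr (r : {perm I}) := [forall k : 'I_m, forall k' : 'I_m, (k < k') ==> (r (lshift l k) < r (lshift l k'))].

Definition dir (M : {set I}) (j : nat) := ~~ odd #|[set x in M | j <= x]|.

Definition matches (M : {set I}) (s : {perm I}) :=
  [forall j : I, (0 < j) ==> (ascents true s j == dir M j)].

Lemma crit_geE (r : {perm I}) (j : nat) : crit_ge (fun i => r i : nat) j = #|[set x in crit_pos r | j <= x]|.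
Proof.
rewrite /crit_ge -(card_imset (f := fun k => r (lshift l k))); last first.
  by move=> k k' /perm_inj /lshift_inj.
apply: eq_card => x; rewrite !inE; apply/imsetP/andP.
  by move=> [k]; rewrite inE => kj ->; split => //; apply: imset_f.
by move=> [/imsetP[k _ ->] h]; exists k; rewrite ?inE.
Qed.

Lemma alt_config_perm (r s : {perm I}) :
  alt_config (fun i => r i : nat) (fun i => (r * s)%g i : nat) =
  crit_incr r && matches (crit_pos r) s.
Proof.
apply/alt_configP/andP => [[h1 h2]|[h2 h1]]; split.
- by apply/forallP => k; apply/forallP => k'; apply/implyP/h2.
- apply/forallP => j; apply/implyP => j0; apply/eqP.
  have j1 : j.-1 < m + l by have := ltn_ord j; lia.
  have [a e] : exists a : I, nat_of_ord j = a.+1 by exists (Ordinal j1); rewrite /= prednK.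
  have := h1 ((r^-1)%g a) ((r^-1)%g j); rewrite !permM !permKV => h.
  rewrite [X in ascents _ _ X]e /= -e !nat_of_permE [LHS]h ?crit_geE //; first by rewrite ltEnat /= e.
  by move=> k; rewrite !ltEnat /= e ltnS; lia.
- move=> i j ij nk; rewrite crit_geE -/(dir _ _) !permM.
  move: (r i) (r j) ij nk => a b ab nk.
  have nM t : a < t <= b -> dir (crit_pos r) t = dir (crit_pos r) b.
    move=> /andP[at_ tb]; congr (~~ odd _); apply: eq_card => x; rewrite !inE.
    case: imsetP => //= -[k _ ->]; have := nk k; rewrite !ltEnat /=; lia.
  have st t : a < t <= b -> ascents true s t = dir (crit_pos r) b.
    move=> tab; have tN : t < m + l by have := ltn_ord b; lia.
    have /forallP/(_ (Ordinal tN))/implyP/= := h1 => h; rewrite -(nM t) //; apply/eqP/h; lia.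
  rewrite !ltEnat /= -!nat_of_permE.
  have : forall c, a < c <= b -> (nat_of_perm s a < nat_of_perm s c) = dir (crit_pos r) b.
    elim=> // c IH; rewrite ltnS => /andP[]; rewrite leq_eqVlt => /orP[/eqP ac|ac] cb.
      by rewrite -(st c.+1) /= ?ac //; lia.
    have {}IH := IH ltac:(lia); have := st c.+1 ltac:(lia); rewrite /=.
    have inj : nat_of_perm s c != nat_of_perm s c.+1 /\ nat_of_perm s a != nat_of_perm s c.+1.
      have inj i1 i2 : i1 < m + l -> i2 < m + l -> i1 != i2 -> nat_of_perm s i1 != nat_of_perm s i2.
        move=> p1 p2; rewrite -[i1]/(val (Ordinal p1)) -[i2]/(val (Ordinal p2)) !nat_of_permE.
        by apply: contraNneq => /val_inj/perm_inj->.
      by have := ltn_ord b; split; apply: inj; lia.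
    move: inj IH => [/eqP i1 /eqP i2]; case: (dir _ _) => IH IH'; [lia|].
    lia.
  by move=> /(_ b); apply; rewrite leqnn andbT.
- by move=> k k' kk; have /forallP/(_ k)/forallP/(_ k')/implyP := h2; apply.
Qed.

End AltConfig.

Section CountAlt.
Variables m l : nat.
Local Notation I := 'I_(m + l).

Lemma dir_gt (M : {set I}) j : m + l <= j -> dir M j = true.
Proof.
move=> Nj; rewrite /dir (_ : [set _ in _ | _] = set0) ?cards0 //.
by apply/setP => x; rewrite !inE; have := ltn_ord x; case: (x \in M) => //=; lia.
Qed.

Lemma dirS (M : {set I}) (x : I) : (dir M x != dir M x.+1) = (x \in M).
Proof.
rewrite /dir; have -> : [set y in M | x <= y] = [set y in M | x < y] :|: ([set x] :&: M).
  apply/setP => y; rewrite !inE; case: (eqVneq y x) => [->|yx]; first by rewrite leqnn ltnn andbF andbT.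
  have {}yx : nat_of_ord y <> x by move/val_inj/eqP; apply/negP.
  by rewrite orbF; case: (y \in M) => //=; lia.
rewrite cardsU (_ : _ :&: ([set x] :&: M) = set0) ?cards0 ?subn0; last first.
  by apply/setP => y; rewrite !inE; case: eqVneq => [->|]; rewrite ?ltnn ?andbF.
rewrite oddD; have [xM|xM] := boolP (x \in M).
  by rewrite (setIidPl _) ?sub1set // cards1; case: (odd _).
by rewrite disjoint_setI0 ?cards0 ?addbF ?eqxx // disjoints1.
Qed.

Definition turning (d : bool) (s : {perm I}) : {set I} :=
  [set j : I | ascents d s j != ascents d s j.+1].

Lemma card_turning d s : #|turning d s| = word_changes d s.
Proof.
rewrite /word_changes /changes big_mkord -sum1_card big_mkcond /=.
by apply: eq_bigr => j _; rewrite inE; case: (_ != _).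
Qed.

Lemma dir_turning d s j : j <= m + l -> 0 < m + l -> dir (turning d s) j = ascents d s j.
Proof.
move=> jN N0; have [k] := ubnP (m + l - j); elim: k j jN => // k IH j jN jk.
move: jN; rewrite leq_eqVlt => /orP[/eqP->|jN].
  by rewrite dir_gt // ascents_ge.
have := dirS (turning d s) (Ordinal jN); rewrite inE -[nat_of_ord (Ordinal jN)]/j (IH j.+1) //; last by lia.
by case: (dir _ _) (ascents d s j) (ascents d s j.+1) => [] [] [].
Qed.

Lemma matches_turning (M : {set I}) s : 0 < m + l ->
  matches M s = (M == turning true s) || (M == turning false s).
Proof.
move=> N0; have asc d j : 0 < j -> ascents d s j = ascents true s j by case: j.
apply/idP/idP => [/forallP h|].
  have e j : j <= m + l -> ascents (dir M 0) s j = dir M j.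
    move=> jN; case: (posnP j) => [->//|j0]; rewrite asc //.
    move: jN; rewrite leq_eqVlt => /orP[/eqP->|jN]; first by rewrite dir_gt // ascents_ge.
    by have /implyP/(_ j0)/eqP := h (Ordinal jN).
  suff : M = turning (dir M 0) s by case: (dir M 0) => /eqP ->; rewrite ?orbT.
  apply/setP => x; rewrite inE !e ?dirS //; exact: ltnW.
by move=> /orP[] /eqP ->; apply/forallP => j; apply/implyP => j0;
  rewrite dir_turning ?asc // ltnW.
Qed.

Lemma turning_neq (s : {perm I}) : 0 < m + l -> turning true s != turning false s.
Proof.
move=> N0; apply/eqP => /setP /(_ (Ordinal N0)); rewrite !inE /=.
by case: (nat_of_perm s _ < _).
Qed.

Lemma sum_matches k : 0 < m + l ->
  \sum_(s : {perm I}) #|[set M : {set I} | (#|M| == k) && matches M s]| = run_count (m + l) k.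
Proof.
move=> N0; rewrite /run_count exchange_big /=; apply: eq_bigr => s _.
rewrite big_bool /= -!card_turning.
have -> : [set M : {set I} | (#|M| == k) && matches M s] =
  [set M in [set turning true s; turning false s] | #|M| == k].
  by apply/setP => M; rewrite !inE matches_turning // andbC.
rewrite -[LHS]sum1_card (eq_bigl (fun M => (M \in [set turning true s; turning false s]) && (#|M| == k))); last first.
  by move=> M; rewrite inE.
rewrite big_mkcondr /= big_setU1 ?big_set1 ?inE ?turning_neq //=.
Qed.

Lemma crit_incr_inj (r r' : {perm I}) : crit_incr r -> crit_incr r' ->
  crit_pos r = crit_pos r' -> forall k : 'I_m, r (lshift l k) = r' (lshift l k).
Proof.
have rk (p : {perm I}) (k : 'I_m) : crit_incr p ->
    #|[set x in crit_pos p | x < p (lshift l k)]| = k.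
  move=> /forallP hp.
  have hp2 (a b : 'I_m) : a < b -> p (lshift l a) < p (lshift l b).
    by move=> ab; have /forallP/(_ b)/implyP := hp a; apply.
  have -> : [set x in crit_pos p | x < p (lshift l k)] = [set p (lshift l a) | a in [set a : 'I_m | a < k]].
    apply/setP => x; rewrite inE; apply/andP/imsetP => [[/imsetP[a _ ->] h]|[a]].
      exists a => //; rewrite inE ltnNge leq_eqVlt; apply/negP => /orP[/eqP/val_inj ka|/hp2].
        by rewrite ka ltnn in h.
      by rewrite ltnNge ltnW.
    by rewrite inE => ak ->; rewrite imset_f //= hp2.
  rewrite card_imset; last by move=> a b /perm_inj/lshift_inj.
  rewrite -[RHS](card_ord k) -[RHS](card_imset (f := widen_ord (ltnW (ltn_ord k)))); last by move=> a b /(congr1 val)/= /val_inj.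
  apply: eq_card => a; rewrite inE; apply/idP/imsetP => [ak|[b _ ->]]; last exact: ltn_ord b.
  by exists (Ordinal ak) => //; apply: val_inj.
move=> hr hr' e k.
have [k' _ kk'] : exists2 k', k' \in [set: 'I_m] & r (lshift l k) = r' (lshift l k').
  have : r (lshift l k) \in crit_pos r' by rewrite -e imset_f.
  by move=> /imsetP[k' _ ->]; exists k'.
have := rk r k hr; rewrite e kk' rk // => /val_inj kk; by rewrite kk.
Qed.

Lemma crit_incr_exists (M : {set I}) : #|M| = m ->
  exists2 r, crit_incr r & crit_pos r = M.
Proof.
move=> cM.
have cC : #|~: M| = l by have := cardsC M; rewrite cM card_ord => /eqP; rewrite eqn_add2l => /eqP.
pose f (i : I) : I := match split i with
  | inl k => Order.enum_val (cast_ord (esym cM) k)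
  | inr k => Order.enum_val (cast_ord (esym cC) k) end.
have fl k : f (lshift l k) = Order.enum_val (cast_ord (esym cM) k).
  by rewrite /f; case: split_ordP => k' /eqP; rewrite ?eq_lrshift // (inj_eq (@lshift_inj _ _)) => /eqP->.
have fr k : f (rshift m k) = Order.enum_val (cast_ord (esym cC) k).
  by rewrite /f; case: split_ordP => k' /eqP; rewrite ?eq_rlshift // (inj_eq (@rshift_inj _ _)) => /eqP->.
have fM k : f (lshift l k) \in M by rewrite fl Order.enum_valP.
have fC k : f (rshift m k) \notin M by have := Order.enum_valP (cast_ord (esym cC) k); rewrite -fr inE.
have ev (A : {set I}) : injective (@Order.enum_val _ _ A) := Order.enum_val_inj (A := A).
have finj : injective f.
  move=> a b; case: (split_ordP a) => a' ->; case: (split_ordP b) => b' ->.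
  - by rewrite !fl => /ev/cast_ord_inj->.
  - by move=> h; have := fM a'; rewrite h (negbTE (fC _)).
  - by move=> h; have := fM b'; rewrite -h (negbTE (fC _)).
  - by rewrite !fr => /ev/cast_ord_inj->.
exists (perm finj).
  apply/forallP => k; apply/forallP => k'; apply/implyP => kk; rewrite !permE !fl.
  have := leW_mono (@Order.le_enum_val _ I (@le_total _ _) M) (cast_ord (esym cM) k) (cast_ord (esym cM) k').
  by rewrite !ltEord /= => ->.
apply/eqP; rewrite eqEcard card_imset; last by move=> k k' /perm_inj/lshift_inj.
rewrite card_ord cM leqnn andbT; apply/subsetP => x /imsetP[k _ ->].
by rewrite permE.
Qed.

Lemma card_crit_incr (M : {set I}) : #|M| = m ->
  #|[set r : {perm I} | crit_incr r && (crit_pos r == M)]| = l`!.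
Proof.
move=> /crit_incr_exists[r0 i0 e0].
pose A : {set I} := [set rshift m i | i : 'I_l].
have cA : #|A| = l by rewrite card_imset ?card_ord //; exact: rshift_inj.
rewrite -[in RHS]cA -card_perm -[RHS](card_imset _ (mulIg r0)).
apply: eq_card => r; rewrite inE; apply/andP/imsetP.
  move=> [ir /eqP er]; exists (r * r0^-1)%g; last by rewrite mulgKV.
  apply/subsetP => x; rewrite inE; apply: contraR; case: (split_ordP x) => k -> h.
    by rewrite permM (@crit_incr_inj r r0) ?er // permK.
  by case/negP: h; apply: imset_f.
move=> [t tA ->].
have tl k : (t * r0)%g (lshift l k) = r0 (lshift l k).
  rewrite permM (out_perm tA) //; apply/imsetP => -[i _ /eqP]; by rewrite eq_lrshift.
split.
  apply/forallP => k; apply/forallP => k'; rewrite !tl.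
  by have /forallP/(_ k)/forallP/(_ k') := i0.
by rewrite -e0; apply/eqP; apply: eq_imset => k; rewrite tl.
Qed.

Definition alt_types : {set {perm I} * {perm I}} :=
  [set rs : {perm I} * {perm I} | alt_config (fun i => rs.1 i : nat) (fun i => rs.2 i : nat)].

Lemma card_alt_types : 0 < m + l -> #|alt_types| = l`! * run_count (m + l) m.
Proof.
move=> N0.
have bij : bijective (fun rs : {perm I} * {perm I} => (rs.1, (rs.1 * rs.2)%g)).
  by exists (fun rs : {perm I} * {perm I} => (rs.1, (rs.1^-1 * rs.2)%g)) => -[r s] /=; rewrite ?mulKg ?mulKVg.
rewrite -sum1_card (eq_bigl (fun rs : {perm I} * {perm I} => alt_config (fun i => rs.1 i : nat) (fun i => rs.2 i : nat))); last first.
  by move=> rs; rewrite inE.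
rewrite (reindex _ (onW_bij _ bij)) /=.
under eq_bigl do rewrite alt_config_perm.
rewrite big_mkcond /= -(pair_bigA _ (fun r s => if crit_incr r && matches (crit_pos r) s then 1 else 0)) /=.
rewrite exchange_big /= -(sum_matches m N0) big_distrr /=; apply: eq_bigr => s _.
rewrite -big_mkcond /= (partition_big (@crit_pos m l) (fun M => (#|M| == m) && matches M s)) /=; last first.
  move=> r /andP[_ ->]; rewrite andbT /crit_pos card_imset ?card_ord //.
  by move=> k k' /perm_inj/lshift_inj.
rewrite -sum1_card big_distrr /= [RHS](eq_bigl (fun M : {set I} => (#|M| == m) && matches M s)); last first.
  by move=> M; rewrite inE.
apply: eq_bigr => M /andP[/eqP cM mM].
rewrite muln1 -(card_crit_incr cM) -sum1_card; apply: eq_bigl => r; rewrite inE.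
by case: eqP => [->|]; rewrite ?andbF ?mM ?andbT.
Qed.

Lemma card_alt_types0 : m + l = 0 -> #|alt_types| = 1.
Proof.
move=> N0; have no (i : I) : False by case: i => i; rewrite N0.
apply/eqP; rewrite -(cards1 (1%g : {perm I}, 1%g : {perm I})); apply/eqP; apply: eq_card => -[r s].
rewrite !inE; have -> : r = 1%g by apply/permP => i; case: (no i).
have -> : s = 1%g by apply/permP => i; case: (no i).
rewrite eqxx; apply/alt_configP; split=> [i|k]; first by case: (no i).
by case: (no (lshift l k)).
Qed.

End CountAlt.

From mathcomp Require Import boolp.
Local Open Scope ring_scope.

(** * Solution of the recurrence *)

Section HomogeneousTop.
Variable R : numFieldType.
Implicit Types (F G : R -> R -> R) (T : {poly R}).

(* T lists the homogeneous part of degree i of F: T`_d is the coefficient of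
   n^d l^(i-d). *)
Definition has_top (i : nat) T F :=
  (size T <= i.+1)%N /\
  exists p : nat -> {poly R},
    [/\ forall d, (size (p d) <= i.+1 - d)%N,
        forall d, (d <= i)%N -> (p d)`_(i - d) = T`_d &
        forall n l, F n l = \sum_(0 <= d < i.+1) (p d).[l] * n ^+ d].

Lemma eq_has_top i T F G : (forall n l, F n l = G n l) ->
  has_top i T F -> has_top i T G.
Proof. by move=> FG [sT [p [sp tp Fp]]]; split=> //; exists p; split=> // n l; rewrite -FG. Qed.

Lemma has_top1 : has_top 0 1 (fun _ _ => 1).
Proof.
split; first by rewrite size_poly1.
exists (fun d => if d is 0 then 1 else 0); split.
- by move=> [|d]; rewrite ?size_poly1 ?size_poly0.
- by move=> [|d] // _; rewrite subnn.
- by move=> n l; rewrite big_nat1 hornerC expr0 mulr1.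
Qed.

Lemma has_topD i T U F G : has_top i T F -> has_top i U G ->
  has_top i (T + U) (fun n l => F n l + G n l).
Proof.
move=> [sT [p [sp tp Fp]]] [sU [q [sq tq Gq]]]; split.
  by rewrite (leq_trans (size_polyD _ _)) // geq_max sT.
exists (fun d => p d + q d); split.
- by move=> d; rewrite (leq_trans (size_polyD _ _)) // geq_max sp sq.
- by move=> d di; rewrite !coefD tp // tq.
- move=> n l; rewrite Fp Gq -big_split /=; apply: eq_bigr => d _.
  by rewrite hornerD mulrDl.
Qed.

Lemma has_topZ i T F a : has_top i T F -> has_top i (a *: T) (fun n l => a * F n l).
Proof.
move=> [sT [p [sp tp Fp]]]; split; first exact: leq_trans (size_scale_leq _ _) sT.
exists (fun d => a *: p d); split.
- by move=> d; exact: leq_trans (size_scale_leq _ _) (sp d).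
- by move=> d di; rewrite !coefZ tp.
- move=> n l; rewrite Fp mulr_sumr /=; apply: eq_bigr => d _.
  by rewrite hornerZ mulrA.
Qed.

Lemma has_top0 i : has_top i 0 (fun _ _ => 0).
Proof.
split; first by rewrite size_poly0.
exists (fun => 0); split=> [d|d|n l]; rewrite ?size_poly0 ?coef0 //.
by rewrite big1 // => d _; rewrite horner0 mul0r.
Qed.

Lemma has_top_sum i k (T : nat -> {poly R}) (F : nat -> R -> R -> R) :
  (forall f, (f < k)%N -> has_top i (T f) (F f)) ->
  has_top i (\sum_(0 <= f < k) T f) (fun n l => \sum_(0 <= f < k) F f n l).
Proof.
elim: k => [_|k IH h].
  by rewrite big_nil; apply: eq_has_top (has_top0 _) => n l; rewrite big_nil.
rewrite big_nat_recr //=.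
apply: (@eq_has_top _ _ (fun n l => \sum_(0 <= f < k) F f n l + F k n l)).
  by move=> n l; rewrite big_nat_recr.
by apply: has_topD (h k _) => //; apply: IH => f fk; apply: h; rewrite ltnS ltnW.
Qed.

Lemma has_topM_lin i T F a b c : has_top i T F ->
  has_top i.+1 ((a *: 'X + b%:P) * T) (fun n l => (a * n + b * l + c) * F n l).
Proof.
move=> [sT [p [sp tp Fp]]].
have sab (u v : R) : (size (u *: 'X + v%:P)%R <= 2)%N.
  rewrite (leq_trans (size_polyD _ _)) // geq_max (leq_trans (size_scale_leq _ _)) ?size_polyX //.
  by rewrite (leq_trans (size_polyC_leq1 _)).
have cab (u v : R) (q : {poly R}) k : ((u *: 'X + v%:P) * q)`_k = u * (if k is k'.+1 then q`_k' else 0) + v * q`_k.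
  by rewrite mulrDl coefD -scalerAl coefZ coefXM coefCM; case: k.
split.
  apply: leq_trans (size_polyMleq _ _) _.
  by have := leq_add (sab a b) sT; case: (_ + _)%N.
pose q d : {poly R} := (if d is d'.+1 then a *: p d' else 0) + (b *: 'X + c%:P) * p d.
exists q; split.
- move=> d; rewrite /q (leq_trans (size_polyD _ _)) // geq_max; apply/andP; split.
    by case: d => [|d]; rewrite ?size_poly0 // (leq_trans (size_scale_leq _ _)) // (leq_trans (sp d)).
  have [p0|p0] := eqVneq (p d) 0; first by rewrite p0 mulr0 size_poly0.
  have p1 : (0 < size (p d))%N by rewrite size_poly_gt0.
  have -> : (i.+2 - d = (2 + (i.+1 - d)).-1)%N by have := leq_trans p1 (sp d); lia.
  apply: leq_trans (size_polyMleq _ _) _.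
  by rewrite -!subn1 leq_sub2r // leq_add.
- move=> [|d] di; rewrite /q coefD cab cab.
    have t0 := tp 0%N (leq0n i); rewrite !subn0 in t0 *.
    have z0 : (p 0%N)`_i.+1 = 0 by apply: nth_default; have := sp 0%N; rewrite subn0.
    by rewrite ?coef0 ?t0 ?z0 ?mulr0 ?add0r ?mulr0 ?addr0.
  rewrite coefZ subSS tp //; congr (_ + _).
  move: di; rewrite ltnS leq_eqVlt => /orP[/eqP->|di].
    have p0 : p i.+1 = 0.
      by apply/eqP; rewrite -size_poly_leq0 (leq_trans (sp _)) // subnn.
    by rewrite subnn p0 coef0 (nth_default _ sT) !mulr0 addr0.
  have -> : (i - d = (i - d.+1).+1)%N by lia.
  rewrite tp // (_ : (p d.+1)`_(i - d.+1).+1 = 0) ?mulr0 ?addr0 //.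
  by apply: nth_default; have := sp d.+1; rewrite subSS => /leq_trans; apply; lia.
- move=> n l; rewrite Fp.
  rewrite /q.
  under [RHS]eq_bigr do rewrite hornerD mulrDl.
  rewrite big_split /= [X in _ = X + _]big_nat_recl //= horner0 mul0r add0r.
  rewrite [X in _ = _ + X]big_nat_recr //= (_ : p i.+1 = 0); last first.
    by apply/eqP; rewrite -size_poly_leq0 (leq_trans (sp _)) // subnn.
  rewrite mulr0 horner0 mul0r addr0 -big_split /= mulr_sumr /=; apply: eq_bigr => d _.
  by rewrite hornerZ hornerM hornerD hornerZ hornerX hornerC exprS; ring.
Qed.

End HomogeneousTop.

Section Coefficients.
Variable R : numFieldType.

(* The coefficient of K_(n + 2 l - 1 - 2 i) is the sum over f of
   alpha i f (n + 2 l) * l ^_ (2 i + f). *)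
Fixpoint alpha (i f : nat) (M : R) : R :=
  if i is i'.+1 then
    (2 * (if f is f'.+1 then alpha i' f' (M - 2) else 0)
     - (M - 2 * (2 * i' + f + 1)%:R) * alpha i' f (M - 2)) / (2 * i' + f + 2)%:R
  else (f == 0%N)%:R.

Lemma alpha_gt i f M : (i < f)%N -> alpha i f M = 0.
Proof.
elim: i f M => [|i IH] [|f] M //= fi.
by rewrite !IH ?mulr0 ?subrr ?mul0r //; lia.
Qed.

Definition lead (i f : nat) : R := (-1) ^+ i / (2 ^+ i * i`!%:R) * 'C(i, f)%:R * (- (4 / 3)) ^+ f.

Lemma lead_rec i f : (2 * (if f is f'.+1 then lead i f' else 0) - lead i f) / (2 * i + f + 2)%:R = lead i.+1 f.
Proof.
rewrite /lead; set A := (-1) ^+ i / (2 ^+ i * i`!%:R).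
have i1 : (i.+1)%:R != 0 :> R by rewrite pnatr_eq0.
have -> : (-1) ^+ i.+1 / (2 ^+ i.+1 * (i.+1)`!%:R) = - A / (2 * i.+1%:R) :> R.
  rewrite /A factS natrM !exprS; field.
  by rewrite nat1r i1 pnatr_eq0 -lt0n fact_gt0 expf_neq0 // pnatr_eq0.
have d0 : (2 * i + f + 2)%:R != 0 :> R by rewrite pnatr_eq0; lia.
apply: (mulIf d0); rewrite mulfVK //.
case: f d0 => [|f] d0.
  have -> : (2 * i + 0 + 2)%:R = 2 * i.+1%:R :> R by rewrite -natrM; congr (_%:R); lia.
  by rewrite !bin0 mulr0 sub0r expr0 !mulr1; field; rewrite nat1r.
rewrite binS natrD.
have e : (f.+1)%:R * ('C(i, f.+1)%:R + 'C(i, f)%:R) = i.+1%:R * 'C(i, f)%:R :> R.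
  by rewrite -natrD -binS -natrM -natrM mul_bin_diag.
rewrite exprS; set u := (_ ^+ f).
have -> : (2 * i + f.+1 + 2)%:R = 2 * i.+1%:R + f.+1%:R :> R by rewrite -natrM -natrD; congr (_%:R); lia.
move: e; set x := 'C(i, f.+1)%:R; set y := 'C(i, f)%:R => e.
set J := i.+1%:R in i1 e *.
transitivity (- A / (2 * J) * (2 * J * (x + y) + f.+1%:R * (x + y)) * (- (4 / 3) * u)); last by ring.
by rewrite e; field; rewrite nat1r.
Qed.

Lemma alpha_top i f s : (f <= i)%N ->
  has_top (i - f) (lead i f *: ('X + 2%:P) ^+ (i - f))
    (fun n l => alpha i f (n + 2 * l + s)).
Proof.
elim: i f s => [|i IH] f s fi.
  have -> : f = 0%N by lia.
  by rewrite /lead expr0 subnn expr0 expr0 !mul1r invr1 bin0 expr0 !mulr1 scale1r; exact: has_top1.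
have A1 : has_top (i.+1 - f) ((2 * (if f is f'.+1 then lead i f' else 0)) *: ('X + 2%:P) ^+ (i.+1 - f))
    (fun n l => 2 * (if f is f'.+1 then alpha i f' (n + 2 * l + s - 2) else 0)).
  case: f fi => [|f] fi.
    by rewrite mulr0 scale0r; apply: eq_has_top (has_top0 _ _) => n l; rewrite /= ?mulr0.
  rewrite -scalerA subSS; apply: has_topZ.
  by apply: eq_has_top (IH f (s - 2) _) => // n l; congr (alpha _ _ _); ring.
have A2 : has_top (i.+1 - f) (- lead i f *: ('X + 2%:P) ^+ (i.+1 - f))
    (fun n l => - ((n + 2 * l + s - 2 * (2 * i + f + 1)%:R) * alpha i f (n + 2 * l + s - 2))).
  move: fi; rewrite leq_eqVlt => /orP[/eqP->|fi].
    rewrite /lead bin_small // mulr0 mul0r oppr0 scale0r.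
    by apply: eq_has_top (has_top0 _ _) => n l; rewrite alpha_gt // mulr0 oppr0.
  have := has_topM_lin (-1) (-2) (- s + 2 * (2 * i + f + 1)%:R) (@IH f (s - 2) fi).
  rewrite subSn // exprS.
  have -> : (-1 *: 'X + (- (2 : R))%:P) * (lead i f *: ('X + 2%:P) ^+ (i - f)) =
     - lead i f *: (('X + 2%:P) * ('X + 2%:P) ^+ (i - f)).
    by rewrite scaleNr scale1r polyCN -opprD mulNr -scalerAr scaleNr.
  apply: eq_has_top => n l; rewrite -mulNr; congr (_ * alpha _ _ _); ring.
rewrite -lead_rec.
have := has_topZ ((2 * i + f + 2)%:R^-1) (has_topD A1 A2).
rewrite -scalerDl scalerA [_^-1 * _]mulrC; apply: eq_has_top => n l /=.
by rewrite mulrC.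
Qed.

Definition rfact (x : R) (f : nat) := \prod_(j < f) (x - j%:R).

Lemma ffact_rfact l f : (l ^_ f)%:R = rfact l%:R f.
Proof.
rewrite /rfact; elim: f => [|f IH]; first by rewrite big_ord0.
rewrite ffactnSr natrM IH big_ord_recr /=.
have [fl|fl] := leqP f l; first by rewrite natrB.
have -> : \prod_(i < f) (l%:R - i%:R : R) = 0.
  by rewrite (bigD1 (Ordinal fl)) //= subrr mul0r.
by rewrite !mul0r.
Qed.

Lemma rfact_top i T F (s : R) f : has_top i T F ->
  has_top (i + f) T (fun n l => F n l * rfact (l + s) f).
Proof.
move=> h; elim: f => [|f IH].
  by rewrite addn0; apply: eq_has_top h => n l; rewrite /rfact big_ord0 mulr1.
rewrite addnS; have := has_topM_lin 0 1 (s - f%:R) IH.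
rewrite scale0r add0r polyC1 mul1r; apply: eq_has_top => n l.
rewrite /rfact big_ord_recr /= ; ring.
Qed.

(* The normalized coefficient of K_(n + 2 l - 1 - 2 i), with its factors
   depending on l only through l ^_ (2 i) removed. *)
Definition ncoef (i : nat) (n l : R) : R :=
  (-2) ^+ i * i`!%:R * \sum_(0 <= f < i.+1) alpha i f (n + 2 * l) * rfact (l - (2 * i)%:R) f.

Lemma ncoef_top i : has_top i (('X + (2 / 3)%:P) ^+ i) (ncoef i).
Proof.
have h f : (f < i.+1)%N -> has_top i (lead i f *: ('X + 2%:P) ^+ (i - f))
  (fun n l => alpha i f (n + 2 * l) * rfact (l - (2 * i)%:R) f).
  move=> fi; have := rfact_top (- (2 * i)%:R) f (@alpha_top i f 0 fi).
  rewrite subnK //; apply: eq_has_top => n l; by rewrite addr0.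
have := has_topZ ((-2) ^+ i * i`!%:R) (has_top_sum h).
suff -> : ((-2) ^+ i * i`!%:R) *: (\sum_(0 <= f < i.+1) lead i f *: ('X + 2%:P) ^+ (i - f)) =
  ('X + (2 / 3)%:P) ^+ i by [].
have -> : ('X + (2 / 3)%:P) = ('X + 2%:P) + (- (4 / 3))%:P :> {poly R}.
  by rewrite -addrA -polyCD; congr (_ + _%:P); field.
rewrite exprDn big_mkord scaler_sumr; apply: eq_bigr => f _.
rewrite scalerA -polyC_exp [X in _ = X *+ _]mulrC mul_polyC -scaler_nat scalerA; congr (_ *: _).
rewrite /lead.
have -> : (-2) ^+ i = (-1) ^+ i * 2 ^+ i :> R by rewrite -mulN1r exprMn.
set e := (_ ^+ f).
have s1 : ((-1) ^+ i * (-1) ^+ i = 1 :> R) by rewrite -expr2 sqrr_sign.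
move: s1; set sg := (-1) ^+ i => s1; transitivity (sg * sg * ('C(i, f)%:R * e)); last by rewrite s1 mul1r.
set t : R := 2 ^+ i.
have t0 : t != 0 by rewrite expf_neq0 // pnatr_eq0.
have i0 : i`!%:R != 0 :> R by rewrite pnatr_eq0 -lt0n fact_gt0.
by field; rewrite i0 t0.
Qed.

Lemma ncoef_poly : exists p : nat -> nat -> {poly R},
  (forall i d, (d <= i)%N -> size (p i d) = (i - d).+1) /\
  (forall i n l, ncoef i n l = \sum_(0 <= d < i.+1) (p i d).[l] * n ^+ d).
Proof.
have h i : exists p : nat -> {poly R},
  (forall d, (d <= i)%N -> size (p d) = (i - d).+1) /\
  (forall n l, ncoef i n l = \sum_(0 <= d < i.+1) (p d).[l] * n ^+ d).
  have [_ [p [sp tp pE]]] := ncoef_top i; exists p; split=> // d di.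
  apply/eqP; rewrite eqn_leq -subSn // sp /= subSn // ltnNge; apply/negP => hs.
  have := tp _ di; rewrite nth_default //.
  rewrite addrC exprDn coef_sum (bigD1 (Ordinal (n:=i.+1) (m:=d) di)) //= big1 => [|j jd].
    rewrite -polyC_exp coefMn mul_polyC coefZ coefXn eqxx mulr1 addr0 => /esym/eqP.
    by rewrite mulrn_eq0 expf_eq0 mulf_eq0 invr_eq0 !pnatr_eq0 andbF orbF -leqn0 leqNgt bin_gt0 di.
  rewrite -polyC_exp coefMn mul_polyC coefZ coefXn.
  have -> : (d == j) = false by apply: contra_neqF jd => /eqP dj; apply/val_inj.
  by rewrite mulr0 mul0rn.
have [p pP] := boolp.choice h; exists p.
by split=> [i d|i n l]; [exact: (pP i).1|exact: (pP i).2].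
Qed.

End Coefficients.

Lemma ffactnD n a b : (n ^_ (a + b) = n ^_ a * (n - a) ^_ b)%N.
Proof.
elim: b => [|b IH]; first by rewrite addn0 ffactn0 muln1.
by rewrite addnS !ffactnSr IH -mulnA subnDA.
Qed.

Section Formula.
Variable R : numFieldType.

Definition coef_BE (i : nat) (M : R) (l : nat) : R :=
  \sum_(0 <= f < i.+1) alpha i f M * (l ^_ (2 * i + f))%:R.

Lemma coef_BE_small i M l : (l < 2 * i)%N -> coef_BE i M l = 0.
Proof.
move=> li; rewrite /coef_BE big1 // => f _; rewrite ffact_small ?mulr0 //.
by rewrite (leq_trans li) // leq_addr.
Qed.

Lemma coef_BE0 M l : coef_BE 0 M l = 1.
Proof. by rewrite /coef_BE big_nat1 /= mul1r ffactn0. Qed.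

Lemma coef_BE_rec i (M : R) l :
  coef_BE i.+1 M l.+1 = coef_BE i.+1 M l - l%:R * (M - 2 * l%:R) * coef_BE i (M - 2) l.-1.
Proof.
have dff e : (l.+1 ^_ e.+1)%:R = (l ^_ e.+1)%:R + e.+1%:R * (l ^_ e)%:R :> R.
  rewrite -natrM -natrD ffactSS ffactnSr mulnC.
  have [el|el] := leqP e l; last by rewrite ffact_small // !(mul0n, muln0).
  by congr (_%:R); nia.
have e1 f : l%:R * (l.-1 ^_ (2 * i + f))%:R = (l ^_ (2 * i + f).+1)%:R :> R.
  by case: (l) => [|k] /=; rewrite ?mul0r ?ffact0n // -natrM ffactSS.
have e2 f : l%:R * (l ^_ (2 * i + f).+1)%:R =
    (l ^_ (2 * i + f).+2)%:R + (2 * i + f + 1)%:R * (l ^_ (2 * i + f).+1)%:R :> R.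
  rewrite [(l ^_ (2 * i + f).+2)%N]ffactnSr.
  have [el|el] := leqP (2 * i + f).+1 l; last by rewrite ffact_small // !mulr0 addr0.
  by rewrite natrM natrB // addn1; ring.
have st f : alpha i.+1 f M * (l.+1 ^_ (2 * i.+1 + f))%:R = alpha i.+1 f M * (l ^_ (2 * i.+1 + f))%:R
   + (2 * (if f is f'.+1 then alpha i f' (M - 2) else 0)
     - (M - 2 * (2 * i + f + 1)%:R) * alpha i f (M - 2)) * (l ^_ (2 * i + f).+1)%:R.
  have -> : (2 * i.+1 + f = (2 * i + f).+2)%N by lia.
  rewrite dff mulrDr; congr (_ + _).
  rewrite mulrA /= [(2 * i + f + 2)%N]addn2 mulfVK //; by rewrite pnatr_eq0.
rewrite /coef_BE.
under eq_bigr do rewrite st.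
rewrite big_split /=; congr (_ + _).
under eq_bigr do rewrite mulrBl.
rewrite sumrB [X in X - _]big_nat_recl //= mulr0 mul0r add0r.
rewrite [X in _ - X]big_nat_recr //= alpha_gt // mulr0 mul0r addr0 -sumrB mulr_sumr -sumrN.
apply: eq_bigr => f _; rewrite addnS.
transitivity (- (alpha i f (M - 2) * (M - 2 * l%:R) * (l%:R * (l.-1 ^_ (2 * i + f))%:R))); last by ring.
rewrite e1.
transitivity (- (alpha i f (M - 2) * (M * (l ^_ (2 * i + f).+1)%:R - 2 * (l%:R * (l ^_ (2 * i + f).+1)%:R)))); last by ring.
rewrite e2; ring.
Qed.

Variables (kap : nat -> nat -> R) (Kn : nat -> R).
Hypothesis kap0 : forall n, kap n.+1 0 = Kn n.
Hypothesis kap1 : forall n, kap n 1 = Kn n.+1.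
Hypothesis kapSS : forall n l,
  kap n l.+2 = kap n.+2 l.+1 - (l.+1)%:R * (n.+2)%:R * kap n.+2 l.

Lemma kap_expand B l n : (l <= 2 * B + 1)%N -> (n, l) <> (0, 0)%N ->
  kap n l = \sum_(0 <= i < B.+1) coef_BE i (n + 2 * l)%:R l * Kn (n + 2 * l - 1 - 2 * i).
Proof.
have base B' l' M : (l' < 2)%N ->
    \sum_(0 <= i < B'.+1) coef_BE i M%:R l' * Kn (M - 1 - 2 * i) = Kn (M - 1).
  move=> l2; rewrite big_nat_recl // coef_BE0 mul1r muln0 subn0 big1 ?addr0 // => i _.
  by rewrite coef_BE_small ?mul0r //; lia.
have [k] := ubnP l; elim: k l B n => // k IH [|[|l]] B n lk lB nl.
- rewrite base // muln0 addn0; case: n nl => // n _; by rewrite kap0 subn1.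
- by rewrite base // kap1; congr (Kn _); lia.
have [B' BE] : exists B', B = B'.+1 by exists B.-1; lia.
rewrite kapSS (IH l.+1 B) //; last by lia.
rewrite (IH l B') //; [|lia|lia].
subst B.
have -> : (n.+2 + 2 * l.+1 = n + 2 * l.+2)%N by lia.
set M := (n + 2 * l.+2)%N.
have M2 : (n.+2 + 2 * l)%:R = M%:R - 2 :> R by rewrite -natrB; [congr (_%:R)|]; rewrite /M; lia.
rewrite M2 [RHS]big_nat_recl // [X in X - _]big_nat_recl // !coef_BE0 -addrA; congr (_ + _).
under [in RHS]eq_bigr do rewrite coef_BE_rec mulrBl.
rewrite sumrB; congr (_ - _); rewrite mulr_sumr; apply: eq_bigr => i _.
have -> : (n.+2 + 2 * l - 1 - 2 * i = M - 1 - 2 * i.+1)%N by rewrite /M; lia.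
have -> : (n.+2)%:R = M%:R - 2 * (l.+1)%:R :> R.
  by rewrite -natrM -natrB; [congr (_%:R)|]; rewrite /M; lia.
by rewrite /=; ring.
Qed.

Lemma coef_BE_ncoef i n l : (2 * i <= l)%N ->
  coef_BE i (n + 2 * l)%:R l =
  (-1) ^+ i / (2 ^+ i * i`!%:R) * (l`!%:R / (l - 2 * i)`!%:R) * ncoef i n%:R l%:R.
Proof.
move=> il; rewrite /ncoef /coef_BE.
have -> : (-2) ^+ i = (-1) ^+ i * 2 ^+ i :> R by rewrite -mulN1r exprMn.
have s1 : (-1) ^+ i * (-1) ^+ i = 1 :> R by rewrite -expr2 sqrr_sign.
have f0 k : k`!%:R != 0 :> R by rewrite pnatr_eq0 -lt0n fact_gt0.
have t0 : 2 ^+ i != 0 :> R by rewrite expf_neq0 // pnatr_eq0.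
move: s1 t0 (f0 i); set sg := (-1) ^+ i; set t := 2 ^+ i; set q := i`!%:R => s1 t0 q0.
set S := \sum_(0 <= f < i.+1) alpha i f _ * rfact _ f.
transitivity (sg * sg * (l`!%:R / (l - 2 * i)`!%:R * S)); last by field; rewrite q0 t0 f0.
rewrite s1 mul1r /S mulr_sumr; apply: eq_bigr => f _.
rewrite -natrM -natrD mulrCA; congr (_ * _).
have -> : l%:R - (2 * i)%:R = (l - 2 * i)%:R :> R by rewrite natrB.
rewrite -ffact_rfact ffactnD natrM; congr (_ * _).
by rewrite -(ffact_fact il) natrM mulfK.
Qed.
End Formula.

From mathcomp Require Import all_boot all_order all_algebra finmap.
From mathcomp Require Import all_classical all_reals all_analysis.
From mathcomp Require Import zify ring lra.

Import Order.TTheory GRing.Theory Num.Theory.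
Import numFieldNormedType.Exports.

Local Open Scope classical_set_scope.
Local Open Scope ring_scope.

Lemma coef_BE1 (R : numFieldType) (n : R) (l : nat) :
  coef_BE 1 (n + 2 * l%:R) l =
  - (l%:R * (l%:R - 1) / 2 * n + (l%:R + 1) * l%:R * (l%:R - 1) / 3).
Proof.
rewrite /coef_BE big_nat_recr // big_nat1 !ffact_rfact /rfact !big_ord_recr big_ord0 /=.
by field.
Qed.

Lemma coef_BE2 (R : numFieldType) (n : R) (l : nat) :
  coef_BE 2 (n + 2 * l%:R) l =
  l%:R * (l%:R - 1) * (l%:R - 2) * (l%:R - 3)
           * (1 / 8 * n ^+ 2 + (2 * l%:R + 1) / 12 * n
              + (l%:R + 1) * (5 * l%:R - 2) / 90).
Proof.
rewrite /coef_BE big_nat_recr // big_nat_recr // big_nat1 !ffact_rfact /rfact !big_ord_recr big_ord0 /=.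
by field.
Qed.

Lemma kap_formula (R : realType) (kap : nat -> nat -> R) (K : nat -> R) :
  (forall n, kap n.+1 0%N = K n) -> (forall n, kap n 1%N = K n.+1) ->
  (forall n l, kap n l.+2 = kap n.+2 l.+1 - (l.+1)%:R * (n.+2)%:R * kap n.+2 l) ->
  exists p : nat -> nat -> {poly R},
    (forall k d : nat, (4 <= k)%N -> (d <= k - 1)%N ->
       size (p k d) = (k - d - 1).+1) /\
    (forall n l : nat, (n, l) <> (0%N, 0%N) ->
       kap n l =
         int_index K (n%:Z + 2 * l%:Z - 1)
         - (l%:R * (l%:R - 1) / 2 * n%:R
            + (l%:R + 1) * l%:R * (l%:R - 1) / 3)
           * int_index K (n%:Z + 2 * l%:Z - 3)
         + l%:R * (l%:R - 1) * (l%:R - 2) * (l%:R - 3)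
           * (1 / 8 * n%:R ^+ 2 + (2 * l%:R + 1) / 12 * n%:R
              + (l%:R + 1) * (5 * l%:R - 2) / 90)
           * int_index K (n%:Z + 2 * l%:Z - 5)
         + \sum_(4 <= k < (l %/ 2 + 1).+1)
             ((- 1) ^+ (k - 1) / (2 ^+ (k - 1) * ((k - 1)`!)%:R)
              * ((l`!)%:R / ((l + 2 - 2 * k)`!)%:R)
              * \sum_(0 <= d < k) (p k d).[l%:R] * n%:R ^+ d)
             * int_index K (n%:Z + 2 * (l%:Z - k%:Z) + 1)).
Proof.
move=> kap0 kap1 kapSS; have [p [sp pE]] := ncoef_poly R.
exists (fun k => p k.-1); split=> [k d k4 dk|n l nl].
  by rewrite sp; [congr _.+1; lia|lia].
have idx (i : nat) (z : int) : (2 * i <= l)%N -> z = n%:Z + 2 * l%:Z - 1 - 2 * i%:Z ->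
    int_index K z = K (n + 2 * l - 1 - 2 * i)%N.
  move=> il ->.
  have -> : n%:Z + 2 * l%:Z - 1 - 2 * i%:Z = (n + 2 * l - 1 - 2 * i)%N%:Z.
    by case: n l nl il => [|n] [|l] //; lia.
  by [].
rewrite (kap_expand kap0 kap1 kapSS (B := (l %/ 2 + 2)%N)) //; last by lia.
have M (i : nat) : coef_BE i (n + 2 * l)%:R l = coef_BE i (n%:R + 2 * l%:R : R) l.
  by rewrite natrD natrM.
rewrite addn2 big_nat_recl // big_nat_recl // big_nat_recl // !addrA.
congr (_ + _ + _ + _).
- by rewrite coef_BE0 mul1r (idx 0%N) ?mulr0 ?subr0.
- rewrite M coef_BE1 mulNr; congr (- _).
  have [l2|l2] := leqP 2 l; first by rewrite (idx 1%N) //; lia.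
  suff -> : l%:R * (l%:R - 1) / 2 * n%:R + (l%:R + 1) * l%:R * (l%:R - 1) / 3 = 0 :> R by rewrite !mul0r.
  by case: (l) l2 => [|[|]] //= _; ring.
- rewrite M coef_BE2.
  have [l4|l4] := leqP 4 l; first by rewrite (idx 2%N) //; lia.
  suff -> : l%:R * (l%:R - 1) * (l%:R - 2) * (l%:R - 3) = 0 :> R by rewrite !mul0r.
  by case: (l) l4 => [|[|[|[|]]]] //= _; ring.
rewrite (big_addn 0 _ 4) /=.
rewrite [RHS](big_nat_widen _ _ (l %/ 2)); last by lia.
rewrite [RHS]big_mkcond /=; apply: eq_bigr => i _.
case: ifP => [il|/negbT il]; last by rewrite coef_BE_small ?mul0r //; lia.
rewrite coef_BE_ncoef; last by lia.
rewrite (idx i.+3); [|lia|lia].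
rewrite addn4 subn1 /= pE; congr (_ * (_ / _ `! %:R) * _ * _); lia.
Qed.

(** * Derivatives of sec + tan *)

Section BernoulliEuler.
Variable R : realType.

(* [sec + tan] has N-th derivative [(run_poly N).[sin] / cos ^ (N + 1)]. *)
Fixpoint run_poly (N : nat) : {poly R} :=
  if N is N'.+1 then (1 - 'X^2) * (run_poly N')^`() + N%:R *: ('X * run_poly N')
  else 'X + 1.

Lemma is_cvg_pseries_diffs_inside (c : R^nat) (x z : R) :
  cvgn (pseries c x) -> `|z| < `|x| -> cvgn (pseries (pseries_diffs c) z).
Proof.
move=> cx zx.
have [y /andP[zy yx]] : exists y, `|z| < y < `|x|.
  by exists ((`|z| + `|x|) / 2); rewrite !midf_lt.
have y0 : 0 < y by exact: le_lt_trans zy.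
have cy : cvgn (pseries (fun i => `|c i|) y).
  by apply: is_cvg_pseries_inside_norm cx _; rewrite gtr0_norm.
have cy1 : cvgn (series (fun i => `|c i.+1| * y ^+ i)).
  have -> : series (fun i => `|c i.+1| * y ^+ i) =
      (fun n => (pseries (fun i => `|c i|) y n.+1 - `|c 0%N|) * y^-1).
    apply/funext => n; rewrite /pseries /series /= big_nat_recl // expr0 mulr1 addrC addKr.
    rewrite mulr_suml; apply: eq_bigr => i _; rewrite exprS; field.
    by rewrite gt_eqF.
  apply: is_cvgM; last exact: is_cvg_cst.
  apply: is_cvgB; last exact: is_cvg_cst.
  have /cvg_ex[l hl] := cy; apply/cvg_ex; exists l.
  by move: hl; rewrite -(cvg_shiftS (pseries (fun i => `|c i|) y)).
apply: normed_cvg.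
pose q := `|z| / y; have q0 : 0 <= q by rewrite divr_ge0 // ltW.
have q1 : q < 1 by rewrite ltr_pdivrMr // mul1r.
pose C := 1 + (1 - q)^-1.
have C0 : 0 <= C by rewrite addr_ge0 // invr_ge0 subr_ge0 ltW.
have bern n : n.+1%:R * q ^+ n <= C.
  elim: n => [|n IH]; first by rewrite expr0 mulr1 lerDl invr_ge0 subr_ge0 ltW.
  have : n.+2%:R * q ^+ n.+1 <= \sum_(i < n.+2) q ^+ i.
    rewrite mulr_natl -[in leLHS](card_ord n.+2) -sumr_const; apply: ler_sum => i _.
    by apply: ler_wiXn2l => //; [exact: ltW|rewrite -ltnS].
  move/le_trans; apply.
  have := subrX1 q n.+2; rewrite (_ : \sum_(i < n.+2) q ^+ i = (1 - q ^+ n.+2) / (1 - q)) => [_|].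
    rewrite ler_pdivrMr ?subr_gt0 // /C mulrDl mulVf ?gt_eqF ?subr_gt0 // mul1r.
    have := exprn_ge0 n.+2 q0; nra.
  apply: (@mulIf _ (1 - q)); first by rewrite gt_eqF ?subr_gt0.
  rewrite mulfVK ?gt_eqF ?subr_gt0 //.
  have := subrX1 q n.+2 => e; rewrite -[1 - q ^+ _]opprB e; ring.
apply: (@series_le_cvg _ _ (fun i => C * (`|c i.+1| * y ^+ i))) => //=.
- by move=> n; rewrite mulr_ge0 // mulr_ge0 // exprn_ge0 // ltW.
- move=> n; rewrite /pseries_diffs !normrM normrX ger0_norm //.
  have -> : `|z| = q * y by rewrite /q mulfVK // gt_eqF.
  rewrite exprMn; have := bern n; have : 0 <= `|c n.+1| * y ^+ n by rewrite mulr_ge0 // exprn_ge0 // ltW.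
  nra.
exact: is_cvg_seriesZ.
Qed.

Lemma lim_pseries_at0 (c : R^nat) : limn (pseries c 0) = c 0%N.
Proof.
apply: cvg_lim => //; rewrite -cvg_shiftS.
rewrite (_ : [sequence _]_n = cst (c 0%N)); first exact: cvg_cst.
apply/funext => n; rewrite /pseries /series /= big_nat_recl // expr0 mulr1 big1 ?addr0 // => i _.
by rewrite expr0n /= mulr0.
Qed.

Lemma is_derive_run_poly N (t : R) : cos t != 0 ->
  is_derive t 1 (fun x => (run_poly N).[sin x] / cos x ^+ N.+1)
    ((run_poly N.+1).[sin t] / cos t ^+ N.+2).
Proof.
move=> ct.
have ds := is_derive1_comp (is_derive_poly (run_poly N) (sin t)) (is_derive_sin t).
have cX : cos t ^+ N.+1 != 0 by rewrite expf_neq0.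
have dX : is_derive t 1 (fun x : R => cos x ^+ N.+1) ((N.+1%:R * cos t ^+ N) *: - sin t).
  have := is_deriveX N.+1 (is_derive_cos t).
  by rewrite (_ : cos ^+ N.+1 = fun x : R => cos x ^+ N.+1) //; apply/funext => x; rewrite exprfctE.
have dc := is_deriveV (f := fun x => cos x ^+ N.+1) cX dX.
apply: (is_derive_eq (is_deriveM ds dc)) => /=.
rewrite hornerD hornerM hornerD hornerN hornerXn -polyC1 hornerC hornerZ hornerM hornerX.
have -> : 1 - sin t ^+ 2 = cos t ^+ 2 by rewrite sin2cos2; ring.
rewrite /GRing.scale /= !exprS.
have cN0 : cos t ^+ N != 0 by rewrite expf_neq0.
move: (cos t ^+ N) cN0 => u u0; field.
by rewrite u0 ct.
Qed.

Lemma bernoulli_euler_run_poly (K : nat -> R) : bernoulli_euler K ->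
  forall N, K N = (run_poly N)`_0.
Proof.
move=> hK.
pose a0 (m : nat) := K m / m`!%:R.
pose a N := iter N (@pseries_diffs R) a0.
have aE N m : a N m = K (m + N)%N / m`!%:R.
  elim: N m => [|N IH] m; first by rewrite addn0.
  rewrite /a iterS -/(a N) /pseries_diffs IH addSnnS factS natrM.
  have m0 : m.+1%:R != 0 :> R by rewrite pnatr_eq0.
  have f0 : m`!%:R != 0 :> R by rewrite pnatr_eq0 -lt0n fact_gt0.
  by move: (m.+1%:R) m0 (m`!%:R) f0 => u u0 v v0; field; rewrite u0 v0.
have [r r0 hr] : exists2 r : R, 0 < r & forall t, `|t| < r ->
    cos t != 0 /\ (pseries a0 t @ \oo --> (cos t)^-1 + tan t).
  have : \forall t \near (0 : R), cos t != 0 /\ (pseries a0 t @ \oo --> (cos t)^-1 + tan t).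
    near=> t; split; last first.
      rewrite /pseries (_ : (fun i => _) = (fun m => K m * t ^+ m / (m`!)%:R)); last first.
        by apply/funext => i; rewrite mulrAC.
      by near: t.
    near: t.
    have : cos @ (0 : R) --> cos (0 : R) by exact: continuous_cos.
    rewrite cos0 => /cvgr_neq0; apply; exact: oner_neq0.
  move=> /nbhs_ballP[r /= r0 h]; exists r => // t tr; apply: h.
  by rewrite /ball /= sub0r normrN.
have ca N x : `|x| < r -> cvgn (pseries (a N) x).
  elim: N x => [|N IH] x xr; first by apply/cvg_ex; eexists; exact: (hr x xr).2.
  have [y /andP[xy yr]] : exists y, `|x| < y < r by exists ((`|x| + r) / 2); rewrite !midf_lt.
  have y0 : 0 < y by exact: le_lt_trans xy.
  apply: (@is_cvg_pseries_diffs_inside _ y); last by rewrite (gtr0_norm y0).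
  by apply: IH; rewrite (gtr0_norm y0).
have main N x : `|x| < r -> limn (pseries (a N) x) = (run_poly N).[sin x] / cos x ^+ N.+1.
  elim: N x => [|N IH] x xr.
    have [cx hx] := hr x xr.
    rewrite (cvg_lim _ hx) // /run_poly !hornerE /tan expr1 mulrDl mul1r addrC //.
  have [y /andP[xy yr]] : exists y, `|x| < y < r by exists ((`|x| + r) / 2); rewrite !midf_lt.
  have y0 : 0 < y by exact: le_lt_trans xy.
  have yr' : `|y| < r by rewrite (gtr0_norm y0).
  have d1 : is_derive x (1 : R) (fun z => limn (pseries (a N) z)) (limn (pseries (a N.+1) x)).
    apply: (@pseries_snd_diffs _ (a N) y x (ca N y yr') (ca N.+1 y yr') (ca N.+2 y yr')).
    by rewrite (gtr0_norm y0).
  have d2 := is_derive_run_poly N (hr x xr).1.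
  have nr : \near x, limn (pseries (a N) x) = (run_poly N).[sin x] / cos x ^+ N.+1.
    apply/nbhs_ballP; exists (r - `|x|); first by rewrite /= subr_gt0.
    move=> z; rewrite /ball /= distrC => xz; apply: IH.
    rewrite -(subrK x z) (le_lt_trans (ler_normD _ _)) // -ltrBrDr //.
  have d1' := near_eq_is_derive nr d1.
  by rewrite -(@derive_val _ _ _ _ _ _ _ d1') (@derive_val _ _ _ _ _ _ _ d2).
move=> N; have := main N 0; rewrite normr0 => /(_ r0).
by rewrite lim_pseries_at0 aE add0n divr1 sin0 cos0 expr1n divr1 horner_coef0.
Unshelve. all: by end_near. Qed.

End BernoulliEuler.

Section Kappa.
Variable R : realType.

Lemma run_poly_coefS N l : (run_poly R N.+1)`_l =
  l.+1%:R * (run_poly R N)`_l.+1 + (if l is k.+1 then (N.+1%:R - k%:R) * (run_poly R N)`_k else 0).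
Proof.
have -> : run_poly R N.+1 = (1 - 'X^2) * (run_poly R N)^`() + N.+1%:R *: ('X * run_poly R N) by [].
move: (run_poly R N) => q.
rewrite mulrBl mul1r coefD coefB coefXnM coefZ coefXM !coef_deriv -[_ *+ l.+1]mulr_natl.
case: l => [|[|k]] /=.
- by rewrite subr0 mulr0 !addr0.
- by rewrite !subr0.
have -> : (k.+2 - 2 = k)%N by lia.
by rewrite -[q`_k.+1 *+ _]mulr_natl; ring.
Qed.

Lemma run_poly_coef N l : (0 < N)%N ->
  (run_poly R N)`_l = (if (l <= N)%N then run_count N (N - l)%N else 0%N)%:R.
Proof.
case: N => // N _; elim: N l => [|N IH] l.
  rewrite run_poly_coefS /= !coefD !coefX !coef1.
  case: l => [|[|[|l]]] /=; rewrite ?run_count1 ?addr0 ?add0r ?mulr1 ?mulr0 ?subr0 ?coefD ?coefX ?coef1 /= ?addr0 ?add0r ?mulr1 ?mulr0 //.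
  by rewrite subrr.
rewrite run_poly_coefS IH.
case: l => [|l].
  rewrite subn0 /= [run_count N.+2 _]run_countS // (@run_count_gt N.+1 N.+2) // muln0 add0n addr0 mul1r.
  by rewrite subn1 /= subSn ?leqnn // subnn mul1n.
rewrite IH; have [lN|lN] := leqP l N.+1; last first.
  by rewrite !ifF ?mulr0 ?addr0 //; lia.
have -> : (l < N.+2)%N by lia.
have -> : (N.+2 - l.+1 = N.+1 - l)%N by lia.
rewrite [run_count N.+2 _]run_countS // natrD -natrB ?(leq_trans lN) // -!natrM.
have -> : (N.+2 - l = (N.+1 - l).+1)%N by lia.
rewrite addrC; congr (_ + _); case: ifP => h.
  have -> : (N.+1 - l = (N.+1 - l.+2).+2)%N by lia.
  by congr (_ * _)%:R; lia.
by rewrite muln0; have [->|->] : (N.+1 - l = 0 \/ N.+1 - l = 1)%N by lia.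
Qed.

Lemma run_poly_coef_last N : (run_poly R N)`_N.+1 = (N == 0%N)%:R.
Proof.
case: N => [|N]; first by rewrite coefD coefX coef1 addr0.
by rewrite run_poly_coef // ltnn.
Qed.

Definition kappa (n l : nat) : R := l`!%:R * (run_poly R (n + l).-1)`_l.

Lemma kappa_run_count n l : (0 < n + l)%N ->
  kappa n.+1 l = (l`! * run_count (n + l) n)%:R.
Proof.
by move=> nl; rewrite /kappa addSn /= run_poly_coef // leq_addl addnK natrM.
Qed.

Lemma kappa0 (K : nat -> R) n : bernoulli_euler K -> kappa n.+1 0 = K n.
Proof. by move=> hK; rewrite /kappa fact0 mul1r addn0 /= (bernoulli_euler_run_poly hK). Qed.

Lemma kappa1 (K : nat -> R) n : bernoulli_euler K -> kappa n 1 = K n.+1.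
Proof.
by move=> hK; rewrite /kappa factS fact0 muln1 mul1r addn1 (bernoulli_euler_run_poly hK) run_poly_coefS mul1r addr0.
Qed.

Lemma kappaSS n l :
  kappa n l.+2 = kappa n.+2 l.+1 - (l.+1)%:R * (n.+2)%:R * kappa n.+2 l.
Proof.
rewrite /kappa.
have -> : (n + l.+2).-1 = (n + l).+1 by lia.
have -> : (n.+2 + l.+1).-1 = (n + l).+2 by lia.
have -> : (n.+2 + l).-1 = (n + l).+1 by lia.
rewrite [(run_poly R (n + l).+2)`_l.+1]run_poly_coefS.
have -> : n.+2%:R = (n + l).+2%:R - l%:R :> R by rewrite -natrB; [congr (_%:R)|]; lia.
rewrite !factS !natrM; ring.
Qed.

Lemma kappa_0 l : (0 < l)%N -> kappa 0 l = (l == 1%N)%:R.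
Proof.
case: l => // l _; rewrite /kappa add0n /= run_poly_coef_last.
by case: l => [|l]; rewrite ?mulr1 ?mulr0.
Qed.

End Kappa.

(** * Connected components *)

Section Topology.

Lemma open_injective_connected (T U : topologicalType) (S : set T) (f : T -> U) :
  (forall z, S z -> nbhs z S) -> {in S &, injective f} ->
  (forall z A, S z -> nbhs z A -> nbhs (f z) (f @` A)) ->
  connected (f @` S) -> connected S.
Proof.
move=> oS injf of_ cf B [b Bb] [C oC BC] [D cD BD].
have sBS : B `<=` S by rewrite BC => z [].
have inj z w : S z -> S w -> f z = f w -> z = w by move=> Sz Sw; apply: injf; rewrite inE.
have open_image O : (forall z, O z -> S z /\ nbhs z O) -> open (f @` O).
  move=> hO; rewrite openE => _ [z Oz <-]; have [Sz nO] := hO z Oz; exact: of_.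
have e : f @` B = f @` S.
  apply: cf; first by exists (f b), b.
  - exists (f @` B); last by apply/seteqP; split=> [_ [z Bz <-]|y []//]; split; exists z => //; exact: sBS.
    apply: open_image => z; rewrite BC => -[Sz Cz]; split=> //.
    by apply: filterI; [exact: oS|exact: open_nbhs_nbhs].
  - exists (~` (f @` (S `&` ~` D))).
      apply: open_closedC; apply: open_image => z [Sz nDz]; split=> //.
      by apply: filterI; [exact: oS|apply: open_nbhs_nbhs; split=> //; exact: closed_openC].
    apply/seteqP; split=> [_ [z Bz <-]|y [[z Sz <-] nD]].
      split; first by exists z => //; exact: sBS.
      move=> [w [Sw nDw] /inj e]; apply: nDw; rewrite (e Sw (sBS z Bz)).
      by move: Bz; rewrite BD => -[].
    exists z => //; rewrite BD; split=> //; apply: contrapT => nDz; apply: nD.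
    by exists z.
apply/seteqP; split=> // z Sz; have : (f @` B) (f z) by rewrite e; exists z.
by move=> [w Bw /inj <-//]; exact: sBS.
Qed.

Lemma components_partition (T : topologicalType) (A : set T) (I : finType) (V : {set I}) (S : I -> set T) :
  (forall i, i \in V -> [/\ S i !=set0, S i `<=` A, connected (S i) &
     exists2 C, open C & S i = A `&` C]) ->
  (forall x, A x -> exists2 i, i \in V & S i x) ->
  (forall i j x, S i x -> S j x -> i = j) ->
  finite_set (components A) /\ #|` fset_set (components A)| = #|V|.
Proof.
move=> hS cov disj.
have comp i x : i \in V -> S i x -> connected_component A x = S i.
  move=> iV Six; have [_ SA cS [C oC SC]] := hS i iV.
  apply/seteqP; split; last exact: connected_component_max.
  move=> y [D /= [Dx DA cD] Dy].
  have e : D `&` S i = D; last by move: Dy; rewrite -e => -[].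
  apply: cD; first by exists x.
    exists C => //; rewrite SC; apply/seteqP; split=> z; first by case=> Dz [_ Cz].
    by case=> Dz Cz; split=> //; split=> //; exact: DA.
  pose O := [set z | exists j W, [/\ open W, S j = A `&` W, W z, j != i & j \in V]].
  exists (~` O).
    apply: open_closedC; rewrite openE => z [j [W [hW SW Wz ji jV]]].
    by apply: (filterS _ (open_nbhs_nbhs (conj hW Wz))) => w Ww; exists j, W.
  apply/seteqP; split=> z [Dz].
    move=> Siz; split=> // -[j [W [_ SW Wz ji jV]]]; move/eqP: ji; apply.
    by apply: disj Siz; rewrite SW; split=> //; exact: DA.
  move=> nO; split=> //; have [j jV Sjz] := cov z (DA z Dz).
  have [<-//|ji] := eqVneq j i; case: nO.
  have [_ _ _ [W hW SW]] := hS j jV; exists j, W; split=> //.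
  by move: Sjz; rewrite SW => -[].
have cE : components A = S @` [set i | i \in V].
  apply/seteqP; split=> [_ [x Ax <-]|_ [i iV <-]].
    by have [i iV Six] := cov x Ax; exists i => //; rewrite (comp i).
  have [[x Six] SA _ _] := hS i iV; exists x; first exact: SA.
  exact: comp.
have fin : finite_set (components A).
  by rewrite cE; apply: finite_image; exact: finite_finset.
split=> //.
have -> : fset_set (components A) = [fset S i | i in V]%fset.
  apply/fsetP => X; rewrite in_fset_set //; apply/idP/imfsetP.
    by rewrite inE cE => -[i iV <-]; exists i.
  by move=> [i /= iV ->]; rewrite inE cE; exists i.
rewrite card_in_imfset /=; first by rewrite cardE.
move=> i j iV jV e; have [[x Six] _ _ _] := hS i iV.
by apply: (disj i j x) => //; rewrite -e.
Qed.

End Topology.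

(** * Polynomials with real critical points *)

Section RowVectors.
Variables (R : realType) (m : nat).
Implicit Types p : 'rV[R]_m.

Lemma coord_le_norm p i : `|p 0 i| <= `|p|.
Proof.
by rewrite [leRHS]/Num.Def.normr /= mx_normrE; apply: (le_bigmax _ (fun i => `|p i.1 i.2|) (0, i)).
Qed.

Lemma norm_le_coord p e : 0 <= e -> (forall i, `|p 0 i| <= e) -> `|p| <= e.
Proof.
move=> e0 h; rewrite /Num.Def.normr /= mx_normrE; apply: bigmax_le => // -[i j] _ /=.
by rewrite ord1.
Qed.

Lemma norm_lt_coord p e : 0 < e -> (forall i, `|p 0 i| < e) -> `|p| < e.
Proof.
move=> e0 h; rewrite /Num.Def.normr /= mx_normrE; apply: bigmax_lt => // -[i j] _ /=.
by rewrite ord1.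
Qed.

Lemma cvg_rV (T : Type) (F : set_system T) {FF : Filter F} (f : T -> 'rV[R]_m) p :
  (forall i, (f t 0 i) @[t --> F] --> p 0 i) -> f @ F --> p.
Proof.
move=> h; apply/cvgrPdist_lt => e e0.
have /filterS : \forall t \near F, forall i, `|p 0 i - f t 0 i| < e.
  by apply: filter_forall => i; have /cvgrPdist_lt := h i; apply.
by apply=> t ht; apply: norm_lt_coord => // i; rewrite !mxE.
Qed.

Lemma cvg_coord (T : Type) (F : set_system T) {FF : Filter F} (f : T -> 'rV[R]_m) p i :
  f @ F --> p -> (f t 0 i) @[t --> F] --> p 0 i.
Proof. exact: (@continuous_cvg _ _ _ F FF f (fun v => v 0 i) p (@coord_continuous R 1 m 0 i p)). Qed.

Lemma cvg_sumr (T I : Type) (F : set_system T) {FF : Filter F} (r : seq I) (f : I -> T -> R) (a : I -> R) :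
  (forall i, f i t @[t --> F] --> a i) ->
  (\sum_(i <- r) f i t) @[t --> F] --> \sum_(i <- r) a i.
Proof.
move=> h; elim: r => [|i r IH].
  by under eq_fun do rewrite big_nil; rewrite big_nil; exact: cvg_cst.
by under eq_fun do rewrite big_cons; rewrite big_cons; apply: cvgD.
Qed.

End RowVectors.

Section CriticalPoints.
Variable R : realType.

(* Unlike in P_n, the constant coefficient is free (when m > 0), so that the
   critical values are m independent parameters. *)
Definition centered m (p : 'rV[R]_m) : {poly R} := 'X^(m.+1) + rVpoly p.

Definition critical m (p c : 'rV[R]_m) : Prop :=
  (centered p)^`() = m.+1%:R *: \prod_(k < m) ('X - (c 0 k)%:P) /\
  forall k k' : 'I_m, (k < k')%N -> c 0 k < c 0 k'.

Section Fixed_m.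
Variable m : nat.
Implicit Types (p q c : 'rV[R]_m) (x y : R).

Lemma horner_centered p x : (centered p).[x] = x ^+ m.+1 + \sum_(i < m) p 0 i * x ^+ i.
Proof.
rewrite hornerD hornerXn; congr (_ + _); rewrite (horner_coef_wide x (size_poly _ _)).
by apply: eq_bigr => i _; rewrite coef_rVpoly_ord.
Qed.

Lemma horner_deriv_centered p x :
  (centered p)^`().[x] = m.+1%:R * x ^+ m + \sum_(i < m) p 0 i * (i%:R * x ^+ i.-1).
Proof.
rewrite derivD hornerD derivXn /= -[X in X.[x] + _]scaler_nat hornerZ hornerXn; congr (_ + _).
rewrite (_ : rVpoly p = \sum_(i < m) p 0 i *: 'X^i); last first.
  rewrite /rVpoly poly_def; apply: eq_bigr => i _; by rewrite valK.
rewrite linear_sum horner_sum; apply: eq_bigr => i _.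
by rewrite /= derivZ derivXn hornerZ -scaler_nat hornerZ hornerXn.
Qed.

Lemma cvg_horner (T : Type) (F : set_system T) {FF : Filter F} (f : T -> 'rV[R]_m) (g : T -> R) p x :
  f @ F --> p -> g @ F --> x -> (centered (f t)).[g t] @[t --> F] --> (centered p).[x].
Proof.
move=> fp gx; rewrite horner_centered; under eq_fun do rewrite horner_centered.
apply: cvgD; first exact: (@continuous_cvg _ _ _ F FF g _ x (@exprn_continuous _ m.+1 x) gx).
apply: cvg_sumr => i; apply: cvgM; first exact: cvg_coord.
exact: (@continuous_cvg _ _ _ F FF g _ x (@exprn_continuous _ i x) gx).
Qed.

Lemma cvg_horner_deriv (T : Type) (F : set_system T) {FF : Filter F} (f : T -> 'rV[R]_m) (g : T -> R) p x :
  f @ F --> p -> g @ F --> x -> (centered (f t))^`().[g t] @[t --> F] --> (centered p)^`().[x].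
Proof.
have cX n : g @ F --> x -> g t ^+ n @[t --> F] --> x ^+ n.
  by move=> gx; exact: (@continuous_cvg _ _ _ F FF g _ x (@exprn_continuous _ n x) gx).
move=> fp gx; rewrite horner_deriv_centered; under eq_fun do rewrite horner_deriv_centered.
apply: cvgD; first by apply: cvgM; [exact: cvg_cst|exact: cX].
apply: cvg_sumr => i; apply: cvgM; first exact: cvg_coord.
by apply: cvgM; [exact: cvg_cst|exact: cX].
Qed.

Lemma size_centered_sub (p q : 'rV[R]_m) : (size (centered p - centered q)%R <= m)%N.
Proof. by rewrite /centered opprD addrACA subrr add0r -linearB /= size_poly. Qed.

Lemma centered_inj : injective (@centered m).
Proof. by move=> p q /addrI/(congr1 (@poly_rV R m)); rewrite !rVpolyK. Qed.

Lemma critical_lt p c k k' : critical p c -> (c 0 k < c 0 k') = (k < k')%N.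
Proof.
move=> [_ h]; case: (ltngtP k k') => [/h//|/h kk|/val_inj->]; last exact: ltxx.
by apply/negbTE; rewrite -leNgt ltW.
Qed.

Lemma critical_le p c k k' : critical p c -> (c 0 k <= c 0 k') = (k <= k')%N.
Proof. by move=> h; rewrite leNgt (critical_lt _ _ h) -leqNgt. Qed.

Lemma critical_deriv p c x : critical p c ->
  (centered p)^`().[x] = m.+1%:R * \prod_(k < m) (x - c 0 k).
Proof.
by move=> [-> _]; rewrite hornerZ horner_prod; under eq_bigr do rewrite hornerXsubC.
Qed.

Lemma critical_root p c k : critical p c -> (centered p)^`().[c 0 k] = 0.
Proof. by move=> /critical_deriv->; rewrite (bigD1 k) //= subrr mul0r mulr0. Qed.

Lemma critical_sign p c x : critical p c -> (forall k, x != c 0 k) ->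
  0 < (-1) ^+ #|[set k | x <= c 0 k]%SET| * (centered p)^`().[x].
Proof.
move=> pc xc; rewrite (critical_deriv _ pc) mulrCA mulr_gt0 ?ltr0n //.
have -> : (-1) ^+ #|[set k | x <= c 0 k]%SET| = \prod_(k < m) (if x <= c 0 k then -1 else 1) :> R.
  by rewrite -big_mkcond /= -prodr_const; apply: eq_bigl => k; rewrite inE.
rewrite -big_split /=; apply: prodr_gt0 => k _ /=; case: (leP x (c 0 k)) => h.
  by rewrite mulN1r opprB subr_gt0 lt_neqAle xc.
by rewrite mul1r subr_gt0.
Qed.

Lemma critical_mono p c x y : critical p c -> x < y ->
  (forall k, ~~ (x < c 0 k < y)) ->
  0 < (-1) ^+ #|[set k | y <= c 0 k]%SET| * ((centered p).[y] - (centered p).[x]).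
Proof.
move=> pc xy nk; have [z] := polyrcf.poly_mvt (centered p) xy.
rewrite in_itv /= => /andP[xz zy] ->; rewrite mulrA mulr_gt0 ?subr_gt0 //.
have -> : [set k | y <= c 0 k]%SET = [set k | z <= c 0 k]%SET.
  apply/setP => k; rewrite !inE; apply/idP/idP => [|zk]; first exact/le_trans/ltW.
  by have := nk k; rewrite (lt_le_trans xz zk) /= -leNgt.
apply: critical_sign => // k; apply: contra (nk k) => /eqP <-.
by rewrite xz zy.
Qed.

Lemma critical_ltE p c x y : critical p c -> x < y ->
  (forall k, ~~ (x < c 0 k < y)) ->
  ((centered p).[x] < (centered p).[y]) = ~~ odd #|[set k | y <= c 0 k]%SET|.
Proof.
move=> pc xy nk; have := critical_mono pc xy nk; rewrite -signr_odd.
case: (odd _); rewrite ?mulN1r ?mul1r ?oppr_gt0 ?subr_lt0 ?subr_gt0 //.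
by move=> /ltW; rewrite leNgt => /negbTE.
Qed.

Lemma critical_card p c (k : 'I_m) : critical p c -> #|[set j | c 0 k <= c 0 j]%SET| = (m - k)%N.
Proof.
move=> pc; rewrite (_ : [set j | _]%SET = ~: [set j : 'I_m | (j < k)%N]%SET); last first.
  by apply/setP => j; rewrite !inE (critical_le _ _ pc) leqNgt.
rewrite cardsCs finset.setCK card_ord; congr (_ - _)%N.
rewrite -[RHS]card_ord -(card_imset (f := widen_ord (ltnW (ltn_ord k)))).
  apply: eq_card => a; rewrite inE; apply/idP/imsetP => [ak|[b _ ->]]; last exact: ltn_ord b.
  by exists (Ordinal ak) => //; apply: val_inj.
by move=> a b /(congr1 val)/= /val_inj.
Qed.

Lemma critical_extremum p c (k : 'I_m) x : critical p c ->
  (forall j : 'I_m, (j < k)%N -> c 0 j <= x) -> (forall j : 'I_m, (k < j)%N -> x <= c 0 j) ->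
  (-1) ^+ (m - k) * (centered p).[x] <= (-1) ^+ (m - k) * (centered p).[c 0 k].
Proof.
move=> pc lx xg; case: (ltgtP x (c 0 k)) => [xk|kx|->]; last exact: lexx.
  have := @critical_mono p c x (c 0 k) pc xk; rewrite (critical_card _ pc) => h.
  rewrite -subr_ge0 -mulrBr ltW //; apply: h => j; apply/negP => /andP[xj].
  by rewrite (critical_lt _ _ pc) => /lx; rewrite leNgt xj.
have := @critical_mono p c (c 0 k) x pc kx.
have -> : #|[set j | x <= c 0 j]%SET| = (m - k).-1.
  rewrite -(critical_card k pc) (cardsD1 k [set j | c 0 k <= c 0 j]%SET) inE lexx /=.
  apply: eq_card => j; rewrite !inE (critical_le _ _ pc); apply/idP/andP => [xj|[jk kj]].
    have kj : c 0 k < c 0 j := lt_le_trans kx xj.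
    rewrite (critical_lt _ _ pc) in kj; by rewrite ltnW // -(inj_eq val_inj) /= gtn_eqF.
  by apply: xg; rewrite ltn_neqAle kj andbT eq_sym; apply: contra jk => /eqP/val_inj->.
move=> h; have {h} : 0 < (-1) ^+ (m - k).-1 * ((centered p).[x] - (centered p).[c 0 k]).
  apply: h => j; apply/negP => /andP[]; rewrite (critical_lt _ _ pc) => /xg.
  by rewrite leNgt => /negbTE->.
have -> : (m - k = (m - k).-1.+1)%N by rewrite prednK // subn_gt0.
rewrite exprS /= => h; move: h; rewrite mulrBr !mulN1r !mulNr lerN2 subr_gt0; exact: ltW.
Qed.

End Fixed_m.
End CriticalPoints.

Section CriticalValues.
Variables (R : realType) (m : nat).
Implicit Types (p q c d : 'rV[R]_m) (x y : R).

Lemma size_centered p : size (centered p) = m.+2.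
Proof.
rewrite size_polyDl size_polyXn // ltnS; exact: leq_trans (size_poly _ _) (leqnSn _).
Qed.

Lemma lead_coef_centered p : lead_coef (centered p) = 1.
Proof.
rewrite lead_coefDl ?lead_coefXn // size_polyXn ltnS; exact: leq_trans (size_poly _ _) (leqnSn _).
Qed.

Lemma coef_centered_m p : (centered p)`_m = 0.
Proof.
rewrite coefD coefXn (_ : (m == m.+1) = false) ?add0r; last by lia.
by rewrite nth_default // size_poly.
Qed.

Lemma critical_of_roots p c : (forall k, (centered p)^`().[c 0 k] = 0) ->
  (forall k k' : 'I_m, (k < k')%N -> c 0 k < c 0 k') -> critical p c.
Proof.
move=> rc ic; split=> //.
pose rs := [seq c 0 k | k <- enum 'I_m].
have sz : size (centered p)^`() = m.+1.
  apply/eqP; rewrite eqn_leq; apply/andP; split.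
    by have := lt_size_deriv (p := centered p); rewrite size_centered ltnS; apply; rewrite -size_poly_gt0 size_centered.
  rewrite ltnNge; apply/negP => h; have : (centered p)^`()`_m = 0 by rewrite nth_default.
  rewrite coef_deriv -[m.+1]/(m.+2.-1) -(size_centered p) -lead_coefE lead_coef_centered size_centered.
  by move/eqP; rewrite pnatr_eq0.
rewrite [LHS](@all_roots_prod_XsubC _ _ rs).
- congr (_ *: _).
    rewrite lead_coefE sz coef_deriv -[m.+1 in LHS]/(m.+2.-1) -{1}(size_centered p) -lead_coefE lead_coef_centered //.
  by rewrite big_map big_enum.
- by rewrite sz size_map size_enum_ord.
- by apply/allP => _ /mapP[k _ ->]; apply/rootP.
- rewrite uniq_rootsE map_inj_uniq ?enum_uniq // => k k' e.
  by case: (ltngtP k k') => [/ic|/ic|/val_inj//]; rewrite e ltxx.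
Qed.

Lemma critical_inj p c d : critical p c -> critical p d -> c = d.
Proof.
move=> pc pd; pose S c := [seq (c : 'rV[R]_m) 0 k | k <- enum 'I_m].
have st e : critical p e -> sorted <%R (S e).
  move=> pe; rewrite sorted_map /relpre /=; apply: (@sub_sorted _ (fun i j : 'I_m => (i < j)%N)).
    by move=> i j ij /=; rewrite (critical_lt _ _ pe).
  by have := iota_ltn_sorted 0 m; rewrite -val_enum_ord sorted_map.
have mem e x : critical p e -> (x \in S e) = ((centered p)^`().[x] == 0).
  move=> pe; rewrite (critical_deriv _ pe) mulf_eq0 pnatr_eq0 /= prodf_seq_eq0.
  apply/mapP/hasP => -[k ks h]; exists k; rewrite ?mem_index_enum ?mem_enum //=.
    by rewrite h subrr.
  by move: h; rewrite subr_eq0 => /eqP.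
have : S c = S d.
  apply: (irr_sorted_eq lt_trans ltxx (st _ pc) (st _ pd)) => x.
  by rewrite !mem.
by move=> /eq_in_map e; apply/rowP => k; apply: e; rewrite mem_enum.
Qed.

Lemma interlaced_inj p q c d : critical p c -> critical q d ->
  (forall k, (centered p).[c 0 k] = (centered q).[d 0 k]) ->
  (forall k k' : 'I_m, (k < k')%N -> c 0 k < d 0 k' /\ d 0 k < c 0 k') -> p = q.
Proof.
move=> pc qd ev il; apply: centered_inj; apply/eqP; rewrite -subr_eq0; apply/eqP.
pose G := centered p - centered q.
have rt k : exists x, [/\ root G x, Num.min (c 0 k) (d 0 k) <= x & x <= Num.max (c 0 k) (d 0 k)].
  have h1 := @critical_extremum _ _ q d k (c 0 k) qd.
  have h2 := @critical_extremum _ _ p c k (d 0 k) pc.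
  have {}h1 := h1 (fun j jk => ltW (il j k jk).2) (fun j kj => ltW (il k j kj).1).
  have {}h2 := h2 (fun j jk => ltW (il j k jk).1) (fun j kj => ltW (il k j kj).2).
  have sg : G.[c 0 k] * G.[d 0 k] <= 0.
    have : (-1) ^+ (m - k) * (-1) ^+ (m - k) = 1 :> R by rewrite -expr2 sqrr_sign.
    have GE x : G.[x] = (centered p).[x] - (centered q).[x] by rewrite hornerD hornerN.
    move: h1 h2; rewrite !GE -ev; set s := (-1) ^+ _ => h1 h2 ss.
    rewrite -[leLHS]mul1r -{1}ss mulrACA.
    by apply: mulr_ge0_le0; rewrite mulrBr ?subr_ge0 ?subr_le0.
  have [cd|dc] := leP (c 0 k) (d 0 k).
    by have [x] := polyrcf.poly_ivt cd sg; rewrite in_itv /= => /andP[? ?] ?; exists x.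
  rewrite mulrC in sg.
  by have [x] := polyrcf.poly_ivt (ltW dc) sg; rewrite in_itv /= => /andP[? ?] ?; exists x.
have [x xP] := boolp.choice rt.
pose rs := [seq x k | k <- enum 'I_m].
apply/eqP; apply: contraT => G0; have := @max_poly_roots _ G rs G0.
have -> : all (root G) rs by apply/allP => _ /mapP[k _ ->]; case: (xP k).
have -> : uniq rs.
  rewrite map_inj_uniq ?enum_uniq // => k k' e.
  have lt (a b : 'I_m) : (a < b)%N -> x a < x b.
    move=> ab; have [_ _ h1] := xP a; have [_ h2 _] := xP b.
    apply: le_lt_trans h1 (lt_le_trans _ h2).
    have [i1 i2] := il a b ab.
    by rewrite gt_max !lt_min i1 i2 (pc.2 _ _ ab) (qd.2 _ _ ab).
  by case: (ltngtP k k') => [/lt|/lt|/val_inj//]; rewrite e ltxx.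
move=> /(_ isT isT); rewrite size_map size_enum_ord ltnNge.
by rewrite (leq_trans (size_centered_sub _ _)).
Qed.

Lemma critical_gap p c (e : R) : critical p c -> 0 < e ->
  exists2 g, 0 < g <= e & forall k k' : 'I_m, (k < k')%N -> c 0 k + g <= c 0 k' - g.
Proof.
move=> pc e0.
have : \forall g \near 0^'+, forall kk : 'I_m * 'I_m, (kk.1 < kk.2)%N -> c 0 kk.1 + g <= c 0 kk.2 - g.
  apply: filter_forall => -[k k'] /=; case: (ltnP k k') => kk; last first.
    by apply: nearW.
  have h : 0 < (c 0 k' - c 0 k) / 2 by rewrite divr_gt0 // subr_gt0 (pc.2 _ _ kk).
  near=> g => _; have : g < (c 0 k' - c 0 k) / 2 by near: g; exact: nbhs_right_lt.
  lra.
move=> near1.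
have /filter_ex[g [g0 [ge hg]]] : \forall g \near 0^'+, 0 < g /\ (g < e /\
    forall kk : 'I_m * 'I_m, (kk.1 < kk.2)%N -> c 0 kk.1 + g <= c 0 kk.2 - g).
  near=> g; split; first by near: g; exact: nbhs_right_gt.
  by split; near: g => //; exact: nbhs_right_lt.
exists g; first by rewrite g0 ltW.
by move=> k k' kk; exact: (hg (k, k')).
Unshelve. all: by end_near. Qed.

Lemma critical_near p c (e : R) : critical p c -> 0 < e ->
  \forall q \near p, exists2 d, critical q d & forall k, `|d 0 k - c 0 k| < e.
Proof.
move=> pc e0; have [g /andP[g0 ge] hg] := critical_gap pc e0.
pose f q x := (centered q)^`().[x].
have fp k : f p (c 0 k - g) * f p (c 0 k + g) < 0.
  rewrite /f !(critical_deriv _ pc) mulrACA pmulr_rlt0 ?mulr_gt0 ?ltr0n //.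
  rewrite -big_split (bigD1 k) //= pmulr_llt0; last first.
    apply: prodr_gt0 => j jk /=.
    have : c 0 k + g <= c 0 j - g \/ c 0 j + g <= c 0 k - g.
      case: (ltngtP j k) => [/hg|/hg|/val_inj e']; [by right|by left|].
      by rewrite e' eqxx in jk.
    by case=> h; nra.
  by have := g0; nra.
have near1 x : f p x != 0 -> \forall q \near p, 0 < f q x * f p x.
  move=> fx; have : f q x * f p x @[q --> p] --> f p x * f p x.
    have h : f q x @[q --> p] --> f p x.
      by apply: (@cvg_horner_deriv R m _ (nbhs p) _ id (cst x)); [exact: cvg_id|exact: cvg_cst].
    apply: (cvgM h); apply: cvg_cst.
  move=> /cvgr_gt; apply; by rewrite -expr2 lt_def sqrf_eq0 fx sqr_ge0.
have f1 k : f p (c 0 k - g) != 0 by have := fp k; case: eqP => // ->; rewrite mul0r ltxx.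
have f2 k : f p (c 0 k + g) != 0 by have := fp k; case: eqP => // ->; rewrite mulr0 ltxx.
have : \forall q \near p, forall k, 0 < f q (c 0 k - g) * f p (c 0 k - g) /\
    0 < f q (c 0 k + g) * f p (c 0 k + g).
  have h k : \forall q \near p, 0 < f q (c 0 k - g) * f p (c 0 k - g) /\
      0 < f q (c 0 k + g) * f p (c 0 k + g).
    by apply: filterI; exact: near1.
  exact: filter_forall h.
apply: filterS => q hq.
have rt k : exists x, root (centered q)^`() x /\ (c 0 k - g < x < c 0 k + g).
  have [h1 h2] := hq k.
  have le : c 0 k - g <= c 0 k + g by have := g0; lra.
  have sg : (centered q)^`().[c 0 k - g] * (centered q)^`().[c 0 k + g] < 0.
    have := mulr_gt0 h1 h2; rewrite mulrACA.
    by rewrite (nmulr_lgt0 _ (fp k)).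
  by have [x] := polyrcf.poly_ivtoo le sg; rewrite in_itv /= => ? ?; exists x.
have [x xP] := boolp.choice rt.
exists (\row_k x k).
  apply: critical_of_roots => [k|k k' kk]; rewrite !mxE; first by have [/rootP] := xP k.
  have [_ /andP[_ h1]] := xP k; have [_ /andP[h2 _]] := xP k'.
  by apply: lt_trans h1 (le_lt_trans (hg _ _ kk) h2).
move=> k; rewrite mxE; have [_ h] := xP k; rewrite (lt_le_trans _ ge) // ltr_norml; lra.
Unshelve. all: by end_near. Qed.

End CriticalValues.

Section CriticalValueMap.
Variables (R : realType) (m : nat).
Implicit Types (p q c d y : 'rV[R]_m).

Definition hyperbolic p := exists c, critical p c.
Definition crits p : 'rV[R]_m := xget 0 [set c | critical p c].
Definition crit_values p : 'rV[R]_m := \row_k (centered p).[crits p 0 k].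

Lemma critical_crits p : hyperbolic p -> critical p (crits p).
Proof. by move=> hp; rewrite /crits; case: xgetP => [c -> //|h]; case: hp => c /h. Qed.

Lemma crits_critical p c : critical p c -> crits p = c.
Proof. by move=> pc; apply: (critical_inj _ pc); apply: critical_crits; exists c. Qed.

Lemma crit_valuesE p c k : critical p c -> crit_values p 0 k = (centered p).[c 0 k].
Proof. by move=> pc; rewrite mxE (crits_critical pc). Qed.

Lemma hyperbolic_near p : hyperbolic p -> \forall q \near p, hyperbolic q.
Proof.
move=> [c pc]; apply: filterS (critical_near pc (@ltr01 R)) => q [d qd _].
by exists d.
Qed.

Lemma cvg_crits p : hyperbolic p -> crits q @[q --> p] --> crits p.
Proof.
move=> hp; have pc := critical_crits hp; apply/(@cvgrPdist_lt R 'rV[R]_m _ (nbhs p)) => e e0.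
apply: filterS (critical_near pc e0) => q [d qd h].
by apply: norm_lt_coord => // i; rewrite !mxE (crits_critical qd) distrC.
Qed.

Lemma cvg_crit_values p : hyperbolic p -> crit_values q @[q --> p] --> crit_values p.
Proof.
move=> hp; apply: (@cvg_rV R m _ (nbhs p)) => i; rewrite mxE.
rewrite (_ : (fun q => _) = (fun q => (centered q).[crits q 0 i])); last first.
  by apply/funext => q; rewrite mxE.
apply: (@cvg_horner R m _ (nbhs p) _ id (fun q => crits q 0 i)); first exact: cvg_id.
by apply: (@cvg_coord R m _ (nbhs p)); exact: cvg_crits.
Qed.

Lemma lagrange c y : (forall k k' : 'I_m, (k < k')%N -> c 0 k < c 0 k') ->
  exists d, forall k, (rVpoly d).[c 0 k] = y 0 k.
Proof.
move=> ic; pose W := Vandermonde m c.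
have Wu : W \in unitmx.
  rewrite unitmxE det_Vandermonde unitfE; apply/prodf_neq0 => i _; apply/prodf_neq0 => j ij.
  by rewrite subr_eq0 gt_eqF // ic.
exists (y *m invmx W) => k.
rewrite (horner_coef_wide _ (size_poly _ _)).
transitivity ((y *m invmx W *m W) 0 k); last by rewrite mulmxKV.
rewrite [RHS]mxE; apply: eq_bigr => i _; by rewrite coef_rVpoly_ord !mxE.
Qed.

(* The envelope theorem: when p moves in direction d, the critical values move,
   to first order, like the values of d at the critical points. *)
Lemma crit_values_descent p y (A : set 'rV[R]_m) : hyperbolic p -> nbhs p A ->
  crit_values p != y ->
  exists q, [/\ A q, hyperbolic q & `|crit_values q - y| < `|crit_values p - y|].
Proof.
move=> hp nA py; have pc := critical_crits hp; set c := crits p in pc.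
pose D := `|crit_values p - y|; have D0 : 0 < D by rewrite normr_gt0 subr_eq0.
have [d hd] := lagrange (y - crit_values p) pc.2.
have [g /andP[g0 _] hg] := critical_gap pc (@ltr01 R).
have : \forall e \near 0^'+, forall k x, `|x - c 0 k| < e -> `|(rVpoly d).[x] - (rVpoly d).[c 0 k]| < D / 2.
  have h (k : 'I_m) : \forall e \near 0^'+, forall x, `|x - c 0 k| < e -> `|(rVpoly d).[x] - (rVpoly d).[c 0 k]| < D / 2.
    have /cvgrPdist_lt/(_ (D / 2)) := @continuous_horner R (rVpoly d) (c 0 k).
    rewrite divr_gt0 // => /(_ isT)/nbhs_ballP[e /= e0 he].
    have : \forall t \near 0^'+, t < e by exact: nbhs_right_lt.
    apply: filterS => t te x xt; rewrite distrC; apply: he.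
    by rewrite /ball /= distrC (lt_trans xt).
  exact: filter_forall h.
move=> near1.
have /filter_ex[e [e0 [eg he]]] : \forall e \near 0^'+, 0 < e /\ (e < g /\ forall k x,
    `|x - c 0 k| < e -> `|(rVpoly d).[x] - (rVpoly d).[c 0 k]| < D / 2).
  near=> e; split; first by near: e; exact: nbhs_right_gt.
  by split; near: e => //; exact: nbhs_right_lt.
have near2 := critical_near pc e0.
have cs : p + s *: d @[s --> (0 : R)] --> p.
  rewrite -[X in _ --> X]addr0 -(scale0r d).
  by apply: cvgD; [exact: cvg_cst|apply: cvgZr_tmp; exact: cvg_id].
have near3 : \forall s \near (0 : R), A (p + s *: d) /\
    exists2 c', critical (p + s *: d) c' & forall k, `|c' 0 k - c 0 k| < e.
  exact: (cs _ (filterI nA near2)).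
have near4 : \forall s \near 0^'+, A (p + s *: d) /\
    exists2 c', critical (p + s *: d) c' & forall k, `|c' 0 k - c 0 k| < e.
  exact: cvg_at_right_filter near3.
have /filter_ex[s [s0 [s1 [As [c' qc hc']]]]] : \forall s \near 0^'+, 0 < s /\ (s < 1 /\
    (A (p + s *: d) /\ exists2 c', critical (p + s *: d) c' & forall k, `|c' 0 k - c 0 k| < e)).
  near=> s; split; first by near: s; exact: nbhs_right_gt.
  by split; near: s => //; exact: nbhs_right_lt.
exists (p + s *: d); split=> //; first by exists c'.
have evq x : (centered (p + s *: d)).[x] = (centered p).[x] + s * (rVpoly d).[x].
  by rewrite /centered linearD linearZ addrA hornerD hornerZ.
rewrite -/D; apply: norm_lt_coord => // k.
have yk : y 0 k - crit_values p 0 k = (rVpoly d).[c 0 k] by rewrite hd !mxE.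
have Dk : `|crit_values p 0 k - y 0 k| <= D.
  by have := coord_le_norm (crit_values p - y) k; rewrite !mxE.
have il (i j : 'I_m) : (i < j)%N -> c 0 i < c' 0 j /\ c' 0 i < c 0 j.
  move=> ij; have := hg _ _ ij; have := hc' i; have := hc' j; rewrite !ltr_norml; lra.
have h1 := @critical_extremum _ _ p c k (c' 0 k) pc
  (fun j jk => ltW (il j k jk).1) (fun j kj => ltW (il k j kj).2).
have h2 := @critical_extremum _ _ _ c' k (c 0 k) qc
  (fun j jk => ltW (il j k jk).2) (fun j kj => ltW (il k j kj).1).
have h3 := he k _ (hc' k).
rewrite !mxE (crits_critical qc).
move: h1 h2 h3 Dk yk; rewrite !evq -(crit_valuesE k pc).
move: (crit_values p 0 k) (y 0 k) ((centered p).[c' 0 k]) ((rVpoly d).[c' 0 k]) ((rVpoly d).[c 0 k]).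
move: (signr_odd R (m - k)) => <- V Y P u r h1 h2 h3 Dk yk.
subst r; clear -h1 h2 h3 Dk s0 s1 D0.
have s1' : 0 < 1 - s by rewrite subr_gt0.
have h4 : `|(1 - s) * (V - Y)| <= (1 - s) * D by rewrite normrM gtr0_norm // ler_pM2l.
have h5 : `|P + s * u - V - s * (Y - V)| <= s * (D / 2).
  have h6 : s * `|u - (Y - V)| <= s * (D / 2) by rewrite ler_pM2l // ltW.
  apply: le_trans h6.
  have -> : s * `|u - (Y - V)| = `|s * (u - (Y - V))| by rewrite normrM (gtr0_norm s0).
  move: h1 h2; case: (odd _); rewrite ?expr1 ?expr0 ?mulN1r ?mul1r ?lerN2 => h1 h2.
    by rewrite !ler0_norm; lra.
  by rewrite !ger0_norm; lra.
have -> : P + s * u - Y = (P + s * u - V - s * (Y - V)) + (1 - s) * (V - Y) by ring.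
apply: le_lt_trans (ler_normD _ _) _; nra.
Unshelve. all: by end_near. Qed.

End CriticalValueMap.

(** * Polynomials with given critical values *)

Section OpenMap.
Variables (R : realType) (m : nat).
Implicit Types (p q c d y : 'rV[R]_m).

Lemma box_compact (M : 'rV[R]_m) (e : R) : compact [set q : 'rV[R]_m | forall i, `[M 0 i - e, M 0 i + e]%classic (q 0 i)].
Proof. by apply: (@rV_compact R m (fun i => `[M 0 i - e, M 0 i + e]%classic)) => i; exact: segment_compact. Qed.

Lemma crit_values_dist_continuous (A : set 'rV[R]_m) y : (forall q, A q -> hyperbolic q) ->
  {within A, continuous (fun q => `|crit_values q - y|)}.
Proof.
move=> hA; apply: continuous_in_subspaceT => q; rewrite inE => /hA hq.
apply: (@cvg_norm _ _ _ (nbhs q)).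
apply: (@cvgB _ _ _ (nbhs q)); [exact: cvg_crit_values|exact: cvg_cst].
Qed.

Lemma crit_values_open p (A : set 'rV[R]_m) : hyperbolic p -> nbhs p A ->
  nbhs (crit_values p) [set y | exists q, [/\ A q, hyperbolic q & crit_values q = y]].
Proof.
move=> hp nA; have pc := critical_crits hp; set c := crits p in pc.
have [g /andP[g0 _] hg] := critical_gap pc (@ltr01 R).
have : nbhs p (A `&` [set q | exists2 d, critical q d & forall k, `|d 0 k - c 0 k| < g]).
  exact: (filterI nA (critical_near pc g0)).
move=> /nbhs_ballP[r /= r0 hr].
rewrite -ball_normE in hr.
have r2 : 0 < r / 2 by rewrite divr_gt0.
pose B := [set q : 'rV[R]_m | forall i, `[p 0 i - r / 2, p 0 i + r / 2]%classic (q 0 i)].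
have cB : compact B := @box_compact p (r / 2).
have BE q : B q <-> `|p - q| <= r / 2.
  split=> [Bq|h i]; last first.
    have := le_trans (coord_le_norm (p - q) i) h; rewrite !mxE /= in_itv /= ler_norml; lra.
  by apply: norm_le_coord => [|i]; [exact: ltW|rewrite !mxE; have := Bq i; rewrite /= in_itv /= ler_norml; lra].
have Br q : B q -> A q /\ exists2 d, critical q d & forall k, `|d 0 k - c 0 k| < g.
  by move=> /BE h; apply: hr; apply: le_lt_trans h _; lra.
have Bh q : B q -> hyperbolic q by move=> /Br[_ [d ? _]]; exists d.
have Binj q : B q -> crit_values q = crit_values p -> q = p.
  move=> /Br[_ [d qd hd]] e; apply: (interlaced_inj qd pc).
    by move=> k; rewrite -(crit_valuesE k qd) e (crit_valuesE k pc).
  move=> k k' kk; have := hg _ _ kk; have := hd k; have := hd k'; rewrite !ltr_norml; lra.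
pose S := B `&` [set q | r / 2 <= `|p - q|].
have [eta eta0 heta] : exists2 eta, 0 < eta & forall q, S q -> eta <= `|crit_values q - crit_values p|.
  have [S0|S0] := pselect (S !=set0); last first.
    by exists 1 => // q Sq; case: S0; exists q.
  have cS : compact S.
    apply: compact_closedI => //.
    rewrite (_ : [set q | _] = (fun q => `|p - q|) @^-1` [set x | r / 2 <= x]) //.
    apply: preimage_closed; last exact: closed_ge.
    move=> q _; apply: (@cvg_norm _ _ _ (nbhs q)).
    by apply: (@cvgB _ _ _ (nbhs q)); [exact: cvg_cst|exact: cvg_id].
  have [|s] := compact_EVT_min S0 cS (@crit_values_dist_continuous S (crit_values p) _).
    by move=> q [/Bh].
  rewrite inE => -[Bs sr] hs; exists (`|crit_values s - crit_values p|).
    rewrite normr_gt0 subr_eq0; apply/eqP => /(Binj _ Bs) e.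
    by move: sr; rewrite /= e subrr normr0 leNgt r2.
  by move=> q Sq; apply: hs; rewrite inE.
have pB : B p by apply/BE; rewrite subrr normr0 ltW.
apply/nbhs_ballP; exists (eta / 2); first by rewrite /= divr_gt0.
rewrite -ball_normE => y /= hy.
have [q] := compact_EVT_min (ex_intro B p pB) cB (@crit_values_dist_continuous B y Bh).
rewrite inE => Bq qmin.
have q_le : `|crit_values q - y| <= `|crit_values p - y| by apply: qmin; rewrite inE.
have qr : `|p - q| < r / 2.
  rewrite ltNge; apply/negP => h.
  have := heta q (conj Bq h).
  have := ler_normD (crit_values q - y) (y - crit_values p).
  rewrite addrA subrK (distrC y); move: q_le hy; lra.
exists q; split; [exact: (Br q Bq).1|exact: Bh|].
apply/eqP; apply: contraT => qy.
have nB : nbhs q [set q' | `|p - q'| < r / 2].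
  apply: open_nbhs_nbhs; split=> //.
  rewrite (_ : [set q' | _] = (fun q' => `|p - q'|) @^-1` [set x | x < r / 2]) //.
  apply: open_comp; last exact: open_lt.
  move=> z _; apply: (@cvg_norm _ _ _ (nbhs z)).
  by apply: (@cvgB _ _ _ (nbhs z)); [exact: cvg_cst|exact: cvg_id].
have [q' [/= q'B _]] := crit_values_descent (Bh q Bq) nB qy.
by rewrite ltNge qmin // inE; apply/BE/ltW.
Qed.

End OpenMap.

Section Proper.
Variables (R : realType) (m : nat).
Implicit Types (p q c d y v : 'rV[R]_m).

Definition alternating v := forall k k' : 'I_m, k' = k.+1 :> nat ->
  0 < (-1) ^+ (m - k') * (v 0 k' - v 0 k).

Lemma critical_succ p c (k k' j : 'I_m) : critical p c -> k' = k.+1 :> nat -> ~~ (c 0 k < c 0 j < c 0 k').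
Proof. by move=> pc kk; rewrite !(critical_lt _ _ pc) kk; lia. Qed.

Lemma crit_values_alternating p : hyperbolic p -> alternating (crit_values p).
Proof.
move=> /critical_crits pc k k' kk; rewrite !(crit_valuesE _ pc) -(critical_card k' pc).
apply: critical_mono => // [|j]; last exact: critical_succ pc kk.
by rewrite (critical_lt _ _ pc) kk.
Qed.

Lemma critical_gap_le p c (M : R) (k k' : 'I_m) : critical p c -> k' = k.+1 :> nat ->
  (forall j, `|(centered p).[c 0 j]| <= M) -> c 0 k' - c 0 k <= 4 + 8 * M.
Proof.
move=> pc kk hM; have M0 : 0 <= M := le_trans (normr_ge0 _) (hM k).
rewrite leNgt; apply/negP => hg; set g := c 0 k' - c 0 k in hg.
pose a := c 0 k + g / 4; pose b := c 0 k' - g / 4.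
have [ca ab bc] : [/\ c 0 k < a, a < b & b < c 0 k'] by rewrite /a /b; split; move: hg; rewrite /g; lra.
pose s : R := (-1) ^+ (m - k').
have card x : c 0 k < x -> x <= c 0 k' -> (-1) ^+ #|[set j | x <= c 0 j]%SET| = s.
  move=> kx xk; rewrite /s -(critical_card k' pc); congr (_ ^+ _); apply: eq_card => j; rewrite !inE.
  apply/idP/idP => [xj|]; last exact: le_trans.
  by have := critical_succ j pc kk; rewrite (lt_le_trans kx xj) /= -leNgt.
have no (x y : R) : c 0 k <= x -> y <= c 0 k' -> forall j, ~~ (x < c 0 j < y).
  move=> kx yk j; have := critical_succ j pc kk; apply: contra => /andP[xj jy].
  by rewrite (le_lt_trans kx xj) (lt_le_trans jy yk).
have h1 := critical_mono pc ca (no _ _ (lexx _) (ltW (lt_trans ab bc))).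
have h2 := critical_mono pc ab (no _ _ (ltW ca) (ltW bc)).
have h3 := critical_mono pc bc (no _ _ (ltW (lt_trans ca ab)) (lexx _)).
rewrite card // in h1; last exact/ltW/(lt_trans ab).
rewrite card // in h2; [|exact: lt_trans ca ab|exact: ltW].
rewrite card // in h3; last by rewrite (lt_trans ca) // (lt_trans ab).
have sn x : `|s * x| = `|x| by rewrite normrM normrX normrN normr1 expr1n mul1r.
have h4 : g / 2 * (g / 4) <= s * ((centered p).[b] - (centered p).[a]).
  rewrite -[leRHS]gtr0_norm // sn; have [z] := polyrcf.poly_mvt (centered p) ab.
  rewrite in_itv /= => /andP[az zb] ->; rewrite (critical_deriv _ pc).
  have g4 : 1 <= g / 4 by move: hg M0; lra.
  have -> : b - a = g / 2 by rewrite /a /b /g; lra.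
  rewrite normrM (ger0_norm (x := g / 2)); last by move: g4; lra.
  rewrite mulrC ler_pM2r; last by move: g4; lra.
  rewrite normrM ger0_norm ?ler0n //; apply: le_trans (_ : (g / 4) ^+ m <= _).
    by rewrite ler_eXnr // (leq_trans _ (ltn_ord k)).
  rewrite normr_prod -[leLHS]mul1r; apply: ler_pM => //.
  - by rewrite exprn_ge0 // (le_trans ler01).
  - by rewrite ler1n.
  rewrite -[in leLHS](card_ord m) -prodr_const; apply: ler_prod => j _.
  rewrite (le_trans ler01 g4) /=.
  have [jk|kj] := leqP j k.
    have : c 0 j <= c 0 k by rewrite (critical_le _ _ pc).
    move: az; rewrite /a => az jk'; rewrite ger0_norm; move: g4; lra.
  have : c 0 k' <= c 0 j by rewrite (critical_le _ _ pc) kk.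
  move: zb; rewrite /b => zb jk'; rewrite ler0_norm; move: g4; lra.
have := hM k; have := hM k'.
have : s * ((centered p).[c 0 k'] - (centered p).[c 0 k]) <= `|(centered p).[c 0 k']| + `|(centered p).[c 0 k]|.
  by rewrite (le_trans (ler_norm _)) // sn ler_normB.
rewrite !mulrBr in h1 h2 h3 h4 *.
move: hg; nra.
Qed.

Lemma critical_sum0 p c : critical p c -> \sum_k c 0 k = 0.
Proof.
move=> [e _]; case: (posnP m) => [m0|m0].
  by apply: big1 => k _; have := ltn_ord k; rewrite {2}m0.
pose rs := [seq c 0 k | k <- enum 'I_m].
have := congr1 (fun f : {poly R} => f`_m.-1) e.
rewrite coef_deriv prednK // coef_centered_m mul0rn coefZ.
have -> : \prod_(k < m) ('X - (c 0 k)%:P) = \prod_(x <- rs) ('X - x%:P) by rewrite big_map big_enum.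
have srs : size rs = m by rewrite size_map size_enum_ord.
have -> : (\prod_(x <- rs) ('X - x%:P))`_m.-1 = - \sum_(x <- rs) x.
  by rewrite -[in LHS]srs coefPn_prod_XsubC // srs -lt0n.
rewrite big_map big_enum /= mulrN => /eqP.
by rewrite eq_sym oppr_eq0 mulf_eq0 pnatr_eq0 /= => /eqP.
Qed.

Lemma critical_bound p c (M : R) k : critical p c ->
  (forall j, `|(centered p).[c 0 j]| <= M) -> `|c 0 k| <= m%:R * (4 + 8 * M).
Proof.
move=> pc hM; set G := 4 + 8 * M.
have M0 : 0 <= M := le_trans (normr_ge0 _) (hM k).
have G0 : 0 <= G by rewrite /G; lra.
have step n (i j : 'I_m) : (j <= i + n)%N -> c 0 j - c 0 i <= n%:R * G.
  elim: n j => [|n IH] j jn.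
    by rewrite mul0r subr_le0 (critical_le _ _ pc); lia.
  move: jn; rewrite leq_eqVlt => /orP[/eqP jn|jn]; last first.
    apply: le_trans (IH _ _) _; first by lia.
    by rewrite ler_wpM2r // ler_nat.
  have jm : (j.-1 < m)%N by have := ltn_ord j; lia.
  have jj : j = (Ordinal jm).+1 :> nat by rewrite /= jn addnS.
  have jin : (Ordinal jm <= i + n)%N by rewrite /=; lia.
  have := critical_gap_le pc jj hM; have := IH _ jin.
  have -> : n.+1%:R * G = n%:R * G + G by rewrite -[n.+1%:R]natr1; ring.
  by rewrite -/G; lra.
have diff i j : c 0 j - c 0 i <= m%:R * G.
  by apply: step; have := ltn_ord j; lia.
have m0 : 0 < m%:R :> R by rewrite ltr0n (leq_trans _ (ltn_ord k)).
have sum0 := critical_sum0 pc.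
rewrite ler_norml; apply/andP; split.
- rewrite -(ler_pM2l m0).
  have : \sum_(j < m) (c 0 j - c 0 k) <= \sum_(j < m) m%:R * G by apply: ler_sum.
  rewrite sumrB sum0 !sumr_const card_ord -[c 0 k *+ m]mulr_natl -[_ * G *+ m]mulr_natl; lra.
- rewrite -(ler_pM2l m0).
  have : \sum_(j < m) (c 0 k - c 0 j) <= \sum_(j < m) m%:R * G by apply: ler_sum.
  rewrite sumrB sum0 !sumr_const card_ord -[c 0 k *+ m]mulr_natl -[_ * G *+ m]mulr_natl; lra.
Qed.

Lemma coef_prod_XsubC_le (s : seq R) (C : R) i : 0 <= C -> (forall x, x \in s -> `|x| <= C) ->
  `|(\prod_(x <- s) ('X - x%:P))`_i| <= (1 + C) ^+ size s.
Proof.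
move=> C0; elim: s i => [|x s IH] i h.
  by rewrite big_nil coef1 expr0; case: (i == 0)%N; rewrite ?normr1 ?normr0.
have {}IH j := IH j (fun (z : R) zs => h z (mem_behead (s := x :: s) zs)).
rewrite big_cons mulrBl coefB coefXM coefCM exprS mulrDl mul1r.
apply: le_trans (ler_normB _ _) _; apply: lerD.
  by case: i => [|i] /=; rewrite ?normr0 ?exprn_ge0 ?addr_ge0.
by rewrite normrM; apply: ler_pM => //; apply: h; rewrite mem_head.
Qed.

Lemma hyperbolic_bound (M : R) : exists B, forall p, hyperbolic p -> `|crit_values p| <= M ->
  forall i, `|p 0 i| <= B /\ `|crits p 0 i| <= B.
Proof.
pose C := m%:R * (4 + 8 * `|M|); have C0 : 0 <= C by rewrite mulr_ge0 // addr_ge0 // mulr_ge0.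
pose D := m.+1%:R * (1 + C) ^+ m.
have D0 : 0 <= D by rewrite mulr_ge0 // exprn_ge0 // addr_ge0.
pose B0 := `|M| + (C ^+ m.+1 + \sum_(i < m) D * C ^+ i).
have S0 : 0 <= \sum_(i < m) D * C ^+ i by apply: sumr_ge0 => i _; rewrite mulr_ge0 // exprn_ge0.
exists (Num.max C (Num.max D B0)) => p hp hM i.
have pc := critical_crits hp; set c := crits p in pc *.
have hM' j : `|(centered p).[c 0 j]| <= `|M|.
  rewrite -(crit_valuesE j pc) (le_trans (coord_le_norm _ _)) //; exact: le_trans hM (ler_norm _).
have cC j : `|c 0 j| <= C := critical_bound j pc hM'.
split; last by rewrite le_max cC.
rewrite !le_max; apply/orP; right; apply/orP.
have pD (j : 'I_m) : (0 < j)%N -> `|p 0 j| <= D.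
  move=> j0; have := congr1 (fun f : {poly R} => f`_j.-1) pc.1.
  rewrite coef_deriv prednK // coefD coefXn (_ : (j == m.+1 :> nat) = false) ?add0r; last by have := ltn_ord j; lia.
  rewrite coef_rVpoly_ord coefZ => e.
  have : `|p 0 j *+ j| <= D.
    rewrite e normrM ger0_norm ?ler0n // /D ler_pM2l ?ltr0n //.
    pose rs := [seq c 0 k | k <- enum 'I_m].
    have -> : \prod_(k < m) ('X - (c 0 k)%:P) = \prod_(x <- rs) ('X - x%:P) by rewrite big_map big_enum.
    have srs : size rs = m by rewrite size_map size_enum_ord.
    by rewrite -[in leRHS]srs; apply: coef_prod_XsubC_le => // _ /mapP[k _ ->].
  apply: le_trans; rewrite normrMn -mulr_natr ler_peMr // ler1n //.
have [i0|i0] := posnP i; last by left; exact: pD.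
right; have := hM' i; rewrite horner_centered (bigD1 i) //= [X in _ * _ ^+ X]i0 expr0 mulr1 => h.
have e : `|c 0 i ^+ m.+1| <= C ^+ m.+1 by rewrite normrX lerXn2r ?nnegrE.
have e2 : `|\sum_(j < m | j != i) p 0 j * c 0 i ^+ j| <= \sum_(j < m) D * C ^+ j.
  apply: le_trans (ler_norm_sum _ _ _) _.
  rewrite [leRHS](bigID (fun j => j != i)) /= -[leLHS]addr0; apply: lerD; last first.
    by apply: sumr_ge0 => j _; rewrite mulr_ge0 // exprn_ge0.
  apply: ler_sum => j ji; rewrite normrM normrX; apply: ler_pM => //.
    by apply: pD; rewrite lt0n; apply: contra ji => /eqP j0; apply/eqP/val_inj; rewrite /= j0 i0.
  by rewrite lerXn2r ?nnegrE.
move: h e e2; rewrite /B0; set u := c 0 i ^+ m.+1; set w := \sum_(j < m | _) _.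
rewrite !ler_norml; lra.
Qed.

End Proper.

Section ClosedImage.
Variables (R : realType) (m : nat).
Implicit Types (p q c d y v : 'rV[R]_m).
Local Notation E := ('rV[R]_m * 'rV[R]_m)%type.

Definition values_at (pc : E) : 'rV[R]_m := \row_k (centered pc.1).[pc.2 0 k].

Lemma values_at_continuous : continuous values_at.
Proof.
move=> z; apply: (@cvg_rV R m _ (nbhs z)) => i; rewrite mxE.
rewrite (_ : (fun t => _) = (fun t : E => (centered t.1).[t.2 0 i])); last first.
  by apply/funext => t; rewrite mxE.
apply: (@cvg_horner R m _ (nbhs z) _ fst (fun t => t.2 0 i)); first exact: cvg_fst.
by apply: (@cvg_coord R m _ (nbhs z)); exact: cvg_snd.
Qed.

Lemma closed_eq0 (T : topologicalType) (f : T -> R) : continuous f -> closed [set x | f x = 0].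
Proof.
move=> cf; rewrite (_ : [set x | _] = f @^-1` [set x | x = 0]) //.
by apply: preimage_closed; [move=> x _; exact: cf|exact: closed_eq].
Qed.

Lemma closed_fle (T : topologicalType) (f g : T -> R) : continuous f -> continuous g ->
  closed [set x | f x <= g x].
Proof.
move=> cf cg; rewrite (_ : [set x | _] = (fun x => f x - g x) @^-1` [set x | x <= 0]); last first.
  by apply/seteqP; split => x /=; rewrite subr_le0.
apply: preimage_closed; last exact: closed_le.
by move=> x _; apply: (@cvgB _ _ _ (nbhs x)); [exact: cf|exact: cg].
Qed.

Lemma closed_all (T : topologicalType) (I : Type) (A : I -> set T) :
  (forall i, closed (A i)) -> closed [set x | forall i, A i x].
Proof.
move=> cA; rewrite (_ : [set x | _] = \bigcap_i A i); first exact: closed_bigI.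
by apply/seteqP; split=> x h i //; exact: h.
Qed.

Definition weakly_critical (B : R) : set E := [set pc : E |
  [/\ forall i, `[- B, B]%classic (pc.1 0 i), forall i, `[- B, B]%classic (pc.2 0 i),
      forall k, (centered pc.1)^`().[pc.2 0 k] = 0 &
      forall k k' : 'I_m, (k <= k')%N -> pc.2 0 k <= pc.2 0 k']].

Lemma coord2_continuous i : continuous (fun pc : E => pc.2 0 i).
Proof. by move=> z; apply: (@cvg_coord R m _ (nbhs z)); exact: cvg_snd. Qed.

Lemma weakly_critical_compact B : compact (weakly_critical B).
Proof.
pose bxs := [set q : 'rV[R]_m | forall i, `[- B, B]%classic (q 0 i)].
have bx : compact bxs.
  by apply: (@rV_compact R m (fun=> `[- B, B]%classic)) => i; exact: segment_compact.
rewrite (_ : weakly_critical B = (bxs `*` bxs) `&`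
  ([set pc : E | forall k, (centered pc.1)^`().[pc.2 0 k] = 0] `&`
   [set pc : E | forall kk : 'I_m * 'I_m, (kk.1 <= kk.2)%N -> pc.2 0 kk.1 <= pc.2 0 kk.2])).
  apply: compact_closedI; first exact: compact_setX.
  apply: closedI.
    apply: closed_all => k; apply: closed_eq0 => z.
    apply: (@cvg_horner_deriv R m _ (nbhs z) _ fst (fun t => t.2 0 k)); first exact: cvg_fst.
    exact: coord2_continuous.
  apply: (@closed_all _ _ (fun kk : 'I_m * 'I_m => [set pc : E | (kk.1 <= kk.2)%N -> pc.2 0 kk.1 <= pc.2 0 kk.2])) => kk.
  have [kk1|kk1] := boolP (kk.1 <= kk.2)%N; last first.
    by rewrite (_ : mkset _ = setT); [exact: closedT|apply/seteqP; split].
  rewrite (_ : mkset _ = [set pc : E | pc.2 0 kk.1 <= pc.2 0 kk.2]); last first.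
    by apply/seteqP; split=> pc /= h //; apply: h.
  by apply: closed_fle; exact: coord2_continuous.
apply/seteqP; split=> [pc [h1 h2 h3 h4]|pc [[h1 h2] [h3 h4]]].
  by split=> //; split=> //= kk; exact: h4.
by split=> // k k'; exact: (h4 (k, k')).
Qed.

Lemma alternating_lt_critical v pc B : weakly_critical B pc -> values_at pc = v -> alternating v ->
  critical pc.1 pc.2.
Proof.
move=> [_ _ h3 h4] e av; apply: critical_of_roots => // k k' kk.
have k1 : (k.+1 < m)%N := leq_ltn_trans kk (ltn_ord k').
apply: lt_le_trans (h4 (Ordinal k1) k' kk); rewrite lt_neqAle h4 ?andbT //=.
apply/eqP => e2; have := av k (Ordinal k1) erefl.
by rewrite -e !mxE e2 subrr mulr0 ltxx.
Qed.

Lemma hyperbolic_weakly_critical (M : R) : exists B, forall p, hyperbolic p -> `|crit_values p| <= M ->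
  weakly_critical B (p, crits p) /\ values_at (p, crits p) = crit_values p.
Proof.
have [B hB] := hyperbolic_bound m M; exists B => p hp pM; split.
  have pc := critical_crits hp; split=> /=.
  - by move=> i; have [] := hB p hp pM i; rewrite in_itv /= ler_norml.
  - by move=> i; have [_] := hB p hp pM i; rewrite in_itv /= ler_norml.
  - by move=> k; exact: critical_root.
  - by move=> k k'; rewrite (critical_le _ _ pc).
by apply/rowP => k; rewrite !mxE.
Qed.

Lemma rV_hausdorff : hausdorff_space 'rV[R]_m.
Proof. exact: norm_hausdorff. Qed.

Lemma closure_ball (A : set 'rV[R]_m) v : closure A v -> closure (A `&` [set w | `|w| <= `|v| + 1]) v.
Proof.
move=> cA N nN; have nB : nbhs v [set w | `|w| <= `|v| + 1].
  apply/nbhs_ballP; exists 1 => //=; rewrite -ball_normE => w /= vw.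
  have := ler_normD (w - v) v; rewrite subrK (distrC w); lra.
by have [w [Aw [Nw Bw]]] := cA _ (filterI nN nB); exists w.
Qed.

Definition realized v := exists2 p, hyperbolic p & crit_values p = v.

Lemma realized_closed v : alternating v -> closure realized v -> realized v.
Proof.
move=> av /closure_ball; have [B hB] := hyperbolic_weakly_critical (`|v| + 1).
have cZ : closed (values_at @` weakly_critical B).
  apply: compact_closed; first exact: rV_hausdorff.
  apply: continuous_compact (@weakly_critical_compact B).
  exact/continuous_subspaceT/values_at_continuous.
move=> cl; have /cZ[pc wpc e] : closure (values_at @` weakly_critical B) v.
  apply: (closureS _ cl) => _ [[p hp <-] pM]; have [? ?] := hB p hp pM.
  by exists (p, crits p).
have cpc := alternating_lt_critical wpc e av.
exists pc.1; first by exists pc.2.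
by rewrite -e; apply/rowP => k; rewrite (crit_valuesE k cpc) mxE.
Qed.

Definition realized_twice v := exists p q,
  [/\ hyperbolic p, hyperbolic q, crit_values p = v, crit_values q = v & p <> q].

Definition separated (k k' : 'I_m) v := exists p q,
  [/\ hyperbolic p, hyperbolic q, crit_values p = v, crit_values q = v & crits q 0 k' <= crits p 0 k].

Lemma realized_twiceP v : realized_twice v <-> exists2 kk : 'I_m * 'I_m, (kk.1 < kk.2)%N & separated kk.1 kk.2 v.
Proof.
split=> [[p [q [hp hq pv qv pq]]]|[[k k'] /= kk [p [q [hp hq pv qv h]]]]]; last first.
  exists p, q; split=> // e; move: h; rewrite -e.
  by rewrite (critical_le _ _ (critical_crits hp)) leqNgt kk.
apply: contrapT => no; apply: pq.
have [pc qc] := (critical_crits hp, critical_crits hq).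
apply: (interlaced_inj pc qc).
  by move=> k; rewrite -(crit_valuesE k pc) -(crit_valuesE k qc) pv qv.
move=> k k' kk; split; rewrite ltNge; apply/negP => h; apply: no; exists (k, k') => //=.
  by exists p, q.
by exists q, p.
Qed.

Lemma separated_closed (k k' : 'I_m) v : (k < k')%N -> alternating v -> closure (separated k k') v -> separated k k' v.
Proof.
move=> kk av /closure_ball; have [B hB] := hyperbolic_weakly_critical (`|v| + 1).
pose Z2 : set (E * E) := (weakly_critical B `*` weakly_critical B) `&`
  ([set ab : E * E | forall i, values_at ab.1 0 i - values_at ab.2 0 i = 0] `&`
   [set ab : E * E | ab.2.2 0 k' <= ab.1.2 0 k]).
have c1 i : continuous (fun ab : E * E => values_at ab.1 0 i).
  move=> z; apply: (@cvg_coord R m _ (nbhs z)).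
  by apply: (@cvg_comp _ _ _ fst values_at (nbhs z) (nbhs z.1)); [exact: cvg_fst|exact: values_at_continuous].
have c2 i : continuous (fun ab : E * E => values_at ab.2 0 i).
  move=> z; apply: (@cvg_coord R m _ (nbhs z)).
  by apply: (@cvg_comp _ _ _ snd values_at (nbhs z) (nbhs z.2)); [exact: cvg_snd|exact: values_at_continuous].
have cZ2 : compact Z2.
  apply: compact_closedI; first by apply: compact_setX; exact: weakly_critical_compact.
  apply: closedI.
    apply: closed_all => i; apply: closed_eq0 => z.
    by apply: (@cvgB _ _ _ (nbhs z)); [exact: c1|exact: c2].
  apply: closed_fle => z.
    by apply: (@cvg_comp _ _ _ snd (fun pc : E => pc.2 0 k') (nbhs z) (nbhs z.2)); [exact: cvg_snd|exact: coord2_continuous].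
  by apply: (@cvg_comp _ _ _ fst (fun pc : E => pc.2 0 k) (nbhs z) (nbhs z.1)); [exact: cvg_fst|exact: coord2_continuous].
have cZ : closed ((fun ab : E * E => values_at ab.1) @` Z2).
  apply: compact_closed; first exact: rV_hausdorff.
  apply: continuous_compact cZ2; apply: continuous_subspaceT => z.
  by apply: (@cvg_comp _ _ _ fst values_at (nbhs z) (nbhs z.1)); [exact: cvg_fst|exact: values_at_continuous].
move=> cl; have /cZ[[a b] /= [[wa wb] [ab hk]] e] : closure ((fun ab : E * E => values_at ab.1) @` Z2) v.
  apply: (closureS _ cl) => _ [[p [q [hp hq <- qp sep]]] pM].
  have [w1 e1] := hB p hp pM; have [|w2 e2] := hB q hq; first by rewrite qp.
  exists ((p, crits p), (q, crits q)) => //=; split=> //; split=> //= i.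
  by rewrite e1 e2 qp subrr.
have e' : values_at b = v by rewrite -e; apply/rowP => i; apply/eqP; rewrite eq_sym -subr_eq0 ab.
have ca := alternating_lt_critical wa e av; have cb := alternating_lt_critical wb e' av.
exists a.1, b.1; split; [by exists a.2|by exists b.2| | |].
- by rewrite -e; apply/rowP => i; rewrite (crit_valuesE i ca) mxE.
- by rewrite -e'; apply/rowP => i; rewrite (crit_valuesE i cb) mxE.
- by rewrite (crits_critical ca) (crits_critical cb).
Qed.

Lemma realized_twice_closed v : alternating v -> closure realized_twice v -> realized_twice v.
Proof.
move=> av cv; apply/realized_twiceP; apply: contrapT => no.
have h (kk : 'I_m * 'I_m) : \forall w \near v, ~ ((kk.1 < kk.2)%N /\ separated kk.1 kk.2 w).
  have [k12|k12] := ltnP kk.1 kk.2; last by apply: (@nearW _ (nbhs v)) => w [].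
  apply: contrapT => nn; apply: no; exists kk => //; apply: separated_closed => // N nN.
  apply: contrapT => emp; apply: nn; apply: (@filterS _ (nbhs v) _ N _ _ nN) => w Nw [_ sw]; apply: emp.
  by exists w.
have [w [/realized_twiceP[kk k12 sw] hw]] := cv _ (@filter_forall _ _ _ (nbhs v) _ h).
by case: (hw kk).
Qed.

Lemma realized_open v : realized v -> \forall w \near v, realized w.
Proof.
move=> [p hp <-]; have nT : nbhs p (@setT 'rV[R]_m) by apply: (@filterT _ _ (nbhs_filter p)).
have n := crit_values_open hp nT.
by apply: (@filterS _ _ (nbhs_filter (crit_values p)) _ _ _ n) => w [q [_ hq qw]]; exists q.
Qed.

Lemma realized_twice_open v : realized_twice v -> \forall w \near v, realized_twice w.
Proof.
move=> [p [q [hp hq pv qv pq]]].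
have := rV_hausdorff; rewrite open_hausdorff => /(_ p q (introN eqP pq)).
move=> [[A B] /= [/set_mem Ap /set_mem Bq] [oA oB AB0]].
have n1 := crit_values_open hp (open_nbhs_nbhs (conj oA Ap)).
have n2 := crit_values_open hq (open_nbhs_nbhs (conj oB Bq)).
rewrite pv in n1; rewrite qv in n2.
apply: (@filterS _ _ (nbhs_filter v) _ _ _ (@filterI _ _ (nbhs_filter v) _ _ n1 n2)) => w [[p' [Ap' hp' pw]] [q' [Bq' hq' qw]]].
exists p', q'; split=> // e; have : (A `&` B) p' by split=> //; rewrite e.
by move/eqP : AB0 => ->.
Qed.

End ClosedImage.

Lemma convex_connected (R : realType) (V : normedModType R) (A : set V) :
  (forall x y, A x -> A y -> forall t : R, 0 <= t <= 1 -> A (x + t *: (y - x))) -> connected A.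
Proof.
move=> cA; have [[x Ax]|/set0P/negP/negPn/eqP->] := pselect (A !=set0); last exact: connected0.
pose seg y := (fun t : R => x + t *: (y - x)) @` `[0, 1].
have -> : A = \bigcup_(y in A) seg y.
  apply/seteqP; split=> [y Ay|z [y Ay [t /=]]].
    exists y => //; exists 1; first by rewrite /= in_itv /= ler01 lexx.
    by rewrite scale1r addrC subrK.
  by rewrite in_itv /= => t01 <-; exact: cA.
apply: bigcup_connected.
  by exists x => y Ay; exists 0; rewrite ?scale0r ?addr0 //= in_itv /= lexx ler01.
move=> y Ay; apply: connected_continuous_connected; first exact: segment_connected.
apply: continuous_subspaceT => t.
by apply: cvgD; [exact: cvg_cst|apply: cvgZr_tmp; exact: cvg_id].
Qed.

Section WeakAlternation.
Variable R : realType.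

Lemma deriv_eq0 (p : {poly R}) : p^`() = 0 -> p = (p`_0)%:P.
Proof.
move=> dp; apply: size1_polyC; rewrite leqNgt; apply/negP => h.
have p0 : p != 0 by rewrite -size_poly_gt0 ltnW.
have [n sp] : exists n, size p = n.+2 by exists (size p).-2; lia.
have : p^`()`_n = 0 by rewrite dp coef0.
rewrite coef_deriv (_ : n.+1 = (size p).-1); last by rewrite sp.
rewrite -lead_coefE => /eqP; rewrite mulrn_eq0 lead_coef_eq0 (negbTE p0) orbF sp.
by [].
Qed.

(* Proved by induction with the mean value theorem: the derivative again
   alternates weakly, at one point less. *)
Lemma weak_alternation n (p : {poly R}) (t : nat -> R) :
  (forall k, (k < n)%N -> t k < t k.+1) -> (size p <= n)%N ->
  (forall k, (k <= n)%N -> 0 <= (-1) ^+ k * p.[t k]) -> p = 0.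
Proof.
elim: n p t => [|n IH] p t it sp ap.
  by apply/eqP; rewrite -size_poly_eq0 -leqn0.
have h k : exists s, (k < n.+1)%N -> [/\ t k < s, s < t k.+1 & p.[t k.+1] - p.[t k] = p^`().[s] * (t k.+1 - t k)].
  have [kn|kn] := ltnP k n.+1; last by exists 0.
  by have [s] := polyrcf.poly_mvt p (it k kn); rewrite in_itv /= => /andP[? ?] ?; exists s.
have [s sP] := boolp.choice h.
have dp : - p^`() = 0.
  apply: (IH _ s).
  - move=> k kn; have [//|_ h1 _] := sP k; first by lia.
    by have [//|h2 _ _] := sP k.+1; exact: lt_trans h1 h2.
  - rewrite size_polyN; case: (posnP (size p)) => [/eqP|p0].
      by rewrite size_poly_eq0 => /eqP->; rewrite deriv0 size_poly0.
    by have := lt_size_deriv (p := p); rewrite -size_poly_gt0 => /(_ p0) h1; rewrite -ltnS (leq_trans h1).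
  - move=> k kn; have kn1 : (k < n.+1)%N by [].
    have [h1 h2 h3] := sP k kn1.
    have := ap k (ltnW kn1); have := ap k.+1 kn1; rewrite exprS hornerN => a1 a2.
    have d0 : 0 < t k.+1 - t k by rewrite subr_gt0 it.
    rewrite -(pmulr_lge0 _ d0) -mulrA mulNr -h3; move: a1 a2; set e := (-1) ^+ k; lra.
have pc : p = (p`_0)%:P by apply: deriv_eq0; apply/eqP; rewrite -oppr_eq0 dp.
have := ap 0%N isT; have := ap 1%N isT; rewrite pc !hornerC expr0 expr1 => h1 h2.
by have -> : p`_0 = 0 by lra.
Qed.

End WeakAlternation.

Section Tails.
Variables (R : realType) (m : nat).
Implicit Types (p q c d v : 'rV[R]_m).

Lemma centered_right_tail p (w y : R) : exists2 x, y < x & w < (centered p).[x].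
Proof.
have sw : (size (w%:P : {poly R}) < size (centered p))%N.
  by rewrite size_centered (leq_ltn_trans (size_polyC_leq1 _)).
have lc : lead_coef (centered p - w%:P) = 1.
  by rewrite lead_coefDl ?size_polyN // lead_coef_centered.
have [|n hn] := @polyrcf.poly_pinfty_gt_lc R (centered p - w%:P); first by rewrite lc.
exists (Num.max n (y + 1)); first by rewrite lt_max ltrDl ltr01 orbT.
have /hn : n <= Num.max n (y + 1) by rewrite le_max lexx.
by rewrite lc hornerD hornerN hornerC; lra.
Qed.

Lemma centered_left_tail p (w y : R) : exists2 x, x < y & w < (-1) ^+ m.+1 * (centered p).[x].
Proof.
pose q := \row_(i < m) ((-1) ^+ m.+1 * (-1) ^+ i * p 0 i).
have e x : (centered q).[x] = (-1) ^+ m.+1 * (centered p).[- x].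
  rewrite !horner_centered mulrDr mulr_sumr; congr (_ + _).
    by rewrite (exprNn x) mulrA -expr2 sqrr_sign mul1r.
  apply: eq_bigr => i _; rewrite mxE (exprNn x); ring.
have [x yx h] := centered_right_tail q w (- y).
exists (- x); first by rewrite ltrNl.
by rewrite -e.
Qed.

End Tails.

Section Bijection.
Variables (R : realType) (m : nat).
Implicit Types (p q c d v : 'rV[R]_m).

Lemma hyperbolic_exists : exists p : 'rV[R]_m, hyperbolic p.
Proof.
pose c : 'rV[R]_m := \row_k (k%:R - (\sum_(j < m) j%:R) / m%:R).
have c0 : \sum_k c 0 k = 0.
  case: (posnP m) => [m0|m0]; first by apply: big1 => k _; have := ltn_ord k; rewrite {2}m0.
  under eq_bigr do rewrite mxE.
  by rewrite sumrB sumr_const card_ord -[_ / _ *+ m]mulr_natr divfK ?subrr // pnatr_eq0 -lt0n.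
pose P : {poly R} := m.+1%:R *: \prod_(k < m) ('X - (c 0 k)%:P).
pose rs := [seq c 0 k | k <- enum 'I_m].
have prs : \prod_(k < m) ('X - (c 0 k)%:P) = \prod_(x <- rs) ('X - x%:P) by rewrite big_map big_enum.
have srs : size rs = m by rewrite size_map size_enum_ord.
have monP : \prod_(x <- rs) ('X - x%:P) \is monic by exact: monic_prod_XsubC.
have szP : size (\prod_(x <- rs) ('X - x%:P)) = m.+1 by rewrite size_prod_XsubC srs.
exists (\row_i (P`_i.-1 / i%:R)), c; split; last by move=> k k' kk; rewrite !mxE ltrD2r ltr_nat.
rewrite -/P; apply/polyP => j; rewrite coef_deriv coefD coefXn eqSS.
have PE : P = m.+1%:R *: \prod_(x <- rs) ('X - x%:P) by rewrite /P prs.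
case: (ltngtP j m) => [jm|jm|->].
- rewrite add0r /rVpoly coef_poly; case: ltnP => j1.
    by rewrite insubT mxE /= -[_ *+ j.+1]mulr_natr divfK // pnatr_eq0.
  have m0 : (0 < m)%N by lia.
  have -> : j = m.-1 by lia.
  rewrite mul0rn PE coefZ.
  have -> : (\prod_(x <- rs) ('X - x%:P))`_m.-1 = - \sum_(x <- rs) x.
    by rewrite -[in LHS]srs coefPn_prod_XsubC // srs -lt0n.
  by rewrite big_map big_enum /= c0 oppr0 mulr0.
- rewrite add0r nth_default ?mul0rn; last by rewrite (leq_trans (size_poly _ _)) // ltnW // ltnW.
  by rewrite PE coefZ [X in _ * X]nth_default ?mulr0 // szP.
- rewrite [X in _ + X]nth_default ?addr0; last by rewrite (leq_trans (size_poly _ _)).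
  rewrite PE coefZ; have := monicP monP; rewrite lead_coefE szP /= => ->.
  by rewrite mulr1.
Qed.

Definition chebyshev : 'rV[R]_m := \row_k (-1) ^+ (m - k).

Lemma chebyshev_alternating : alternating chebyshev.
Proof.
move=> k k' kk; rewrite !mxE; have -> : (m - k = (m - k').+1)%N by have := ltn_ord k'; lia.
by rewrite exprS mulN1r opprK mulrDr -expr2 sqrr_sign addr_gt0.
Qed.

Lemma critical_between p c (x y z : R) : critical p c -> x < y ->
  (forall k, ~~ (x < c 0 k < y)) -> x <= z <= y ->
  (centered p).[x] <= (centered p).[z] <= (centered p).[y] \/
  (centered p).[y] <= (centered p).[z] <= (centered p).[x].
Proof.
move=> pc xy nk /andP[]; rewrite le_eqVlt => /orP[/eqP->|xz].
  by move=> _; rewrite !lexx /= andbT; apply/orP; exact: le_total.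
rewrite le_eqVlt => /orP[/eqP->|zy].
  by rewrite !lexx !andbT; apply/orP; exact: le_total.
have nxz k : ~~ (x < c 0 k < z).
  by apply: contra (nk k) => /andP[-> h]; exact: lt_trans h zy.
have nzy k : ~~ (z < c 0 k < y).
  by apply: contra (nk k) => /andP[h ->]; rewrite (lt_trans xz h).
have := critical_mono pc xz nxz; have := critical_mono pc zy nzy.
have -> : [set k | z <= c 0 k]%SET = [set k | y <= c 0 k]%SET.
  apply/setP => k; rewrite !inE; apply/idP/idP => [zk|]; last exact/le_trans/ltW.
  by have := nk k; rewrite (lt_le_trans xz zk) /= -leNgt.
rewrite -signr_odd; case: (odd _); rewrite ?expr1 ?expr0 ?mulN1r ?mul1r ?oppr_gt0 ?subr_gt0 ?subr_lt0 => h1 h2.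
  by right; rewrite !ltW.
by left; rewrite !ltW.
Qed.

Hypothesis m0 : (0 < m)%N.

Lemma chebyshev_nodes p : hyperbolic p -> crit_values p = chebyshev ->
  exists t : nat -> R, [/\ forall k, (k < m.+1)%N -> t k < t k.+1,
    forall k, (k <= m.+1)%N -> (-1) ^+ k * (-1) ^+ m.+1 * (centered p).[t k] = 1 &
    forall x, t 0%N <= x <= t m.+1 -> `|(centered p).[x]| <= 1].
Proof.
move=> hp hv; have pc := critical_crits hp; set c := crits p in pc.
have cv k : (centered p).[c 0 k] = (-1) ^+ (m - k) by rewrite -(crit_valuesE k pc) hv mxE.
have lm : (m.-1 < m)%N by rewrite prednK.
have sgn (a b : nat) : odd (a + b) = false -> (-1) ^+ a * (-1) ^+ b = 1 :> R.
  by move=> h; rewrite -exprD -signr_odd h.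
have [a al ha] : exists2 a, a < c 0 (Ordinal m0) & (-1) ^+ m.+1 * (centered p).[a] = 1.
  have [z zl hz] := centered_left_tail p 1 (c 0 (Ordinal m0)).
  pose G := (-1) ^+ m.+1 *: centered p - 1%:P.
  have GE x : G.[x] = (-1) ^+ m.+1 * (centered p).[x] - 1 by rewrite hornerD hornerN hornerC hornerZ.
  have Gl : G.[c 0 (Ordinal m0)] = -2.
    by rewrite GE cv /= subn0 exprS mulN1r mulNr -expr2 sqrr_sign; lra.
  have [|x] := @polyrcf.poly_ivtoo R G z (c 0 (Ordinal m0)) (ltW zl).
    by rewrite Gl GE; lra.
  rewrite in_itv /= => /andP[_ xl] /rootP; rewrite GE => e; exists x => //; lra.
have [b bl hb] : exists2 b, c 0 (Ordinal lm) < b & (centered p).[b] = 1.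
  have [z zl hz] := centered_right_tail p 1 (c 0 (Ordinal lm)).
  pose G := centered p - 1%:P.
  have GE x : G.[x] = (centered p).[x] - 1 by rewrite hornerD hornerN hornerC.
  have Gl : G.[c 0 (Ordinal lm)] = -2.
    by rewrite GE cv /= (_ : m - m.-1 = 1)%N ?expr1; [lra|lia].
  have [|x] := @polyrcf.poly_ivtoo R G (c 0 (Ordinal lm)) z (ltW zl).
    by rewrite Gl GE; lra.
  rewrite in_itv /= => /andP[xl _] /rootP; rewrite GE => e; exists x => //; lra.
pose t k : R := if k is j.+1 then (if insub j is Some i then c 0 i else b) else a.
have t0 : t 0%N = a by [].
have tS (k : 'I_m) : t k.+1 = c 0 k by rewrite /t valK.
have tm : t m.+1 = b by rewrite /t insubF // ltnn.
have inc k : (k < m.+1)%N -> t k < t k.+1.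
  case: k => [_|k]; first by rewrite t0 (tS (Ordinal m0)).
  rewrite ltnS leq_eqVlt => /orP[/eqP e|km].
    have -> : t k.+2 = b by rewrite e tm.
    by have -> : t k.+1 = c 0 (Ordinal lm) by rewrite -tS; congr (t _); rewrite /=; lia.
  have k1 : (k < m)%N by lia.
  by rewrite (tS (Ordinal k1)) (tS (Ordinal km)) (critical_lt _ _ pc) /=.
have val k : (k <= m.+1)%N -> (-1) ^+ k * (-1) ^+ m.+1 * (centered p).[t k] = 1.
  case: k => [_|k]; first by rewrite expr0 mul1r t0.
  rewrite ltnS leq_eqVlt => /orP[/eqP->|km]; first by rewrite tm hb mulr1 sgn // oddD addbb.
  by rewrite (tS (Ordinal km)) cv /= -exprD sgn // !oddD oddB 1?ltnW //=; case: (odd k) (odd m) => [] [].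
have pm k : (k <= m.+1)%N -> (centered p).[t k] = 1 \/ (centered p).[t k] = -1.
  move=> /val; rewrite -exprD -signr_odd; case: (odd _); rewrite ?expr1 ?expr0 ?mul1r ?mulN1r; [right|left]; lra.
have nob k j : (k < m.+1)%N -> ~~ (t k < c 0 j < t k.+1).
  case: k => [_|k km]; first by rewrite (tS (Ordinal m0)) !(critical_lt _ _ pc) ltn0 andbF.
  rewrite ltnS leq_eqVlt in km; case/orP: km => [/eqP e|km].
    have -> : t k.+1 = c 0 (Ordinal lm) by rewrite -tS; congr (t _); rewrite /=; lia.
    by rewrite (critical_lt _ _ pc) /=; have := ltn_ord j; lia.
  have k1 : (k < m)%N by lia.
  by rewrite (tS (Ordinal k1)) (tS (Ordinal km)); apply: critical_succ pc _.
exists t; split=> // x /andP[ax xb].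
have [k km /andP[kx xk]] : exists2 k, (k < m.+1)%N & t k <= x <= t k.+1.
  have : forall n, (n <= m.+1)%N -> x <= t n -> exists2 k, (k < m.+1)%N & t k <= x <= t k.+1.
    elim=> [_ xa|n IH nm xn]; first by exists 0%N; rewrite // ax ltW // (le_lt_trans xa) // inc.
    have [xn'|xn'] := leP x (t n); first by apply: IH => //; exact: ltnW.
    by exists n; rewrite ?xn ?(ltW xn').
  by apply; last exact: xb.
have := critical_between pc (inc k km) (fun j => nob k j km) (introT andP (conj kx xk)).
by rewrite ler_norml; case: (pm k (ltnW km)) => ->; case: (pm k.+1 km) => ->; lra.
Qed.

(* With q rescaled to the interval of p, the difference alternates weakly at
   m + 2 points but has degree at most m. *)
Lemma chebyshev_unique_le p q (t u : nat -> R) : hyperbolic p -> hyperbolic q ->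
  (forall k, (k < m.+1)%N -> t k < t k.+1) -> (forall k, (k < m.+1)%N -> u k < u k.+1) ->
  (forall k, (k <= m.+1)%N -> (-1) ^+ k * (-1) ^+ m.+1 * (centered p).[t k] = 1) ->
  (forall k, (k <= m.+1)%N -> (-1) ^+ k * (-1) ^+ m.+1 * (centered q).[u k] = 1) ->
  (forall x, u 0%N <= x <= u m.+1 -> `|(centered q).[x]| <= 1) ->
  t m.+1 - t 0%N <= u m.+1 - u 0%N -> p = q.
Proof.
move=> hp hq ti ui tv uv ub tu.
have mono (w : nat -> R) : (forall k, (k < m.+1)%N -> w k < w k.+1) -> forall j k, (j <= k <= m.+1)%N -> w j <= w k.
  move=> wi j; elim=> [|k IH] /andP[]; first by rewrite leqn0 => /eqP->.
  rewrite leq_eqVlt => /orP[/eqP->//|jk] km; apply: le_trans (ltW (wi k km)).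
  by apply: IH; rewrite -ltnS jk ltnW.
have t_lt : 0 < t m.+1 - t 0%N.
  by rewrite subr_gt0 (lt_le_trans (ti 0%N _)) //; apply: mono => //; rewrite leqnn andbT.
pose al := (u m.+1 - u 0%N) / (t m.+1 - t 0%N).
have al1 : 1 <= al by rewrite ler_pdivlMr // mul1r.
have al0 : 0 < al by exact: lt_le_trans al1.
pose L : {poly R} := al *: 'X + (u 0%N - al * t 0%N)%:P.
have LE x : L.[x] = u 0%N + al * (x - t 0%N) by rewrite hornerD hornerZ hornerX hornerC; ring.
have dL : L^`() = al%:P by rewrite /L derivD derivZ derivX derivC addr0 alg_polyC.
have sL : size L = 2.
  by rewrite /L size_polyDl size_scale ?gt_eqF // size_polyX // ltnS size_polyC_leq1.
pose h := (al ^+ m.+1)^-1 *: (centered q \Po L).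
have hE x : h.[x] = (al ^+ m.+1)^-1 * (centered q).[L.[x]] by rewrite hornerZ horner_comp.
have a0 : 0 < al ^+ m.+1 by rewrite exprn_gt0.
have lL : lead_coef L = al.
  by rewrite lead_coefDl ?lead_coefZ ?lead_coefX ?mulr1 // size_scale ?gt_eqF // size_polyX ltnS size_polyC_leq1.
have sh : size h = m.+2 by rewrite size_scale ?invr_eq0 ?gt_eqF // size_comp_poly2 // size_centered.
have lh : lead_coef h = 1.
  by rewrite lead_coefZ lead_coef_comp ?sL // lead_coef_centered mul1r lL size_centered mulVf // gt_eqF.
have Lt k : (k <= m.+1)%N -> u 0%N <= L.[t k] <= u m.+1.
  move=> km; rewrite LE; apply/andP; split.
    by rewrite lerDl mulr_ge0 ?(ltW al0) // subr_ge0 mono // km.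
  have -> : u m.+1 = u 0%N + al * (t m.+1 - t 0%N) by rewrite mulfVK ?gt_eqF //; ring.
  by rewrite lerD2l ler_pM2l // lerD2r mono // km leqnn.
have ph : centered p - h = 0.
  have sg (e : R) : e = 1 \/ e = -1 -> e * e = 1 by case=> ->; ring.
  have nz : (-1) ^+ m.+1 != 0 :> R by rewrite signr_eq0.
  suff : (-1) ^+ m.+1 *: (centered p - h) = 0 by move/eqP; rewrite scaler_eq0 (negbTE nz) => /eqP.
  apply: (@weak_alternation _ m.+1 _ t) => // [|k km].
    rewrite size_scale //; apply/leq_sizeP => j; rewrite leq_eqVlt coefB => /orP[/eqP<-|jm].
      have := lead_coef_centered p; rewrite lead_coefE size_centered /= => ->.
      by move: lh; rewrite lead_coefE sh /= => ->; rewrite subrr.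
    by rewrite !nth_default ?subrr ?sh ?size_centered.
  rewrite hornerZ hornerD hornerN mulrA mulrBr tv // subr_ge0 hE.
  have := ub _ (Lt k km); rewrite -exprD -signr_odd ler_norml => /andP[b1 b2].
  have ai : (al ^+ m.+1)^-1 <= 1 by rewrite invf_le1 // exprn_ege1.
  have ai0 : 0 < (al ^+ m.+1)^-1 by rewrite invr_gt0.
  by case: (odd _); rewrite ?expr1 ?expr0 ?mul1r ?mulN1r; nra.
have ph' : centered p = h by apply/eqP; rewrite -subr_eq0 ph.
have al_1 : al = 1.
  have := tv m.+1 (leqnn _); rewrite ph' hE LE mulfVK ?gt_eqF // addrC subrK.
  rewrite mulrCA uv // mulr1 => /eqP; rewrite invr_eq1 => /eqP e.
  by apply/eqP; rewrite -(@pexpr_eq1 _ al m.+1) ?(ltW al0) // e.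
have dE x : (centered p)^`().[x] = (centered q)^`().[x + (u 0%N - t 0%N)].
  rewrite ph' /h al_1 expr1n invr1 scale1r deriv_comp hornerM horner_comp LE al_1 mul1r.
  by rewrite dL hornerC al_1 mulr1; congr (_.[_]); ring.
have [pc qc] := (critical_crits hp, critical_crits hq).
set be := u 0%N - t 0%N in dE.
have e : crits p = \row_k (crits q 0 k - be).
  apply: (critical_inj pc); apply: critical_of_roots => [k|k k' kk].
    by rewrite dE mxE subrK (critical_root k qc).
  by rewrite !mxE ltrD2r (critical_lt _ _ qc).
have be0 : be = 0.
  have := critical_sum0 pc; rewrite e; under eq_bigr do rewrite mxE.
  rewrite sumrB (critical_sum0 qc) sumr_const card_ord => /eqP.
  by rewrite sub0r oppr_eq0 mulrn_eq0 (gtn_eqF m0) => /eqP.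
apply: centered_inj; rewrite ph' /h al_1 expr1n invr1 scale1r /L al_1 scale1r mul1r -/be be0 addr0.
by rewrite comp_polyXr.
Qed.

Lemma chebyshev_not_twice : ~ realized_twice chebyshev.
Proof.
move=> [p [q [hp hq pv qv pq]]].
have [t [t1 t2 t3]] := chebyshev_nodes hp pv; have [u [u1 u2 u3]] := chebyshev_nodes hq qv.
have [tu|ut] := leP (t m.+1 - t 0%N) (u m.+1 - u 0%N).
  exact: pq (chebyshev_unique_le hp hq t1 u1 t2 u2 u3 tu).
exact: pq (esym (chebyshev_unique_le hq hp u1 t1 u2 t2 t3 (ltW ut))).
Qed.

End Bijection.

Section ValueBijection.
Variables (R : realType) (m : nat).
Implicit Types (p q c d v : 'rV[R]_m).

Lemma alternating_connected : connected (@alternating R m).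
Proof.
apply: convex_connected => v w av aw t /andP[t0 t1] k k' kk.
have := av k k' kk; have := aw k k' kk; rewrite !mxE.
set s := (-1) ^+ _; set a := s * _; set b := s * _ => a0 b0.
have -> : s * (v 0 k' + t * (w 0 k' - v 0 k') - (v 0 k + t * (w 0 k - v 0 k))) = (1 - t) * b + t * a.
  by rewrite /a /b; ring.
have [->|tn] := eqVneq t 0; first by lra.
have : 0 < t by rewrite lt_def tn.
nra.
Qed.

Lemma clopen_alternating (P : set 'rV[R]_m) :
  (forall v, P v -> \forall w \near v, P w) ->
  (forall v, alternating v -> closure P v -> P v) ->
  (exists2 v, alternating v & P v) -> forall v, alternating v -> P v.
Proof.
move=> oP cP [v0 av0 pv0] v av.
have : @alternating R m `&` P = @alternating R m; last by move=> e; move: av; rewrite -{1}e => -[].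
apply: alternating_connected; first by exists v0.
  exists (interior P); first exact: open_interior.
  by apply/seteqP; split=> w [aw]; [move=> /oP|move/interior_subset].
exists (closure P); first exact: closed_closure.
by apply/seteqP; split=> w [aw pw]; split=> //; [exact: subset_closure|exact: cP].
Qed.

Lemma crit_values_surj v : alternating v -> exists2 p, hyperbolic p & crit_values p = v.
Proof.
apply: (@clopen_alternating (@realized R m)).
- exact: realized_open.
- exact: realized_closed.
have [p hp] := hyperbolic_exists R m.
by exists (crit_values p); [exact: crit_values_alternating|exists p].
Qed.

Lemma crit_values_inj p q : hyperbolic p -> hyperbolic q -> crit_values p = crit_values q -> p = q.
Proof.
move=> hp hq pq; case: (posnP m) => [m0|m0].
  by apply/rowP => k; have := ltn_ord k; rewrite {2}m0.
apply: contrapT => npq; apply: (chebyshev_not_twice m0 (R := R)).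
apply: (@clopen_alternating (@realized_twice R m)).
- exact: realized_twice_open.
- exact: realized_twice_closed.
- exists (crit_values p); first exact: crit_values_alternating.
  by exists p, q.
exact: chebyshev_alternating.
Qed.

End ValueBijection.

(** * Strata of a given combinatorial type *)

Section Configurations.
Variables (R : realType) (m l : nat).
Local Notation I := 'I_(m + l).
Local Notation E := ('rV[R]_m * 'rV[R]_l)%type.
Implicit Types (z : E).

Definition abscissas z (i : I) : R := row_mx (crits z.1) z.2 0 i.
Definition ordinates z (i : I) : R := (centered z.1).[abscissas z i].

Lemma abscissas_crit z k : abscissas z (lshift l k) = crits z.1 0 k.
Proof. by rewrite /abscissas row_mxEl. Qed.

Lemma abscissas_boundary z j : abscissas z (rshift m j) = z.2 0 j.
Proof. by rewrite /abscissas row_mxEr. Qed.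

Lemma ordinates_crit z k : ordinates z (lshift l k) = crit_values z.1 0 k.
Proof. by rewrite /ordinates abscissas_crit mxE. Qed.

Lemma ordinates_inj z : injective (ordinates z) -> injective (abscissas z).
Proof. by move=> h i j e; apply: h; rewrite /ordinates e. Qed.

Lemma alt_config_points z : hyperbolic z.1 -> alt_config (abscissas z) (ordinates z).
Proof.
move=> /critical_crits pc; apply/alt_configP; split=> [i j ij nk|k k' kk]; last first.
  by rewrite !abscissas_crit (critical_lt _ _ pc).
rewrite /ordinates (critical_ltE pc ij); last by move=> k; rewrite -abscissas_crit.
by congr (~~ odd _); apply: eq_card => k; rewrite !inE abscissas_crit.
Qed.

Section Realization.
Context {d : Order.disp_t} {T : orderType d}.
Variables (x : I -> T) (u : I -> R).
Hypotheses (xu : alt_config x u) (xinj : injective x) (uinj : injective u).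

Lemma alt_config_critlt (k k' : 'I_m) : (x (lshift l k) < x (lshift l k'))%O = (k < k')%N.
Proof.
have /alt_configP[_ h] := xu; case: (ltngtP k k') => [/h//|/h kk|/val_inj->]; last exact: ltxx.
by apply/negbTE; rewrite -leNgt ltW.
Qed.

Lemma crit_ge_crit (k : 'I_m) : crit_ge x (x (lshift l k)) = (m - k)%N.
Proof.
rewrite /crit_ge (_ : [set j | _]%SET = ~: [set j : 'I_m | (j < k)%N]%SET); last first.
  by apply/setP => j; rewrite !inE leNgt alt_config_critlt.
rewrite cardsCs finset.setCK card_ord; congr (_ - _)%N.
rewrite -[RHS]card_ord -(card_imset (f := widen_ord (ltnW (ltn_ord k)))).
  apply: eq_card => a; rewrite inE; apply/idP/imsetP => [ak|[b _ ->]]; last exact: ltn_ord b.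
  by exists (Ordinal ak) => //; apply: val_inj.
by move=> a b /(congr1 val)/= /val_inj.
Qed.

Lemma alt_config_alternating : alternating (\row_k u (lshift l k)).
Proof.
move=> k k' kk; rewrite !mxE -crit_ge_crit.
have /alt_configP[h _] := xu.
have kk' : (x (lshift l k) < x (lshift l k'))%O by rewrite alt_config_critlt kk.
have {}h := h _ _ kk'; have {h} : (u (lshift l k) < u (lshift l k')) = ~~ odd (crit_ge x (x (lshift l k'))).
  by apply: h => j; rewrite !alt_config_critlt kk; lia.
rewrite -signr_odd; case: (odd _) => /= h; rewrite ?expr1 ?expr0 ?mulN1r ?mul1r ?oppr_gt0 ?subr_gt0 ?subr_lt0 //.
rewrite lt_neqAle leNgt h andbT; apply/eqP => /uinj/lshift_inj e.
by move: kk; rewrite e; lia.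
Qed.

Lemma crit_ge_sign (i j : I) : (x i < x j)%O ->
  (forall k, ~~ (x i < x (lshift l k) < x j)%O) ->
  0 < (-1) ^+ crit_ge x (x j) * (u j - u i).
Proof.
move=> ij nk; have /alt_configP[/(_ _ _ ij nk) h _] := xu.
move: h; rewrite -signr_odd; case: (odd _) => /= h; rewrite ?expr1 ?expr0 ?mulN1r ?mul1r ?oppr_gt0 ?subr_gt0 ?subr_lt0 //.
rewrite lt_neqAle leNgt h andbT; apply/eqP => /uinj e.
by move: ij; rewrite e ltxx.
Qed.

Lemma realization_boundary p (j : 'I_l) : hyperbolic p ->
  (forall k, (centered p).[crits p 0 k] = u (lshift l k)) ->
  exists b, (centered p).[b] = u (rshift m j) /\
    forall k, (crits p 0 k < b) = (x (lshift l k) < x (rshift m j))%O /\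
              (b < crits p 0 k) = (x (rshift m j) < x (lshift l k))%O.
Proof.
move=> hp pu; have pc := critical_crits hp; set c := crits p in pc pu *.
set i := rshift m j; set F := centered p in pu *.
have xneq k : x (lshift l k) != x i by rewrite (inj_eq xinj) eq_lrshift.
pose A := crit_ge x (x i).
have [a [a1 a2 a3]] : exists a, [/\ a <= `|c|, forall k, (x (lshift l k) < x i)%O -> c 0 k <= a &
    (forall k, (x i < x (lshift l k))%O -> a < c 0 k) /\ 0 < (-1) ^+ A * (u i - F.[a])].
  case: (pickP (fun k => (x (lshift l k) < x i)%O)) => [k0 k0i|no].
    have [k kP kmax] := @arg_maxnP _ k0 (fun k => (x (lshift l k) < x i)%O) (fun k => k : nat) k0i.
    exists (c 0 k); split.
    - exact: le_trans (ler_norm _) (coord_le_norm _ _).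
    - by move=> k' /kmax; rewrite (critical_le _ _ pc).
    - split.
        move=> k' ik'; rewrite (critical_lt _ _ pc) -alt_config_critlt; exact: lt_trans ik'.
      rewrite pu; apply: crit_ge_sign => // k'; apply/negP => /andP[].
      by rewrite alt_config_critlt => kk' /kmax /=; rewrite leqNgt kk'.
  have [a ac ha] := centered_left_tail p ((-1) ^+ m.+1 * u i) (- `|c|).
  exists a; split.
  - by rewrite ltW // (lt_le_trans ac) // (le_trans _ (normr_ge0 _)) // oppr_le0.
  - by move=> k; rewrite no.
  - split.
      move=> k _; apply: lt_le_trans ac _; rewrite lerNl.
      by apply: le_trans (coord_le_norm c k); rewrite -normrN ler_norm.
    have -> : A = m.
      rewrite /A /crit_ge (_ : [set k | _]%SET = [set: 'I_m]%SET) ?cardsT ?card_ord //.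
      by apply/setP => k; rewrite !inE leNgt no.
    by move: ha; rewrite exprS !mulN1r !mulNr ltrN2 mulrBr subr_gt0.
have [b [b1 [b2 b3] b4]] : exists b, [/\ a < b, (forall k, (x (lshift l k) < x i)%O -> c 0 k < b) /\
    (forall k, (x i < x (lshift l k))%O -> b <= c 0 k) & 0 < (-1) ^+ A * (F.[b] - u i)].
  case: (pickP (fun k => (x i < x (lshift l k))%O)) => [k0 k0i|no].
    have [k kP kmin] := @arg_minnP _ k0 (fun k => (x i < x (lshift l k))%O) (fun k => k : nat) k0i.
    exists (c 0 k); split.
    - exact: a3.1.
    - split; first by move=> k' ik'; rewrite (critical_lt _ _ pc) -alt_config_critlt; exact: lt_trans kP.
      by move=> k' /kmin; rewrite (critical_le _ _ pc).
    - have -> : A = crit_ge x (x (lshift l k)).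
        apply: eq_card => k'; rewrite !inE; apply/idP/idP; last by apply: le_trans; exact: ltW.
        rewrite le_eqVlt eq_sym (negbTE (xneq k')) /= => /kmin; by rewrite leNgt alt_config_critlt -leqNgt.
      rewrite pu; apply: crit_ge_sign => // k'; apply/negP => /andP[/kmin].
      by rewrite alt_config_critlt leqNgt => /negbTE->.
  have [b bc hb] := centered_right_tail p (u i) `|c|.
  exists b; split; first exact: le_lt_trans bc.
    split=> k; last by rewrite no.
    by move=> _; apply: le_lt_trans bc; exact: le_trans (ler_norm _) (coord_le_norm _ _).
  have -> : A = 0%N.
    apply/eqP; rewrite cards_eq0; apply/eqP/setP => k; rewrite !inE.
    by rewrite le_eqVlt eq_sym (negbTE (xneq k)) no.
  by rewrite expr0 mul1r subr_gt0.
have GE y : (F - (u i)%:P).[y] = F.[y] - u i by rewrite hornerD hornerN hornerC.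
have sg : (F - (u i)%:P).[a] * (F - (u i)%:P).[b] < 0.
  rewrite !GE; move: a3.2 b4; rewrite -signr_odd.
  case: (odd A); rewrite ?expr1 ?expr0 ?mulN1r ?mul1r ?oppr_gt0 => h1 h2; nra.
have [y] := polyrcf.poly_ivtoo (ltW b1) sg.
rewrite in_itv /= => /andP[ay yb] /rootP; rewrite GE => /eqP; rewrite subr_eq0 => /eqP e.
exists y; split=> // k.
have [lt|gt|e'] := ltgtP (x (lshift l k)) (x i); last by have := xneq k; rewrite e' eqxx.
  have h : c 0 k < y := le_lt_trans (a2 k lt) ay.
  by rewrite h; split=> //; apply/negbTE; rewrite -leNgt ltW.
have h : y < c 0 k := lt_le_trans yb (b3 k gt).
by rewrite h; split=> //; apply/negbTE; rewrite -leNgt ltW.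
Qed.

Lemma realization : exists z, [/\ hyperbolic z.1, ordinates z = u &
  forall i j, (abscissas z i < abscissas z j) = (x i < x j)%O].
Proof.
have [p hp pv] := crit_values_surj alt_config_alternating.
have pc := critical_crits hp.
have pu k : (centered p).[crits p 0 k] = u (lshift l k).
  by rewrite -(crit_valuesE k pc) pv mxE.
have [b bP] := boolp.choice (fun j => realization_boundary j hp pu).
pose z : E := (p, \row_j b j).
have uz : ordinates z = u.
  apply/funext => i; case: (split_ordP i) => k ->.
    by rewrite /ordinates abscissas_crit /= pu.
  by rewrite /ordinates abscissas_boundary /= mxE (bP k).1.
exists z; split=> //.
have zinj : injective (abscissas z) by apply: ordinates_inj; rewrite uz.
have cb k j : (abscissas z (lshift l k) < abscissas z (rshift m j)) = (x (lshift l k) < x (rshift m j))%O.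
  by rewrite abscissas_crit abscissas_boundary /= mxE; have [] := (bP j).2 k.
have bc k j : (abscissas z (rshift m j) < abscissas z (lshift l k)) = (x (rshift m j) < x (lshift l k))%O.
  by rewrite abscissas_crit abscissas_boundary /= mxE; have [] := (bP j).2 k.
have zu := alt_config_points (z := z) hp; rewrite uz in zu.
have key j j' : (x (rshift m j) < x (rshift m j'))%O -> abscissas z (rshift m j) < abscissas z (rshift m j').
  move=> jj; have [//|gt|/zinj e] := ltgtP (abscissas z (rshift m j)) (abscissas z (rshift m j')); last first.
    by move: jj; rewrite e ltxx.
  case: (pickP (fun k => (x (rshift m j) < x (lshift l k))%O && (x (lshift l k) < x (rshift m j'))%O)) => [k /andP[]|no].
    by rewrite -bc -cb => h1 h2; by have := lt_trans (lt_trans h1 h2) gt; rewrite ltxx.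
  have /alt_configP[h _] := xu; have {}h := h _ _ jj (fun k => negbT (no k)).
  have /alt_configP[h' _] := zu; have {h'} := h' _ _ gt.
  have -> : crit_ge (abscissas z) (abscissas z (rshift m j)) = crit_ge x (x (rshift m j')).
    apply: eq_card => k; rewrite !inE !leNgt cb; congr negb; apply/idP/idP => [kj|kj'].
      exact: lt_trans jj.
    have := no k; rewrite kj' andbT => /negbT; rewrite -leNgt le_eqVlt (inj_eq xinj) eq_lrshift //.
  move=> h'; have : (u (rshift m j') < u (rshift m j)) = (u (rshift m j) < u (rshift m j')).
    rewrite h h' // => k; rewrite bc cb; apply/negP => /andP[h1 h2].
    by have := lt_trans h1 (lt_trans h2 jj); rewrite ltxx.
  case: (ltgtP (u (rshift m j')) (u (rshift m j))) => // /uinj e _.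
  by move: jj; rewrite e ltxx.
move=> i i'; case: (split_ordP i) => k ->; case: (split_ordP i') => k' -> //.
  by rewrite !abscissas_crit (critical_lt _ _ pc) alt_config_critlt.
have [lt|gt|/xinj/rshift_inj->] := ltgtP (x (rshift m k)) (x (rshift m k')); last exact: ltxx.
  exact: key.
by apply/negbTE; rewrite -leNgt ltW // key.
Qed.

End Realization.
End Configurations.

Section Strata.
Variables (R : realType) (m l : nat).
Local Notation I := 'I_(m + l).
Local Notation E := ('rV[R]_m * 'rV[R]_l)%type.
Implicit Types (z : E) (rs : {perm I} * {perm I}).

Definition stratum rs : set E := [set z | [/\ hyperbolic z.1,
  forall i j, (abscissas z i < abscissas z j) = (rs.1 i < rs.1 j)%N &
  forall i j, (ordinates z i < ordinates z j) = (rs.2 i < rs.2 j)%N]].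

Lemma order_perm_inj (T : Type) (f : T -> R) (g : T -> I) :
  injective g -> (forall i j, (f i < f j) = (g i < g j)%N) -> injective f.
Proof.
move=> gi h i j e; apply: gi; apply: val_inj => /=.
by case: (ltngtP (g i) (g j)) => //; rewrite -h e ltxx.
Qed.

Lemma stratum_ordinates_inj rs z : stratum rs z -> injective (ordinates z).
Proof. by move=> [_ _ h]; exact: order_perm_inj (@perm_inj _ _) h. Qed.

Lemma cvg_abscissas z i : hyperbolic z.1 -> abscissas w i @[w --> z] --> abscissas z i.
Proof.
move=> hz; case: (split_ordP i) => k ->.
  rewrite abscissas_crit (_ : (fun w => _) = (fun w : E => crits w.1 0 k)); last first.
    by apply/funext => w; rewrite abscissas_crit.
  apply: (@cvg_coord R m _ (nbhs z)).
  by apply: (@cvg_comp _ _ _ fst (@crits R m) (nbhs z) (nbhs z.1)); [exact: cvg_fst|exact: cvg_crits].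
rewrite abscissas_boundary (_ : (fun w => _) = (fun w : E => w.2 0 k)); last first.
  by apply/funext => w; rewrite abscissas_boundary.
by apply: (@cvg_coord R l _ (nbhs z)); exact: cvg_snd.
Qed.

Lemma cvg_ordinates z i : hyperbolic z.1 -> ordinates w i @[w --> z] --> ordinates z i.
Proof.
move=> hz; apply: (@cvg_horner R m _ (nbhs z) _ fst (fun w => abscissas w i)); first exact: cvg_fst.
exact: cvg_abscissas.
Qed.

Lemma near_order (T : topologicalType) (J : finType) (f : J -> T -> R) (t : T) :
  (forall i, f i w @[w --> t] --> f i t) -> injective (f^~ t) ->
  \forall w \near t, forall i j, (f i w < f j w) = (f i t < f j t).
Proof.
move=> cf inj.
have lt i j : f i t < f j t -> \forall w \near t, f i w < f j w.
  move=> ij; have : f j w - f i w @[w --> t] --> f j t - f i t.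
    by apply: (@cvgB _ _ _ (nbhs t)); exact: cf.
  move=> /cvgr_gt/(_ 0); rewrite subr_gt0 => /(_ ij).
  by apply: filterS => w; rewrite subr_gt0.
have h (ij : J * J) : \forall w \near t, (f ij.1 w < f ij.2 w) = (f ij.1 t < f ij.2 t).
  case: (ltgtP (f ij.1 t) (f ij.2 t)) => [/lt|/lt|/inj->].
  - by apply: filterS => w ->.
  - by apply: filterS => w h; apply/negbTE; rewrite -leNgt ltW.
  - by apply: filterE => w; rewrite ltxx.
have hf : \forall w \near t, forall ij : J * J, (f ij.1 w < f ij.2 w) = (f ij.1 t < f ij.2 t).
  exact: filter_forall h.
by apply: filterS hf => w hw i j; exact: (hw (i, j)).
Qed.

Lemma stratum_open rs z : stratum rs z -> nbhs z (stratum rs).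
Proof.
move=> Sz; have [hz h1 h2] := Sz; have oinj := stratum_ordinates_inj Sz.
have n1 : \forall w \near z, hyperbolic w.1.
  exact: (cvg_fst (hyperbolic_near hz)).
have n2 : \forall w \near z, forall i j, (abscissas w i < abscissas w j) = (abscissas z i < abscissas z j).
  apply: (@near_order _ _ (fun i w => abscissas w i)); last exact: ordinates_inj.
  by move=> i; exact: cvg_abscissas.
have n3 : \forall w \near z, forall i j, (ordinates w i < ordinates w j) = (ordinates z i < ordinates z j).
  apply: (@near_order _ _ (fun i w => ordinates w i)) => // i.
  exact: cvg_ordinates.
near=> w; have [hw w1 w2] : [/\ hyperbolic w.1, forall i j, (abscissas w i < abscissas w j) = (abscissas z i < abscissas z j) &
    forall i j, (ordinates w i < ordinates w j) = (ordinates z i < ordinates z j)].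
  by split; near: w.
split=> // i j.
  by rewrite w1.
by rewrite w2.
Unshelve. all: by end_near. Qed.

Definition marked_values z : E := (crit_values z.1, \row_j (centered z.1).[z.2 0 j]).

Lemma marked_valuesE z : row_mx (marked_values z).1 (marked_values z).2 = \row_i ordinates z i.
Proof.
apply/rowP => i; rewrite [RHS]mxE; case: (split_ordP i) => k ->.
  by rewrite row_mxEl ordinates_crit.
by rewrite row_mxEr /ordinates abscissas_boundary mxE.
Qed.

Lemma ordinates_marked z i : ordinates z i = row_mx (marked_values z).1 (marked_values z).2 0 i.
Proof. by rewrite marked_valuesE mxE. Qed.

Lemma marked_values_inj rs : {in stratum rs &, injective marked_values}.
Proof.
move=> z w; rewrite !inE => -[hz z1 z2] [hw w1 w2] [e1 e2].
have p_eq : z.1 = w.1 by exact: crit_values_inj.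
have side (i : 'I_l) k : (z.2 0 i < crits z.1 0 k) = (w.2 0 i < crits z.1 0 k).
  by rewrite {2}p_eq -!abscissas_boundary -!abscissas_crit z1 w1.
have side' (i : 'I_l) k : (crits z.1 0 k < z.2 0 i) = (crits z.1 0 k < w.2 0 i).
  by rewrite {2}p_eq -!abscissas_boundary -!abscissas_crit z1 w1.
have pc := critical_crits hz.
have b_eq : z.2 = w.2.
  apply/rowP => i; have := congr1 (fun v : 'rV[R]_l => v 0 i) e2; rewrite !mxE -p_eq => e.
  have [lt|gt|//] := ltgtP (z.2 0 i) (w.2 0 i).
    have := critical_mono pc lt; rewrite e subrr mulr0 ltxx => h; suff : false by [].
    by apply: h => k; rewrite -side' andbC; case: ltgtP.
  have := critical_mono pc gt; rewrite e subrr mulr0 ltxx => h; suff : false by [].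
  by apply: h => k; rewrite side' andbC; case: ltgtP.
by case: z w {e1 e2 hz z1 z2 hw w1 w2 side side' pc} p_eq b_eq => p b [q b'] /= -> ->.
Qed.

Lemma critical_straddle (p c : 'rV[R]_m) (b e : R) : critical p c -> 0 < e ->
  (forall k, e < `|b - c 0 k|) ->
  ((centered p).[b - e] - (centered p).[b]) * ((centered p).[b + e] - (centered p).[b]) < 0.
Proof.
move=> pc e0 eg.
have lt : b - e < b by rewrite gtrBl.
have gt : b < b + e by rewrite ltrDl.
have nocrit k : ~~ (b - e <= c 0 k <= b + e).
  have := eg k; rewrite ltr_normr => /orP[] h; apply/negP => /andP[? ?]; lra.
have h1 : 0 < (-1) ^+ #|[set k | b <= c 0 k]%SET| * ((centered p).[b] - (centered p).[b - e]).
  apply: critical_mono pc lt _ => k; apply: contra (nocrit k) => /andP[/ltW-> /ltW h] /=.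
  exact: le_trans h (ltW gt).
have h2 : 0 < (-1) ^+ #|[set k | b + e <= c 0 k]%SET| * ((centered p).[b + e] - (centered p).[b]).
  apply: critical_mono pc gt _ => k; apply: contra (nocrit k) => /andP[/ltW h /ltW->] /=.
  by rewrite andbT; exact: le_trans (ltW lt) h.
have e12 : #|[set k | b + e <= c 0 k]%SET| = #|[set k | b <= c 0 k]%SET|.
  apply: eq_card => k; rewrite !inE; apply/idP/idP; first exact/le_trans/ltW.
  move=> bk; have := nocrit k; rewrite (le_trans (ltW lt) bk) /= -ltNge; exact: ltW.
rewrite e12 in h2; move: h1 h2; rewrite -signr_odd.
case: (odd _); rewrite ?expr1 ?expr0 ?mulN1r ?mul1r ?oppr_gt0 ?subr_gt0 ?subr_lt0 => h1 h2.
  by rewrite pmulr_rlt0 ?subr_gt0 // subr_lt0.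
by rewrite nmulr_rlt0 ?subr_lt0 // subr_gt0.
Qed.

Lemma marked_values_open rs z (A : set E) : stratum rs z -> nbhs z A ->
  nbhs (marked_values z) (marked_values @` A).
Proof.
move=> Sz [[P Q] /= [nP nQ] PQA]; have [hz z1 z2] := Sz; have pc := critical_crits hz.
have zinj := ordinates_inj (stratum_ordinates_inj Sz).
move: nQ => /nbhs_ballP[r /= r0 rQ]; rewrite -ball_normE in rQ.
set p := z.1 in nP pc *; set b := z.2 in rQ *; set c := crits p in pc.
have gap (ik : 'I_l * 'I_m) : \forall e \near 0^'+, e < `|b 0 ik.1 - c 0 ik.2|.
  apply: nbhs_right_lt; rewrite normr_gt0 subr_eq0.
  rewrite -abscissas_boundary -abscissas_crit (inj_eq zinj) eq_sym eq_lrshift //.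
have gaps : \forall e \near 0^'+, forall ik : 'I_l * 'I_m, e < `|b 0 ik.1 - c 0 ik.2|.
  exact: filter_forall gap.
have [e [e0 er eg]] : exists e : R, [/\ 0 < e, e < r & forall ik : 'I_l * 'I_m, e < `|b 0 ik.1 - c 0 ik.2|].
  apply: (@filter_ex _ (0^'+)); near=> e; split; near: e => //.
    exact: nbhs_right_gt.
  exact: nbhs_right_lt.
pose f i (v : E) := ((centered v.1).[b 0 i - e] - v.2 0 i) * ((centered v.1).[b 0 i + e] - v.2 0 i).
have f0 i : f i (p, (marked_values z).2) < 0.
  rewrite /f /= !mxE -/p -/b.
  by apply: critical_straddle pc e0 _ => k; exact: (eg (i, k)).
have fc i : f i v @[v --> (p, (marked_values z).2)] --> f i (p, (marked_values z).2).
  set F := nbhs (p, (marked_values z).2).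
  have c2 : (fun v : E => v.2 0 i) @ F --> (marked_values z).2 0 i.
    by apply: (@cvg_coord R l _ F); exact: cvg_snd.
  have c1 (x : R) : (fun v : E => (centered v.1).[x]) @ F --> (centered p).[x].
    by apply: (@cvg_horner R m _ F _ fst (fun=> x)); [exact: cvg_fst|exact: cvg_cst].
  by apply: (@cvgM _ _ F); apply: (@cvgB _ _ _ F).
have ni i : \forall v \near (p, (marked_values z).2), f i v < 0.
  by have /cvgr_lt := fc i; apply.
have nf : \forall v \near (p, (marked_values z).2), forall i, f i v < 0.
  exact: filter_forall ni.
move: nf => [[P' Q'] /= [nP' nQ'] f'].
have nPP : nbhs p (P `&` P') by exact: filterI.
have nv := crit_values_open hz nPP.
exists ([set y | exists q, [/\ (P `&` P') q, hyperbolic q & crit_values q = y]], Q') => //.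
move=> [v w] /= [[q [[Pq P'q] hq <-]] Q'w].
have /boolp.choice[b' b'P] : forall i, exists y, `|b 0 i - y| < r /\ (centered q).[y] = w 0 i.
  move=> i; have := f' (q, w) (conj P'q Q'w) i; rewrite /f /= => sg.
  have GE y : (centered q - (w 0 i)%:P).[y] = (centered q).[y] - w 0 i by rewrite hornerD hornerN hornerC.
  rewrite -!GE in sg; have le : b 0 i - e <= b 0 i + e by lra.
  have [y] := polyrcf.poly_ivtoo le sg.
  rewrite in_itv /= => /andP[ay yb] /rootP; rewrite GE => /eqP; rewrite subr_eq0 => /eqP ey.
  by exists y; split=> //; rewrite ltr_norml; lra.
exists (q, \row_i b' i).
  by apply: PQA; split=> //=; apply: rQ; apply: norm_lt_coord => // i; rewrite !mxE; exact: (b'P i).1.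
by congr pair => /=; apply/rowP => i; rewrite !mxE (b'P i).2.
Unshelve. all: by end_near. Qed.

Definition value_cell (g : I -> I) : set E :=
  [set y | forall i j, (row_mx y.1 y.2 0 i < row_mx y.1 y.2 0 j) = (g i < g j)%N].

Lemma lt_segment (a a' b b' t : R) : 0 <= t <= 1 -> a < a' -> b < b' ->
  a + t * (b - a) < a' + t * (b' - a').
Proof.
move=> /andP[t0 t1] ab ab'; rewrite -subr_gt0.
rewrite (_ : _ - _ = (1 - t) * (a' - a) + t * (b' - b)); last by ring.
have [->|tn] := eqVneq t 1; first by rewrite subrr mul0r mul1r add0r subr_gt0.
apply: ltr_pwDl; last by rewrite mulr_ge0 // subr_ge0 ltW.
by rewrite mulr_gt0 // subr_gt0 // lt_neqAle tn.
Qed.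

Lemma value_cell_connected g : injective g -> connected (value_cell g).
Proof.
move=> gi; apply: convex_connected => y y' cy cy' t t01 i j.
have E_i k : row_mx (y + t *: (y' - y)).1 (y + t *: (y' - y)).2 0 k =
    row_mx y.1 y.2 0 k + t * (row_mx y'.1 y'.2 0 k - row_mx y.1 y.2 0 k).
  by case: (split_ordP k) => k' ->; rewrite ?row_mxEl ?row_mxEr !mxE.
rewrite !E_i; case: (ltngtP (g i) (g j)) => [lt|gt|/val_inj/gi->]; last exact: ltxx.
  by apply: lt_segment; rewrite ?cy ?cy'.
by apply/negbTE; rewrite -leNgt ltW //; apply: lt_segment; rewrite ?cy ?cy'.
Qed.

Lemma stratum_alt_types rs z : stratum rs z -> rs \in alt_types m l.
Proof.
move=> [hz z1 z2]; rewrite inE; apply: etrans (alt_config_points hz); apply: alt_config_mono => i j.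
  by rewrite z1 ltEnat.
by rewrite z2 ltEnat.
Qed.

Lemma stratum_realization rs y : rs \in alt_types m l ->
  value_cell rs.2 y -> exists2 z, stratum rs z & marked_values z = y.
Proof.
rewrite inE => cfg cy; pose u i := row_mx y.1 y.2 0 i.
have inj (s : {perm I}) : injective (fun i => s i : nat) by move=> i j /val_inj/perm_inj.
have xu : alt_config (fun i => rs.1 i : nat) u.
  by apply: etrans cfg; apply: alt_config_mono => i j //; rewrite ltEnat /= -cy.
have uinj : injective u by exact: order_perm_inj (@perm_inj _ rs.2) cy.
have [z [hz zu zx]] := realization xu (inj _) uinj.
exists z; first by split=> // i j; rewrite zu /u cy.
have : row_mx (marked_values z).1 (marked_values z).2 = row_mx y.1 y.2.
  by apply/rowP => i; rewrite -ordinates_marked zu.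
by move=> /eq_row_mx[]; case: (marked_values z) y {cfg cy u xu uinj zu} => ? ? [? ?] /= -> ->.
Qed.

Lemma stratum_nonempty rs : rs \in alt_types m l -> stratum rs !=set0.
Proof.
move=> cfg; pose y : E := (\row_k (rs.2 (lshift l k))%:R, \row_j (rs.2 (rshift m j))%:R).
have [|z Sz _] := @stratum_realization rs y cfg; last by exists z.
have yE i : row_mx y.1 y.2 0 i = (rs.2 i)%:R.
  by case: (split_ordP i) => k ->; rewrite ?row_mxEl ?row_mxEr mxE.
by move=> i j; rewrite !yE ltr_nat.
Qed.

Lemma stratum_connected rs : connected (stratum rs).
Proof.
case: (boolP (rs \in alt_types m l)) => [cfg|ncfg]; last first.
  rewrite (_ : stratum rs = set0); first exact: connected0.
  by apply/seteqP; split=> // z /stratum_alt_types; rewrite (negbTE ncfg).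
apply: (@open_injective_connected _ _ _ marked_values).
- by move=> z; exact: stratum_open.
- exact: marked_values_inj.
- by move=> z A; exact: marked_values_open.
rewrite (_ : _ @` _ = value_cell rs.2); first exact/value_cell_connected/perm_inj.
apply/seteqP; split=> [_ [z [_ _ z2] <-] i j|y cy]; first by rewrite -!ordinates_marked z2.
by have [z Sz <-] := stratum_realization cfg cy; exists z.
Qed.

Lemma rank_perm (N : nat) (x : 'I_N -> R) : injective x ->
  exists s : {perm 'I_N}, forall i j, (x i < x j) = (s i < s j)%N.
Proof.
move=> xinj; pose below i := [set k | x k < x i]%SET.
have below_lt i j : x i < x j -> (#|below i| < #|below j|)%N.
  move=> ij; apply: proper_card; apply/properP; split.
    by apply/fintype.subsetP => k; rewrite !inE => /lt_trans; exact.
  by exists i; rewrite !inE ?ltxx.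
have below_N i : (#|below i| < N)%N.
  rewrite -[X in (_ < X)%N]card_ord -cardsT; apply: proper_card; apply/properP; split.
    exact/fintype.subsetP.
  by exists i; rewrite !inE ?ltxx.
have below_ltE i j : (x i < x j) = (#|below i| < #|below j|)%N.
  case: (ltgtP (x i) (x j)) => [/below_lt->//|/below_lt|/xinj->]; last by rewrite ltnn.
  by move=> h; apply/esym/negbTE; rewrite -leqNgt ltnW.
pose s i := Ordinal (below_N i).
have sinj : injective s.
  move=> i j /(congr1 val)/= e; apply: xinj.
  by case: (ltgtP (x i) (x j)) => // /below_lt; rewrite e ltnn.
exists (perm sinj) => i j; rewrite !permE; exact: below_ltE.
Qed.

Lemma order_perm_eq (N : nat) (s t : {perm 'I_N}) :
  (forall i j, (s i < s j)%N = (t i < t j)%N) -> s = t.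
Proof.
have below (u : {perm 'I_N}) i : #|[set k | (u k < u i)%N]%SET| = u i.
  rewrite -(card_imset _ (@perm_inj _ u)) -[RHS](card_ord (u i)).
  rewrite -(card_imset (f := widen_ord (ltnW (ltn_ord (u i))))); last first.
    by move=> a b /(congr1 val)/= /val_inj.
  apply: eq_card => a; apply/idP/idP => /imsetP[k]; last first.
    move=> _ ->; apply/imsetP.
    by exists (u^-1%g (widen_ord (ltnW (ltn_ord (u i))) k)); rewrite ?inE permKV //=.
  by rewrite inE => ki ->; apply/imsetP; exists (Ordinal ki) => //; exact: val_inj.
move=> st; apply/perm.permP => i; apply: val_inj; rewrite /= -(below s i) -(below t i).
by apply: eq_card => k; rewrite !inE st.
Qed.

Lemma stratum_disjoint rs rs' z : stratum rs z -> stratum rs' z -> rs = rs'.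
Proof.
move=> [_ z1 z2] [_ z1' z2']; case: rs rs' z1 z2 z1' z2' => r s [r' s'] /= z1 z2 z1' z2'.
by congr pair; apply: order_perm_eq => i j; rewrite -?z1 -?z2.
Qed.

Lemma stratum_cover z : hyperbolic z.1 -> injective (ordinates z) ->
  exists2 rs, rs \in alt_types m l & stratum rs z.
Proof.
move=> hz oi; have [r hr] := rank_perm (ordinates_inj oi); have [s hs] := rank_perm oi.
have Sz : stratum (r, s) z by split.
by exists (r, s) => //; exact: stratum_alt_types Sz.
Qed.

End Strata.

(** * Very nice morsifications *)

Section VeryNice.
Variables (R : realType) (m l : nat).
Local Notation M := (m.+1 - 2)%N.
Implicit Types (a : 'rV[R]_M) (p q : 'rV[R]_m) (b : 'rV[R]_l) (rs : {perm 'I_(m + l)} * {perm 'I_(m + l)}).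

Definition low_part a : {poly R} := \sum_(i < M) a 0 i *: 'X^(m.+1 - 2 - i).

Lemma coef_low_part a (i : 'I_M) : (low_part a)`_(m.+1 - 2 - i) = a 0 i.
Proof.
rewrite coef_sum (bigD1 i) //= coefZ coefXn eqxx mulr1 big1 ?addr0 // => j ji.
rewrite coefZ coefXn (_ : (_ == _) = false) ?mulr0 //.
apply/negbTE; apply: contra ji => /eqP e; apply/eqP; apply: val_inj => /=.
have := ltn_ord i; have := ltn_ord j; lia.
Qed.

Lemma coef_low_part0 a k : (forall i : 'I_M, k != m.+1 - 2 - i)%N -> (low_part a)`_k = 0.
Proof.
move=> h; rewrite coef_sum big1 // => j _.
by rewrite coefZ coefXn (negbTE (h j)) mulr0.
Qed.

Definition coordinates a : 'rV[R]_m := poly_rV (low_part a).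
Definition truncate p : 'rV[R]_M := \row_i (rVpoly p)`_(m.+1 - 2 - i).

Lemma rVpoly_coordinates a : rVpoly (coordinates a) = low_part a.
Proof.
rewrite poly_rV_K //; apply/leq_sizeP => k mk; apply: coef_low_part0 => i.
have := ltn_ord i; lia.
Qed.

Lemma centered_coordinates a : centered (coordinates a) = @morse_poly R m.+1 a.
Proof. by rewrite /centered rVpoly_coordinates. Qed.

Lemma truncate_coordinates a : truncate (coordinates a) = a.
Proof. by apply/rowP => i; rewrite mxE rVpoly_coordinates coef_low_part. Qed.

Lemma centered_truncate p :
  centered p = centered (coordinates (truncate p)) + ((rVpoly p)`_0)%:P.
Proof.
rewrite /centered -addrA; congr (_ + _); rewrite rVpoly_coordinates.
apply/polyP => k; rewrite coefD coefC.
case: k => [|k] /=.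
  by rewrite coef_low_part0 ?add0r // => i; have := ltn_ord i; lia.
rewrite addr0; case: (ltnP k.+1 m) => km.
  have ik : (m.+1 - 2 - k.+1 < M)%N by lia.
  have e : k.+1 = (m.+1 - 2 - Ordinal ik)%N by rewrite /=; lia.
  by rewrite {2}e coef_low_part mxE -e.
rewrite coef_low_part0; last by move=> i; have := ltn_ord i; lia.
by rewrite coef_rVpoly; case: insubP => // i; rewrite ltnNge km.
Qed.

Lemma cvg_coordinates a : coordinates a' @[a' --> a] --> coordinates a.
Proof.
have coordE a' k : coordinates a' 0 k = \sum_(i < M) a' 0 i * (nat_of_ord k == m.+1 - 2 - i)%N%:R.
  by rewrite mxE coef_sum; apply: eq_bigr => i _; rewrite coefZ coefXn.
apply: (@cvg_rV R m _ (nbhs a)) => k; rewrite coordE.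
rewrite (_ : (fun a' => _) = (fun a' => \sum_(i < M) a' 0 i * (nat_of_ord k == m.+1 - 2 - i)%N%:R)); last first.
  by apply/funext => a'; rewrite coordE.
apply: (@cvg_sumr R _ _ (nbhs a)) => i; apply: (@cvgM _ _ (nbhs a)); last exact: cvg_cst.
by apply: (@cvg_coord R _ _ (nbhs a)); exact: cvg_id.
Qed.

Lemma cvg_truncate p : truncate q @[q --> p] --> truncate p.
Proof.
apply: (@cvg_rV R _ _ (nbhs p)) => i; rewrite mxE.
rewrite (_ : (fun q => _) = (fun q => (rVpoly q)`_(m.+1 - 2 - i))); last first.
  by apply/funext => q; rewrite mxE.
under eq_fun do rewrite coef_rVpoly; rewrite coef_rVpoly.
case: insub => [k|]; last exact: cvg_cst.
by apply: (@cvg_coord R _ _ (nbhs p)); exact: cvg_id.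
Qed.

Lemma critical_shift p q (c : R) : centered p = centered q + c%:P -> critical p = critical q.
Proof. by move=> e; rewrite /critical e derivD derivC addr0. Qed.

Lemma stratum_shift rs p q b (c : R) : centered p = centered q + c%:P ->
  stratum rs (p, b) -> stratum rs (q, b).
Proof.
move=> e; have ce := critical_shift e.
have he : hyperbolic p = hyperbolic q by rewrite /hyperbolic ce.
have ae i : abscissas (p, b) i = abscissas (q, b) i by rewrite /abscissas /crits /= ce.
have oe i : ordinates (p, b) i = ordinates (q, b) i + c.
  by rewrite /ordinates ae /= e hornerD hornerC.
move=> [/= hp p1 p2]; split=> [|i j|i j] /=.
- by rewrite -he.
- by rewrite -p1 !ae.
- by rewrite -p2 !oe ltrD2r.
Qed.

Lemma injectiveb_ordinates p b : injectiveb (ordinates (p, b)) =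
  uniq ([seq (centered p).[x] | x <- [seq crits p 0 k | k <- enum 'I_m]] ++
        [seq (centered p).[b 0 j] | j : 'I_l]).
Proof.
pose s := [seq lshift l k | k <- enum 'I_m] ++ [seq rshift m j | j <- enum 'I_l].
have sE : perm_eq s (enum 'I_(m + l)).
  apply: uniq_perm; rewrite ?enum_uniq //.
    rewrite cat_uniq (map_inj_uniq (@lshift_inj _ _)) (map_inj_uniq (@rshift_inj _ _)) !enum_uniq /=.
    rewrite andbT; apply/hasPn => _ /mapP[j _ ->]; apply/mapP => -[k _ /eqP].
    by rewrite eq_sym eq_lrshift.
  move=> i; rewrite mem_enum inE mem_cat; case: (split_ordP i) => k ->.
    by rewrite map_f ?mem_enum.
  by rewrite orbC map_f ?mem_enum.
rewrite /injectiveb /dinjectiveb -(perm_uniq (perm_map (ordinates (p, b)) sE)) map_cat.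
rewrite -!(map_comp _ _ (enum _)); congr (uniq (_ ++ _)); apply: eq_map => k /=.
  by rewrite /ordinates abscissas_crit.
by rewrite /ordinates abscissas_boundary.
Qed.

Lemma very_niceE a b : @very_nice R m.+1 l (a, b) <->
  hyperbolic (coordinates a) /\ injective (ordinates (coordinates a, b)).
Proof.
suff : (exists2 c : m.-tuple R,
      (centered (coordinates a))^`() = m.+1%:R *: \prod_(x <- c) ('X - x%:P) &
      uniq ([seq (centered (coordinates a)).[x] | x <- c] ++
            [seq (centered (coordinates a)).[b 0 j] | j : 'I_l])) <->
    hyperbolic (coordinates a) /\ injective (ordinates (coordinates a, b)).
  by rewrite centered_coordinates.
split=> [[c ec uc]|[hp /injectiveP]].
  have uc' : uniq c by move: uc; rewrite cat_uniq => /andP[/map_uniq].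
  pose s := sort <=%R c.
  have ps : perm_eq s c by rewrite perm_sort.
  have ss : sorted <%R s by rewrite sort_lt_sorted.
  have szs : size s = m by rewrite size_sort size_tuple.
  pose d : 'rV[R]_m := \row_k s`_k.
  have ds : [seq d 0 k | k <- enum 'I_m] = s.
    apply: (@eq_from_nth _ 0) => [|i]; rewrite size_map size_enum_ord ?szs // => im.
    by rewrite (nth_map (Ordinal im)) ?size_enum_ord // mxE /= nth_enum_ord.
  have pd : critical (coordinates a) d.
    split=> [|k k' kk].
      rewrite ec; congr (_ *: _); rewrite -(perm_big _ ps) -ds big_map big_enum //.
    by rewrite !mxE (lt_sorted_ltn_nth 0 ss) ?inE ?szs.
  split; first by exists d.
  apply/injectiveP; rewrite injectiveb_ordinates (crits_critical pd) ds.
  by apply: etrans uc; apply: perm_uniq; rewrite perm_cat2r perm_map.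
rewrite injectiveb_ordinates => u.
have szc : size [seq crits (coordinates a) 0 k | k <- enum 'I_m] == m.
  by rewrite size_map size_enum_ord.
have pc := critical_crits hp.
exists (Tuple szc) => //.
by rewrite pc.1 big_map big_enum.
Qed.

Lemma morsifications_strata : finite_set (components (@very_nice R m.+1 l)) /\
  num_morsifications R m.+1 l = #|alt_types m l|.
Proof.
pose emb (ab : 'rV[R]_M * 'rV[R]_l) := (coordinates ab.1, ab.2).
pose cut (pb : 'rV[R]_m * 'rV[R]_l) := (truncate pb.1, pb.2).
have cutK ab : cut (emb ab) = ab by case: ab => a b; rewrite /cut /= truncate_coordinates.
have embc : continuous emb.
  move=> ab; apply: (@cvg_pair _ _ _ (nbhs ab) (nbhs (coordinates ab.1)) (nbhs ab.2)); last exact: cvg_snd.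
  by apply: (@cvg_comp _ _ _ fst coordinates (nbhs ab) (nbhs ab.1)); [exact: cvg_fst|exact: cvg_coordinates].
have cutc : continuous cut.
  move=> pb; apply: (@cvg_pair _ _ _ (nbhs pb) (nbhs (truncate pb.1)) (nbhs pb.2)); last exact: cvg_snd.
  by apply: (@cvg_comp _ _ _ fst truncate (nbhs pb) (nbhs pb.1)); [exact: cvg_fst|exact: cvg_truncate].
have emb_cut rs pb : stratum rs pb -> stratum rs (emb (cut pb)).
  by case: pb => p b; apply: stratum_shift; exact: centered_truncate.
apply: (@components_partition _ _ _ (alt_types m l) (fun rs => emb @^-1` stratum rs)).
- move=> rs rsV; split.
  + by have [z Sz] := stratum_nonempty R rsV; exists (cut z); exact: emb_cut.
  + move=> [a b] Sab; apply/very_niceE; split; first by case: Sab.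
    exact: stratum_ordinates_inj Sab.
  + rewrite (_ : _ @^-1` _ = cut @` stratum rs).
      apply: connected_continuous_connected; first exact: stratum_connected.
      exact: continuous_subspaceT.
    apply/seteqP; split=> [ab Sab|_ [z Sz <-]]; last exact: emb_cut.
    by exists (emb ab).
  + exists (emb @^-1` stratum rs).
      apply: open_comp => [x _|]; first exact: embc.
      by rewrite openE => z; exact: stratum_open.
    apply/esym/setIidPr => -[a b] Sab; apply/very_niceE; split; first by case: Sab.
    exact: stratum_ordinates_inj Sab.
- move=> [a b] /very_niceE[hp oi]; exact: (@stratum_cover R m l (coordinates a, b)).
- by move=> rs rs' ab; exact: stratum_disjoint.
Qed.

End VeryNice.

Section DegreeZero.
Variable R : realType.

Lemma very_nice0 l : @very_nice R 0 l = [set _ | (l <= 1)%N].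
Proof.
have u (ab : 'rV[R]_(0 - 2) * 'rV[R]_l) : uniq ([::] ++ [seq (@morse_poly R 0 ab.1).[ab.2 0 i] | i : 'I_l]) = (l <= 1)%N.
  have e (s : seq 'I_l) : [seq (@morse_poly R 0 ab.1).[ab.2 0 i] | i <- s] = nseq (size s) 0.
    by elim: s => //= i s ->; rewrite horner0.
  rewrite cat0s /image_mem e size_enum_ord {e ab}; case: l => [|[|l]] //=.
  by rewrite inE eqxx.
apply/seteqP; split=> ab /=.
  by case=> c _; rewrite tuple0 /= u.
by rewrite -(u ab) => ?; exists [tuple] => //; rewrite deriv0 scale0r.
Qed.

Lemma morsifications0 l : (0 < l)%N -> finite_set (components (@very_nice R 0 l)) /\
  num_morsifications R 0 l = (l == 1%N).
Proof.
move=> l0; rewrite /num_morsifications very_nice0.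
pose V := [set _ : unit | l == 1%N]%SET.
have -> : nat_of_bool (l == 1%N) = #|V|.
  by rewrite /V; case: (l == 1%N); [rewrite cardsT card_unit|rewrite cards0].
apply: (@components_partition _ _ _ V (fun=> setT)).
- move=> [] lV; have {}lV : (l <= 1)%N by move: lV; rewrite inE => /eqP->.
  split; [by exists 0| by []| |].
    by apply: convex_connected.
  by exists setT; [exact: openT|apply/seteqP].
- by move=> x /= l1; exists tt => //; rewrite inE; apply/eqP; lia.
- by move=> [] [].
Qed.

End DegreeZero.

Theorem corollary5p1 (R : realType) (K : nat -> R) (hK : bernoulli_euler K) :
  exists p : nat -> nat -> {poly R},
    (forall k d : nat, (4 <= k)%N -> (d <= k - 1)%N ->
       size (p k d) = (k - d - 1).+1) /\
    (forall n l : nat, (n, l) <> (0%N, 0%N) ->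
       finite_set (components (@very_nice R n l)) /\
       (num_morsifications R n l)%:R =
         int_index K (n%:Z + 2 * l%:Z - 1)
         - (l%:R * (l%:R - 1) / 2 * n%:R
            + (l%:R + 1) * l%:R * (l%:R - 1) / 3)
           * int_index K (n%:Z + 2 * l%:Z - 3)
         + l%:R * (l%:R - 1) * (l%:R - 2) * (l%:R - 3)
           * (1 / 8 * n%:R ^+ 2 + (2 * l%:R + 1) / 12 * n%:R
              + (l%:R + 1) * (5 * l%:R - 2) / 90)
           * int_index K (n%:Z + 2 * l%:Z - 5)
         + \sum_(4 <= k < (l %/ 2 + 1).+1)
             ((- 1) ^+ (k - 1) / (2 ^+ (k - 1) * ((k - 1)`!)%:R)
              * ((l`!)%:R / ((l + 2 - 2 * k)`!)%:R)
              * \sum_(0 <= d < k) (p k d).[l%:R] * n%:R ^+ d)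
             * int_index K (n%:Z + 2 * (l%:Z - k%:Z) + 1)).
Proof.
have [p [sp hp]] := kap_formula (fun n => kappa0 n hK) (fun n => kappa1 n hK) (@kappaSS R).
exists p; split=> // n l nl; rewrite -hp //.
case: n nl => [|n] nl.
  have l0 : (0 < l)%N by case: l nl.
  by have [? ->] := morsifications0 R l0; rewrite kappa_0.
have [? ->] := morsifications_strata R n l; split=> //.
have [nl0|nl0] := posnP (n + l)%N; last by rewrite card_alt_types // kappa_run_count.
rewrite card_alt_types0 //; have [-> ->] : n = 0%N /\ l = 0%N by lia.
by rewrite /kappa /= fact0 mul1r coefD coefX coef1 add0r.
Qed.
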